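(* There exists a finite monoid $\mathbf{M}$ that has an infinite irredundant basis of monoid identities; that is, there is an infinite set $\Sigma$ of monoid identities such that (i) for every monoid identity $\mathbf{u}\approx\mathbf{v}$, $\mathbf{M}$ satisfies $\mathbf{u}\approx\mathbf{v}$ if and only if $\mathbf{u}\approx\mathbf{v}$ is a consequence of $\Sigma$, and (ii) no identity $\sigma\in\Sigma$ is a consequence of $\Sigma\setminus\{\sigma\}$.
   Context: Monoids are considered as algebras in the signature $\{\cdot,1\}$ of type $\langle 2,0\rangle$. Fix a countably infinite alphabet $\mathscr{A}$ of variables; $\mathscr{A}^*$ is the free monoid over $\mathscr{A}$ (including the empty word $1$). A monoid identity is an expression $\mathbf{u}\approx\mathbf{v}$ with $\mathbf{u},\mathbf{v}\in\mathscr{A}^*$. A monoid $\mathbf{M}$ satisfies $\mathbf{u}\approx\mathbf{v}$ if $\mathbf{u}\theta=\mathbf{v}\theta$ for every substitution $\theta:\mathscr{A}\to\mathbf{M}$ (extended to a monoid homomorphism $\mathscr{A}^*\to\mathbf{M}$). An identity is a consequence of a set $\Sigma$ of identities if every monoid satisfying all identities in $\Sigma$ satisfies it. A basis for $\mathbf{M}$ is a set of identities satisfied by $\mathbf{M}$ of which every identity satisfied by $\mathbf{M}$ is a consequence. *)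

(* Defs.v *)
From mathcomp Require Import all_boot all_fingroup.
From mathcomp Require Import boolp classical_sets functions cardinality.

Set Implicit Arguments.
Unset Strict Implicit.
Unset Printing Implicit Defensive.

Local Open Scope classical_set_scope.
Local Open Scope group_scope.

(* The countably infinite alphabet is nat, and the free monoid over it is
   seq nat under concatenation, with unit [::]. *)
Definition word := seq nat.

(* (u, v) stands for the formal identity u ~ v. *)
Definition identity := (word * word)%type.

(* The homomorphic extension of the substitution theta to all words; its value
   at [::] is 1. *)
Definition eval (M : monoidType) (theta : nat -> M) (w : word) : M :=
  \prod_(x <- w) theta x.

Definition satisfies (M : monoidType) (e : identity) : Prop :=
  forall theta : nat -> M, eval theta e.1 = eval theta e.2.

(* The quantifier ranges over all monoids, finite or infinite: the choiceType
   structure underlying monoidType is available on every type by the choice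
   axiom of boolp. *)
Definition consequence (Sigma : set identity) (e : identity) : Prop :=
  forall N : monoidType, (forall s, Sigma s -> satisfies N s) -> satisfies N e.

Definition irredundant (Sigma : set identity) : Prop :=
  forall s, Sigma s -> ~ consequence (Sigma `\ s) s.

(* Main.v *)
Require Import Defs.
From HB Require Import structures.
From mathcomp Require Import all_boot all_fingroup.
From mathcomp Require Import boolp classical_sets functions cardinality.
From mathcomp Require Import zify.

Set Implicit Arguments.
Unset Strict Implicit.
Unset Printing Implicit Defensive.

(** The monoid is the free object on three generators of the variety given by
    the five identities in base. Two of them collapse the letters that occur
    five times or more, so that words on three letters have finitely many
    classes; the other three, exchange 0, 1, 2, allow xyyx to be replaced by
    yxxy in a word that also contains xx and yy away from that factor. An
    identity holds in this monoid if and only if its images under all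
    substitutions by words on three letters are derivable from base
    (monoid_exists).

    For a cycle c on n letters, the cyclic identity cyc_id n c turns every
    block l c(l) c(l) l of the product of these blocks, which are separated by
    letters occurring once, into c(l) l l c(l). To turn one block l by an
    exchange one needs the factor ll, which stands in the block before l on
    the cycle, and the factor c(l) c(l), which appears only when the block of
    c(l) has been turned. So no block can be turned first, and no instance of
    the other identities changes the left side (cyc_id_independent). If one
    letter of the cycle is erased, however, the blocks can be turned one by one,
    backwards from the gap (erased_cycle_deriv); and a substitution by words on
    three letters has to erase one of four letters, up to letters that
    occur five times or more (cyc_sound). Hence the cyclic identities with
    n > 3 hold in the monoid.

    That nothing else is needed is sim_complete. Letters with five or more
    occurrences are removed first. Then the restrictions of both words to
    three letters are derivable from one another, and a finite computation
    (classes_ok) describes how a third letter is placed with respect to two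
    letters whose relative order differs. After letters that always follow each
    other have been contracted, a pair x, y in different order has a factor
    xyyx in the first word, with xx elsewhere, and either yy elsewhere, so
    that an exchange brings x and y into the right order, or a factor yqqy where y
    and q are in different order as well. The chain x, y, q, and so on either
    stops at an exchange or returns to its start after four letters or more
    (chain_cycle), and then its blocks form an instance of a cyclic word. Both
    kinds of steps decrease the number of pairs in different order.

    Finally, redundant members of base are discarded one at a time
    (irredundant_core); the cyclic identities all remain. *)

(** * Equational logic of monoids *)

Definition subst (th : nat -> word) (w : word) : word := flatten (map th w).

Inductive deriv (S : set identity) : word -> word -> Prop :=
| deriv_refl w : deriv S w w
| deriv_step a b th e :
    S e -> deriv S (a ++ subst th e.1 ++ b) (a ++ subst th e.2 ++ b)
| deriv_sym u v : deriv S u v -> deriv S v u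
| deriv_trans v u w : deriv S u v -> deriv S v w -> deriv S u w.

Lemma subst_cat th u v : subst th (u ++ v) = subst th u ++ subst th v.
Proof. by rewrite /subst map_cat flatten_cat. Qed.

Lemma subst_cons th x w : subst th (x :: w) = th x ++ subst th w.
Proof. by []. Qed.

Lemma subst_comp th th' w :
  subst th (subst th' w) = subst (fun x => subst th (th' x)) w.
Proof. by elim: w => //= x w IH; rewrite !subst_cons subst_cat IH. Qed.

Lemma eq_subst th th' w :
  (forall x, x \in w -> th x = th' x) -> subst th w = subst th' w.
Proof. by move=> h; rewrite /subst; congr flatten; apply/eq_in_map. Qed.

Lemma subst_id w : subst (fun x => [:: x]) w = w.
Proof. by elim: w => //= x w IH; rewrite subst_cons IH. Qed.

Lemma filter_subst (p : pred nat) th w :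
  filter p (subst th w) = subst (fun x => filter p (th x)) w.
Proof. by elim: w => //= x w IH; rewrite !subst_cons filter_cat IH. Qed.

Lemma subst_filter th p w :
  (forall x, ~~ p x -> th x = [::]) -> subst th (filter p w) = subst th w.
Proof.
move=> h; elim: w => //= x w IH.
by case px: (p x); rewrite !subst_cons IH // h // px.
Qed.

Lemma filter_as_subst p w : filter p w = subst (fun x => nseq (p x) x) w.
Proof. by elim: w => //= x w IH; rewrite subst_cons -IH; case: (p x). Qed.

Lemma count_subst (a : nat) th w :
  count_mem a (subst th w) = \sum_(x <- w) count_mem a (th x).
Proof.
by elim: w => [|x w IH]; rewrite ?big_nil // big_cons subst_cons count_cat IH.
Qed.

Lemma deriv_cat S a b u v : deriv S u v -> deriv S (a ++ u ++ b) (a ++ v ++ b).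
Proof.
move=> h; elim: h a b => {u v} [w|a' b' th e Se|u v _ IH|v u w _ IH1 _ IH2] a b.
- exact: deriv_refl.
- have E s : a ++ (a' ++ s ++ b') ++ b = (a ++ a') ++ s ++ (b' ++ b) by rewrite -!catA.
  by rewrite !E; apply: deriv_step.
- exact: deriv_sym.
- exact: deriv_trans (IH1 a b) (IH2 a b).
Qed.

Lemma deriv_catl S a u v : deriv S u v -> deriv S (a ++ u) (a ++ v).
Proof. by move=> /(deriv_cat a [::]); rewrite !cats0. Qed.

Lemma deriv_subst S th u v :
  deriv S u v -> deriv S (subst th u) (subst th v).
Proof.
elim=> {u v} [w|a b th' e Se|u v _ IH|v u w _ IH1 _ IH2].
- exact: deriv_refl.
- by rewrite !subst_cat !subst_comp; apply: deriv_step.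
- exact: deriv_sym.
- exact: deriv_trans IH1 IH2.
Qed.

Lemma deriv_id S e : S e -> deriv S e.1 e.2.
Proof.
move=> Se; have := deriv_step [::] [::] (fun x => [:: x]) Se.
by rewrite /= !cats0 !subst_id.
Qed.

Lemma deriv_closed S S' u v :
  (forall e, S e -> deriv S' e.1 e.2) -> deriv S u v -> deriv S' u v.
Proof.
move=> h; elim=> {u v} [w|a b th' e Se|u v _ IH|v u w _ IH1 _ IH2].
- exact: deriv_refl.
- by apply: deriv_cat; apply: deriv_subst; apply: h.
- exact: deriv_sym.
- exact: deriv_trans IH1 IH2.
Qed.

Lemma deriv_mono S S' u v :
  (forall e, S e -> S' e) -> deriv S u v -> deriv S' u v.
Proof. by move=> h; apply: deriv_closed => e /h; exact: deriv_id. Qed.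

(** The condition makes equality with w an invariant of derivations. *)
Lemma deriv_isolated S w :
  (forall a b th e, S e ->
     (w = a ++ subst th e.1 ++ b -> subst th e.1 = subst th e.2) /\
     (w = a ++ subst th e.2 ++ b -> subst th e.1 = subst th e.2)) ->
  forall v, deriv S w v -> v = w.
Proof.
move=> h v d.
have: w = w <-> v = w; last by case=> /(_ erefl).
move: d; move: {1 2}w => u.
elim=> {u v} [//|a b th e Se|u v _ IH|v u u' _ IH1 _ IH2]; last 2 first.
- by split=> /IH.
- by rewrite IH1.
- by case: (h a b th e Se) => h1 h2; split=> E; [rewrite -h1|rewrite h2].
Qed.

Lemma eval_nil (N : monoidType) (th : nat -> N) : eval th [::] = 1%g.
Proof. by rewrite /eval big_nil. Qed.

Lemma eval_cat (N : monoidType) (th : nat -> N) u v :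
  eval th (u ++ v) = (eval th u * eval th v)%g.
Proof. by rewrite /eval big_cat. Qed.

Lemma eval_cons (N : monoidType) (th : nat -> N) x v :
  eval th (x :: v) = (th x * eval th v)%g.
Proof. by rewrite /eval big_cons. Qed.

Lemma eval_subst (N : monoidType) (th : nat -> N) s w :
  eval th (subst s w) = eval (fun x => eval th (s x)) w.
Proof.
elim: w => [|x w IH]; first by rewrite /subst /= !eval_nil.
by rewrite subst_cons eval_cat IH eval_cons.
Qed.

Lemma deriv_sound S u v : deriv S u v -> consequence S (u, v).
Proof.
move=> d N NS th /=; elim: d => {u v} [w|a b s e Se|u v _ IH|v u w _ IH1 _ IH2].
- by [].
- by rewrite !eval_cat !eval_subst (NS _ Se).
- by rewrite IH.
- by rewrite IH1 IH2.
Qed.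

(** ** Quotients of free monoids *)

Record word_congruence (T : choiceType) := WordCongruence {
  wc_rel :> rel (seq T);
  wc_refl : reflexive wc_rel;
  wc_sym : symmetric wc_rel;
  wc_trans : transitive wc_rel;
  wc_cat : forall u u' v v',
    wc_rel u u' -> wc_rel v v' -> wc_rel (u ++ v) (u' ++ v') }.

Definition wc_equiv T (C : word_congruence T) :=
  EquivRel C (wc_refl C) (wc_sym C) (wc_trans (w:=C)).

Definition wquot T (C : word_congruence T) := {eq_quot (wc_equiv C)}%qT.

HB.instance Definition _ T (C : word_congruence T) := Choice.on (wquot C).

Definition wcls T (C : word_congruence T) (w : seq T) : wquot C :=
  (\pi_({eq_quot (wc_equiv C)}%qT) w)%qT.
Definition wrep T (C : word_congruence T) (x : wquot C) : seq T :=
  generic_quotient.repr (x : {eq_quot (wc_equiv C)}%qT).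

Lemma wcls_eq T (C : word_congruence T) u v : wcls C u = wcls C v <-> C u v.
Proof. by split=> [/eqmodP //|h]; apply/eqmodP. Qed.

Lemma wrepK T (C : word_congruence T) (x : wquot C) : wcls C (wrep x) = x.
Proof. exact: reprK. Qed.

Lemma wcls_rep T (C : word_congruence T) u : C (wrep (wcls C u)) u.
Proof. by apply/wcls_eq; rewrite wrepK. Qed.

Definition wmul T (C : word_congruence T) (x y : wquot C) : wquot C :=
  wcls C (wrep x ++ wrep y).

Lemma wmulE T (C : word_congruence T) u v :
  wmul (wcls C u) (wcls C v) = wcls C (u ++ v).
Proof. by apply/wcls_eq; apply: wc_cat; apply: wcls_rep. Qed.

Lemma wmulA T (C : word_congruence T) : associative (@wmul T C).
Proof.
move=> x y z; rewrite -(wrepK x) -(wrepK y) -(wrepK z).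
by rewrite !wmulE catA.
Qed.

Lemma wmul1 T (C : word_congruence T) : left_id (wcls C [::]) (@wmul T C).
Proof. by move=> x; rewrite -(wrepK x) wmulE. Qed.

Lemma wmulr1 T (C : word_congruence T) : right_id (wcls C [::]) (@wmul T C).
Proof. by move=> x; rewrite -(wrepK x) wmulE cats0. Qed.

HB.instance Definition _ T (C : word_congruence T) :=
  isMonoid.Build (wquot C) (@wmulA T C) (@wmul1 T C) (@wmulr1 T C).

Lemma eval_wcls T (C : word_congruence T) (th : nat -> wquot C) w :
  eval th w = wcls C (flatten [seq wrep (th x) | x <- w]).
Proof.
elim: w => [|x w IH]; first by rewrite eval_nil.
by rewrite eval_cons IH /= -[X in (X * _)%g](wrepK (th x)); exact: wmulE.
Qed.

(** For a restricted alphabet T, embedded by g, this is the congruence whose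
    quotient is the free object on T; derivations may leave the image of g. *)
Lemma deriv_congruence_exists (T : choiceType) (g : T -> nat) S :
  exists C : word_congruence T,
    forall u v, C u v <-> deriv S (map g u) (map g v).
Proof.
pose r u v := `[< deriv S (map g u) (map g v) >].
have refl : reflexive r by move=> u; apply/asboolP; exact: deriv_refl.
have sym : symmetric r.
  by move=> u v; apply/asboolP/asboolP; exact: deriv_sym.
have trans : transitive r.
  by move=> v u w /asboolP h /asboolP h'; apply/asboolP; exact: deriv_trans h h'.
have cong u u' v v' : r u u' -> r v v' -> r (u ++ v) (u' ++ v').
  move=> /asboolP h /asboolP h'; apply/asboolP; rewrite !map_cat.
  apply: (deriv_trans (v := map g u' ++ map g v)); last exact: deriv_catl.
  exact: (deriv_cat [::] (map g v) h).
by exists (WordCongruence refl sym trans cong) => u v; split=> /asboolP.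
Qed.

(** Birkhoff completeness: the free monoid modulo derivability is a model, in
    which the identical valuation only equates derivable words. *)
Lemma consequence_deriv S u v : consequence S (u, v) -> deriv S u v.
Proof.
have [C] := deriv_congruence_exists id S; move=> CP h.
have {}CP x y : C x y <-> deriv S x y by rewrite CP !map_id.
have mC e : S e -> satisfies (wquot C) e.
  move=> Se th; rewrite !eval_wcls; apply/wcls_eq/CP.
  by have := deriv_step [::] [::] (fun x => wrep (th x)) Se; rewrite /= !cats0.
have := h _ mC (fun x => wcls C [:: x]); rewrite !eval_wcls /=.
have ev w : C (flatten [seq wrep (wcls C [:: x]) | x <- w]) w.
  elim: w => [|x w IH]; first exact: wc_refl.
  exact: (wc_cat (wcls_rep C [:: x]) IH).
move=> /wcls_eq e; apply/CP; apply: (wc_trans (w := C) _ (ev v)).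
by apply: (wc_trans (w := C) _ e); rewrite (wc_sym C).
Qed.

(** Redundant members of a finite part of a basis can be discarded one at a
    time. *)
Lemma irredundant_core (S : set identity) (F : seq identity) :
  (forall f, f \in F -> ~ S f) ->
  exists F' : seq identity,
    [/\ {subset F' <= F},
        forall e, consequence [set x | x \in F' \/ S x]%classic e <->
                  consequence [set x | x \in F \/ S x]%classic e &
        forall f, f \in F' ->
          ~ consequence ([set x | x \in F' \/ S x] `\ f)%classic f].
Proof.
elim: {F}(size F) {-2}F (leqnn (size F)) => [|n IH] F szF FS.
  by exists [::]; move: szF; rewrite leqn0 => /nilP ->.
have [[f [fF cf]]|irr] := pselect (exists f, f \in F /\
    consequence ([set x | x \in F \/ S x] `\ f)%classic f); last first.
  by exists F; split=> // f fF cf; apply: irr; exists f.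
pose G := filter (predC1 f) F.
have [||F' [sF' bF' iF']] := IH G.
- rewrite -ltnS; apply: leq_trans szF; rewrite size_filter -(count_predC (predC1 f)).
  rewrite -[X in X < _]addn0 ltn_add2l -has_count.
  by apply/hasP; exists f => //=; rewrite eqxx.
- by move=> g; rewrite mem_filter => /andP[_]; exact: FS.
exists F'; split=> // [x /sF'|e]; first by rewrite mem_filter => /andP[].
rewrite bF'; split=> c N NS.
  apply: c => g /= [gG|Sg]; apply: NS; last by right.
  by move: gG; rewrite mem_filter => /andP[_ gF]; left.
apply: c => g /= FSg.
have NG h : h \in G \/ S h -> satisfies N h by exact: NS.
have [->|/eqP gf] := eqVneq g f.
  apply: cf => h [] /= FSh hf; apply: NG; case: FSh => [hF|Sh]; last by right.
  by left; rewrite mem_filter hF andbT /=; apply/eqP.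
apply: NG; case: FSg => [gF|Sg]; last by right.
by left; rewrite mem_filter gF andbT /=; apply/eqP.
Qed.

(** * The finite part of the basis *)

Definition arrange (k : nat) (L A B t s : word) : word :=
  match k with
  | 0 => L ++ t ++ A ++ s ++ B
  | 1 => A ++ t ++ L ++ s ++ B
  | _ => A ++ t ++ B ++ s ++ L
  end.

(** Five occurrences of a letter can be gathered in front of the letters 2 to 6,
    which are what stands before and between them. *)
Definition collapse : identity :=
  ([:: 2; 0; 3; 0; 4; 0; 5; 0; 6; 0], [:: 0; 0; 0; 0; 0; 2; 3; 4; 5; 6]).

Definition power_stable : identity := (nseq 6 0, nseq 5 0).

(** The squares of 0 and 1 make the exchange possible; 2 and 3 fill the space
    between the three blocks, and k is the place of the exchanged one. *)
Definition exchange (k : nat) : identity :=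
  (arrange k [:: 0; 1; 1; 0] [:: 0; 0] [:: 1; 1] [:: 2] [:: 3],
   arrange k [:: 1; 0; 0; 1] [:: 0; 0] [:: 1; 1] [:: 2] [:: 3]).

Definition base : seq identity :=
  [:: collapse; power_stable; exchange 0; exchange 1; exchange 2].

Definition baseS : set identity := [set e | e \in base]%classic.

Lemma subst_arrange th k L A B t s :
  subst th (arrange k L A B t s) =
  arrange k (subst th L) (subst th A) (subst th B) (subst th t) (subst th s).
Proof. by case: k => [|[|k]]; rewrite /= !subst_cat. Qed.

Lemma exchange_deriv k X Y t s :
  deriv baseS (arrange k (X ++ Y ++ Y ++ X) (X ++ X) (Y ++ Y) t s)
              (arrange k (Y ++ X ++ X ++ Y) (X ++ X) (Y ++ Y) t s).
Proof.
wlog: k / k < 3 => [h|k3].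
  by case: (ltnP k 3) => [/h//|]; case: k => [|[|k]] //= _; exact: (h 2).
have Sk : baseS (exchange k).
  by rewrite /baseS /=; case: k k3 => [|[|[|k]]]; rewrite // !inE eqxx ?orbT.
pose th x := nth [::] [:: X; Y; t; s] x.
have := deriv_step [::] [::] th Sk.
by rewrite /= !cats0 !subst_arrange /subst /= !cats0.
Qed.

Lemma infix_double_split (x y : nat) (s1 s2 : word) :
  x != y -> infix [:: y; y] (s1 ++ x :: s2) ->
  infix [:: y; y] s1 \/ infix [:: y; y] s2.
Proof.
move=> xy; elim: s1 => [|z s1 IH].
  by rewrite cat0s infix_consl /= eq_sym (negPf xy) /=; right.
rewrite cat_cons.
rewrite !infix_consl => /orP[|/IH[->|->]]; last 2 first.
- by rewrite orbT; left.
- by right.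
case: s1 {IH} => [|z' s1] /=; last by rewrite !prefix0s => ->; left.
by rewrite [y == x]eq_sym (negPf xy) andbF.
Qed.

Lemma infix_doubles (x y : nat) (s : word) :
  x != y -> infix [:: x; x] s -> infix [:: y; y] s ->
  (exists a t b, s = a ++ [:: x; x] ++ t ++ [:: y; y] ++ b) \/
  (exists a t b, s = a ++ [:: y; y] ++ t ++ [:: x; x] ++ b).
Proof.
move=> xy /infixP[a [b ->]] /= h.
case: (infix_double_split xy h) => [/infixP[a1 [a2 ->]]|h2].
  by right; exists a1, a2, b; rewrite -!catA.
have /orP[|/infixP[b1 [b2 ->]]] : prefix [:: y; y] (x :: b) || infix [:: y; y] b.
- by rewrite -infix_consl.
- by rewrite /= eq_sym (negPf xy).
- by left; exists a, b1, b2.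
Qed.

Definition flanked (x : nat) (a b : word) : Prop :=
  infix [:: x; x] a \/ infix [:: x; x] b.

(** The three exchange identities place 00 before 11; the other order of the
    squares is obtained by reading an identity from right to left with the
    names of 0 and 1 interchanged. *)
Lemma exchange_letters (x y : nat) (a b : word) :
  x != y -> flanked x a b -> flanked y a b ->
  deriv baseS (a ++ [:: x; y; y; x] ++ b) (a ++ [:: y; x; x; y] ++ b).
Proof.
move=> xy fx fy.
have yx : y != x by rewrite eq_sym.
have main z w a1 t s b1 k : 
    deriv baseS (a1 ++ arrange k [:: z; w; w; z] [:: z; z] [:: w; w] t s ++ b1)
                (a1 ++ arrange k [:: w; z; z; w] [:: z; z] [:: w; w] t s ++ b1).
  by apply: deriv_cat; exact: (exchange_deriv k [:: z] [:: w]).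
have main' z w a1 t s b1 k : 
    deriv baseS (a1 ++ arrange k [:: z; w; w; z] [:: w; w] [:: z; z] t s ++ b1)
                (a1 ++ arrange k [:: w; z; z; w] [:: w; w] [:: z; z] t s ++ b1).
  by apply: deriv_sym; exact: main.
case: fx fy => [xa|xb] [ya|yb].
- case: (infix_doubles xy xa ya) => -[a1 [t [s ->]]].
    by have := main x y a1 t s b 2; rewrite /arrange -!catA.
  by have := main' x y a1 t s b 2; rewrite /arrange -!catA.
- case/infixP: xa => a1 [t ->]; case/infixP: yb => s [b1 ->].
  by have := main x y a1 t s b1 1; rewrite /arrange -!catA.
- case/infixP: ya => a1 [t ->]; case/infixP: xb => s [b1 ->].
  by have := main' x y a1 t s b1 1; rewrite /arrange -!catA.
- case: (infix_doubles xy xb yb) => -[t [s [b1 ->]]].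
    by have := main x y a t s b1 0; rewrite /arrange -!catA.
  by have := main' x y a t s b1 0; rewrite /arrange -!catA.
Qed.

(** An instance of collapse with four empty gaps moves x^5 across a letter. *)
Lemma power_absorbs (x : nat) (w : word) :
  deriv baseS (nseq 5 x ++ w) (nseq 5 x ++ filter (predC1 x) w).
Proof.
elim: w => [|y w IH]; first exact: deriv_refl.
have [->|yx] := eqVneq y x.
  rewrite /= eqxx /=; apply: deriv_trans IH.
  have Sp : baseS power_stable by rewrite /baseS /= !inE eqxx ?orbT.
  exact: (deriv_step [::] w (fun=> [:: x]) Sp).
have swap v : deriv baseS (nseq 5 x ++ y :: v) (y :: nseq 5 x ++ v).
  have Sc : baseS collapse by rewrite /baseS /= !inE eqxx ?orbT.
  pose th i := if i == 0 then [:: x] else if i == 2 then [:: y] else [::].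
  by apply: deriv_sym; exact: (deriv_step [::] v th Sc).
rewrite [filter _ _]/= yx; apply: deriv_trans (swap w) _.
apply: deriv_trans (deriv_sym (swap _)).
exact: (deriv_catl [:: y] IH).
Qed.

Lemma kill_letter (x : nat) (w : word) :
  4 < count_mem x w ->
  deriv baseS w (nseq 5 x ++ filter (predC1 x) w).
Proof.
have split2 n (v : word) : n < count_mem x v ->
    exists t v' : word, v = t ++ x :: v' /\ n <= count_mem x v'.
  elim: v => //= y v IH; have [->|yx] := eqVneq y x.
    by rewrite add1n ltnS => h; exists [::], v.
  by rewrite add0n => /IH[t [v' [-> h]]]; exists (y :: t), v'.
move=> /split2[t0 [w0 [-> /split2[t1 [w1 [-> /split2[t2 [w2 [-> /split2[t3
  [w3 [-> /split2[t4 [w4 [-> _]]]]]]]]]]]]]]].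
have Sc : baseS collapse by rewrite /baseS /= !inE eqxx ?orbT.
pose th i := nth [::] [:: [:: x]; [::]; t0; t1; t2; t3; t4] i.
have := deriv_step [::] w4 th Sc.
have -> : [::] ++ subst th collapse.2 ++ w4 =
          nseq 5 x ++ (t0 ++ t1 ++ t2 ++ t3 ++ t4 ++ w4).
  by rewrite /collapse /subst /th /= -!catA.
have -> : [::] ++ subst th collapse.1 ++ w4 =
   t0 ++ x :: t1 ++ x :: t2 ++ x :: t3 ++ x :: t4 ++ x :: w4.
  by rewrite /collapse /subst /th /= -!catA /= -!catA /= -!catA /= -!catA /= -!catA.
move=> d; apply: deriv_trans d _; apply: deriv_trans (power_absorbs _ _) _.
by do 5!rewrite !filter_cat /= eqxx /=; exact: deriv_refl.
Qed.

Lemma kill_letters (E : seq nat) (w : word) :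
  uniq E -> (forall x, x \in E -> 4 < count_mem x w) ->
  deriv baseS w
    (flatten [seq nseq 5 x | x <- E] ++ filter [predC E] w).
Proof.
elim: E w => [|x E IH] w /=.
  by rewrite filter_predT => _ _; exact: deriv_refl.
move=> /andP[xE uE] h.
have hx : 4 < count_mem x w by apply: h; rewrite inE eqxx.
apply: deriv_trans (kill_letter hx) _.
apply: (deriv_catl (nseq 5 x)).
have -> : filter [predC x :: E] w = filter [predC E] (filter (predC1 x) w).
  rewrite -filter_predI; apply: eq_filter => y /=.
  by rewrite !inE negb_or andbC.
apply: IH => // y yE; rewrite count_filter.
rewrite (@eq_count _ _ (pred1 y)); first by apply: h; rewrite inE yE orbT.
move=> z /=; have [->|//] := eqVneq z y; rewrite /=.
by apply: contraNneq xE => <-.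
Qed.

(** Each identity of base is balanced, except for letters that occur at least
    five times on both sides. *)
Lemma base_count_min (a : nat) (u v : word) :
  deriv baseS u v -> minn 5 (count_mem a u) = minn 5 (count_mem a v).
Proof.
elim=> {u v} [//|p q th e Se|//|v u w _ -> _ ->//].
have: minn 5 (count_mem a (subst th e.1)) = minn 5 (count_mem a (subst th e.2)).
  move: Se; rewrite /baseS /= !inE.
  case/or4P=> [/eqP->|/eqP->|/eqP->|/orP[]/eqP->];
    rewrite /subst /= ?cats0 !count_cat /=.
  - move: (count_mem a (th 0)) (count_mem a (th 2)) (count_mem a (th 3)).
    by move: (count_mem a (th 4)) (count_mem a (th 5)) (count_mem a (th 6)); lia.
  - by move: (count_mem a (th 0)) => c; lia.
  1-3: move: (count_mem a (th 0)) (count_mem a (th 1)) (count_mem a (th 2)).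
  1-3: by move: (count_mem a (th 3)); lia.
rewrite !count_cat; move: (count_mem a _) (count_mem a _) => c c'.
by move: (count_mem a _) (count_mem a _); lia.
Qed.

(** * The cyclic identities *)

(** The block of l, turned where fl holds; n + l is a letter of its own that
    separates this block from the next one. *)
Definition cell (n : nat) (c : nat -> nat) (fl : pred nat) (l : nat) : word :=
  (if fl l then [:: c l; l; l; c l] else [:: l; c l; c l; l]) ++ [:: n + l].

Definition cyc_word n c fl : word := flatten [seq cell n c fl l | l <- iota 0 n].

Definition cyc_id n c : identity := (cyc_word n c pred0, cyc_word n c predT).

Definition is_cycle (n : nat) (c : nat -> nat) : Prop :=
  (forall i, i < n -> c i < n) /\
  (forall i j, i < n -> j < n -> exists m, iter m c i = j).

Lemma cycle_surj n c : is_cycle n c ->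
  forall i, i < n -> exists2 j, j < n & c j = i.
Proof.
case=> cn cc i ilt; have [m mi] := cc _ _ (cn _ ilt) ilt.
exists (iter m c i); last by rewrite -iterS iterSr.
by elim: m {mi} => //= m IH; exact: cn.
Qed.

(** A surjection of a finite set onto itself is injective. *)
Lemma cycle_inj n c : is_cycle n c ->
  forall i j, i < n -> j < n -> c i = c j -> i = j.
Proof.
move=> cyc i j ilt jlt; have [cn _] := cyc.
pose f (x : 'I_n) : 'I_n := Ordinal (cn x (ltn_ord x)).
have fs : forall y : 'I_n, y \in codom f.
  move=> y; have [z zlt zy] := cycle_surj cyc (ltn_ord y).
  by apply/codomP; exists (Ordinal zlt); apply/val_inj.
have/injectiveP finj : injectiveb f.
  rewrite /injectiveb /dinjectiveb -/(codom f) ; apply/card_uniqP.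
  rewrite size_codom; apply: eq_card => y; exact: fs.
move=> cij; have fij : f (Ordinal ilt) = f (Ordinal jlt) by exact: val_inj.
by case: (finj _ _ fij).
Qed.

Lemma cycle_neq n c i : is_cycle n c -> 1 < n -> i < n -> c i != i.
Proof.
move=> [_ cc] n1 ilt; apply/eqP => ci.
have fix_i m : iter m c i = i by elim: m => //= m ->.
have [m] := cc i (i == 0 : nat) ilt (leq_ltn_trans (leq_b1 _) n1).
by rewrite fix_i; case: i ilt ci {fix_i}.
Qed.

Lemma iota_split n i : i < n ->
  iota 0 n = iota 0 i ++ i :: iota i.+1 (n - i.+1).
Proof.
by move=> ilt; rewrite -[in LHS](subnKC ilt) addSnnS iotaD.
Qed.

Lemma eq_cells n c fl fl' s : {in s, fl =1 fl'} ->
  [seq cell n c fl l | l <- s] = [seq cell n c fl' l | l <- s].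
Proof. by move=> h; apply/eq_in_map => l ls; rewrite /cell h. Qed.

Lemma infix_flatten (s : seq word) (f w : word) :
  w \in s -> infix f w -> infix f (flatten s).
Proof.
move=> ws fw; case/splitPr: ws => s1 s2; rewrite flatten_cat /=.
by apply: infix_catl; apply: infix_catr.
Qed.

Lemma filter_cyc_eq n c fl fl' (P : pred nat) :
  (forall l, l < n -> filter P (cell n c fl l) = filter P (cell n c fl' l)) ->
  filter P (cyc_word n c fl) = filter P (cyc_word n c fl').
Proof.
move=> h; rewrite /cyc_word !filter_flatten -!map_comp; congr flatten.
by apply/eq_in_map => l; rewrite mem_iota /= add0n => /h.
Qed.

(** The block of i is turned by an exchange as soon as the squares of i and of
    c i stand in other blocks. Passing to the letters in P covers the case
    where a letter has been erased. *)
Lemma cyc_word_exchange n c (fl fl' P : pred nat) i l1 l2 :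
  i < n -> l1 < n -> l2 < n -> l1 != i -> l2 != i ->
  fl i = false -> fl' i -> (forall l, l < n -> l != i -> fl l = fl' l) ->
  P i -> P (c i) -> i != c i ->
  infix [:: i; i] (filter P (cell n c fl l1)) ->
  infix [:: c i; c i] (filter P (cell n c fl l2)) ->
  deriv baseS (filter P (cyc_word n c fl)) (filter P (cyc_word n c fl')).
Proof.
move=> ilt l1n l2n l1i l2i fli fl'i flE Pi Pci ici inf1 inf2.
pose A := iota 0 i; pose B := iota i.+1 (n - i.+1).
have iA : i \notin A by rewrite mem_iota ltnn andbF.
have iB : i \notin B by rewrite mem_iota ltnn.
have AB l : l < n -> l != i -> (l \in A) || (l \in B).
  by rewrite !mem_iota; move=> h1 /eqP h2; lia.
have ABn l : l \in A -> l < n by rewrite mem_iota; lia.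
have ABn' l : l \in B -> l < n by rewrite mem_iota; lia.
pose F s := filter P (flatten [seq cell n c fl l | l <- s]).
have FE g : filter P (cyc_word n c g) =
    filter P (flatten [seq cell n c g l | l <- A]) ++
    filter P (cell n c g i) ++
    filter P (flatten [seq cell n c g l | l <- B]).
  by rewrite /cyc_word (iota_split ilt) map_cat flatten_cat /= !filter_cat.
rewrite !FE.
rewrite -(@eq_cells n c fl fl' A); last first.
  by move=> l lA; rewrite flE ?(ABn _ lA) //; apply: contraNneq iA => <-.
rewrite -(@eq_cells n c fl fl' B); last first.
  by move=> l lB; rewrite flE ?(ABn' _ lB) //; apply: contraNneq iB => <-.
rewrite /cell fli fl'i /= Pi Pci -/(F A) -/(F B).
pose pin := filter P [:: n + i].
have fl_inf z l : l < n -> l != i -> infix [:: z; z] (filter P (cell n c fl l)) ->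
    flanked z (F A) (pin ++ F B).
  move=> ln li inf; have key s : l \in s -> infix [:: z; z] (F s).
    move=> ls; rewrite /F filter_flatten -map_comp.
    by apply: infix_flatten inf; apply/mapP; exists l.
  case/orP: (AB l ln li) => /key; first by left.
  by move=> h; right; apply: infix_catl.
have := exchange_letters ici (fl_inf _ _ l1n l1i inf1) (fl_inf _ _ l2n l2i inf2).
by rewrite /pin /=; case: (P (n + i)).
Qed.

(** Without the letter j, the block of the letter before j on the cycle is a
    square and need not be turned. Going backwards along the cycle, the next
    block always finds one of its two squares in the block turned last, the
    other one in the block that is still to come. *)
Lemma erased_cycle_deriv n c j :
  1 < n -> is_cycle n c -> j < n ->
  deriv baseS (filter (predC1 j) (cyc_word n c pred0))
              (filter (predC1 j) (cyc_word n c predT)).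
Proof.
move=> n1 cyc jn; have [cn cc] := cyc.
pose P : pred nat := fun x => x != j.
rewrite -!(@eq_filter _ P) //.
(* d i is the number of steps from i to j along the cycle; the blocks at
   distance 1, 2, ... are turned in this order. *)
have [d dP] : exists d : nat -> nat, forall i, i < n ->
    iter (d i) c i = j /\ forall m, iter m c i = j -> d i <= m.
  have /choice[d dP] : forall i, exists m, i < n ->
      iter m c i = j /\ forall m', iter m' c i = j -> m <= m'.
    move=> i; case: (ltnP i n) => [ilt|]; last by exists 0.
    have ex : exists m, iter m c i == j.
      by have [m mE] := cc i j ilt jn; exists m; apply/eqP.
    exists (ex_minn ex) => _; case: ex_minnP => m /eqP mE mmin; split=> //.
    by move=> m' /eqP; exact: mmin.
  by exists d.
have d0 i : i < n -> (d i == 0) = (i == j).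
  move=> ilt; have [dE dmin] := dP i ilt; apply/eqP/eqP => [di|ij].
    by rewrite di in dE.
  by apply/eqP; rewrite -leqn0; apply: dmin.
have dS i : i < n -> i != j -> d i = (d (c i)).+1.
  move=> ilt ij; have [dE dmin] := dP i ilt; have [dE' dmin'] := dP _ (cn _ ilt).
  have := d0 i ilt; rewrite (negPf ij); case: (d i) dE dmin => // k dE dmin _.
  congr S; apply/eqP; rewrite eqn_leq; apply/andP; split.
    by rewrite -ltnS; apply: dmin; rewrite iterSr.
  by apply: dmin'; rewrite -iterSr.
have dinj k : forall i i', i < n -> i' < n -> d i = k -> d i' = k -> i = i'.
  elim: k => [|k IH] i i' ilt i'lt di di'.
    by move/eqP: di di'; rewrite d0 // => /eqP-> /eqP; rewrite d0 // => /eqP.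
  have ij : i != j by rewrite -d0 // di.
  have i'j : i' != j by rewrite -d0 // di'.
  move: (dS _ ilt ij) (dS _ i'lt i'j); rewrite di di' => -[e] [e'].
  exact: cycle_inj cyc _ _ ilt i'lt (IH _ _ (cn _ ilt) (cn _ i'lt) (esym e) (esym e')).
pose fl k : pred nat := fun i => (0 < d i) && (d i <= k).
have P2 (Q : pred nat) i x : Q i = false ->
    filter Q [:: x; i; i; x] = filter Q [:: i; x; x; i].
  by move=> Qi; rewrite /= Qi; case: (Q x).
have step k : deriv baseS (filter P (cyc_word n c (fl k)))
                          (filter P (cyc_word n c (fl k.+1))).
  have [[i [ilt di]]|no] := pselect (exists i, i < n /\ d i = k.+1); last first.
    rewrite (@filter_cyc_eq _ _ (fl k) (fl k.+1)); first exact: deriv_refl.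
    move=> i ilt; rewrite /cell; suff -> : fl k i = fl k.+1 i by [].
    rewrite /fl; congr andb; rewrite [RHS]leq_eqVlt ltnS; case: eqP => // e.
    by case: no; exists i.
  have ij : i != j by rewrite -d0 // di.
  have ici : i != c i by rewrite eq_sym (cycle_neq cyc).
  have dci : d (c i) = k by move: (dS _ ilt ij); rewrite di => -[].
  have fli : fl k i = false by rewrite /fl di ltnn.
  have fl'i : fl k.+1 i by rewrite /fl di leqnn.
  have flE l : l < n -> l != i -> fl k l = fl k.+1 l.
    move=> ln li; rewrite /fl; congr andb; rewrite [RHS]leq_eqVlt ltnS.
    by case: eqP => // e; case/eqP: li; exact: dinj e di.
  have [cij|cij] := eqVneq (c i) j.
    rewrite (@filter_cyc_eq _ _ (fl k) (fl k.+1)); first exact: deriv_refl.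
    move=> l ln; have [->|li] := eqVneq l i; last by rewrite /cell flE.
    by rewrite /cell fli fl'i !filter_cat cij P2 // /P eqxx.
  have [x' x'n cx'] := cycle_surj cyc ilt.
  have x'i : x' != i by apply: contraNneq ici => e; rewrite -{2}e cx'.
  apply: (@cyc_word_exchange n c (fl k) (fl k.+1) P i x' (c i)) => //.
  - exact: cn.
  - by rewrite eq_sym.
  - have Pi : P i by [].
    rewrite /cell; have -> : fl k x' = false.
      have [->|x'j] := eqVneq x' j; first by rewrite /fl; have := d0 j jn; rewrite eqxx => /eqP->.
      by rewrite /fl (dS _ x'n x'j) cx' di; lia.
    rewrite filter_cat; apply: infix_catr; rewrite cx' /= Pi.
    by case: (P x'); rewrite /= ?eqxx ?orbT.
  - have fc : fl k (c i) by rewrite /fl dci leqnn andbT -dci lt0n d0 ?cn // cij.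
    rewrite /cell fc filter_cat; apply: infix_catr => /=.
    by have -> : P (c i) by []; case: (P (c (c i))); rewrite /= ?eqxx ?orbT.
have all_steps k : deriv baseS (filter P (cyc_word n c (fl 0)))
                               (filter P (cyc_word n c (fl k))).
  elim: k => [|k IH]; first exact: deriv_refl.
  exact: deriv_trans IH (step k).
have -> : filter P (cyc_word n c pred0) = filter P (cyc_word n c (fl 0)).
  by apply: filter_cyc_eq => i ilt; rewrite /cell /fl /=; case: (d i).
have -> : filter P (cyc_word n c predT) =
          filter P (cyc_word n c (fl (\sum_(i < n) d i))).
  apply: filter_cyc_eq => i ilt; rewrite /cell /fl.
  have -> : d i <= \sum_(i < n) d i.
    by rewrite (bigD1 (Ordinal ilt)) //= leq_addr.
  rewrite andbT lt0n d0 //; have [->|//] := eqVneq i j.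
  by rewrite !filter_cat P2 // /P eqxx.
exact: all_steps.
Qed.

(** * The finite monoid *)

Definition code (th : nat -> seq 'I_3) (x : nat) : word := map val (th x).

(** The monoid consists of the words on three letters modulo base. It is finite
    because every class has a member in which each letter occurs at most five
    times. *)
Lemma monoid_exists : exists M : monoidType, finite_set [set: M]%classic /\
  forall e, satisfies M e <->
    forall th, deriv baseS (subst (code th) e.1) (subst (code th) e.2).
Proof.
have [C CP] := deriv_congruence_exists (val : 'I_3 -> nat) baseS.
exists (wquot C); split; last first.
  move=> e; split=> [h th|h th].
    have := h (fun x => wcls C (th x)); rewrite !eval_wcls => /wcls_eq /CP.
    have ev w : deriv baseS (subst (code th) w) (map val
        (flatten [seq wrep (wcls C (th x)) | x <- w])).
      elim: w => [|x w IH]; first exact: deriv_refl.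
      rewrite subst_cons /= map_cat.
      have hx : deriv baseS (code th x) (map val (wrep (wcls C (th x)))).
        by apply: deriv_sym; apply/CP; exact: wcls_rep.
      exact: deriv_trans (deriv_cat [::] _ hx) (deriv_catl _ IH).
    move=> d; apply: deriv_trans (ev _) _; apply: deriv_trans d _.
    by apply: deriv_sym; exact: ev.
  rewrite !eval_wcls; apply/wcls_eq/CP.
  have := h (fun x => wrep (th x)).
  by rewrite /subst /code !map_flatten -!map_comp.
pose short := [set wcls C (val t) | t in [set: 16.-bseq 'I_3]]%classic.
apply: (@sub_finite_set _ _ short); last by apply: finite_image; exact: finite_finset.
move=> x _; rewrite -(wrepK x); set w := wrep x.
pose E := [seq a <- enum 'I_3 | 4 < count_mem a w].
pose w' := flatten [seq nseq 5 a | a <- E] ++ filter [predC E] w.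
have vE (a b : 'I_3) : (val a == val b) = (a == b) by rewrite (inj_eq val_inj).
have Cw : C w w'.
  apply/CP; have h5 y : y \in map val E -> 4 < count_mem y (map val w).
    case/mapP => a; rewrite mem_filter => /andP[ha _] ->.
    by rewrite count_map (@eq_count _ _ (pred1 a)) // => b; rewrite /= vE.
  have uE : uniq (map val E).
    by rewrite (map_inj_uniq val_inj) filter_uniq // enum_uniq.
  have := kill_letters uE h5; rewrite /w' map_cat map_flatten -!map_comp filter_map.
  by rewrite (@eq_filter _ _ [predC E]) // => a; rewrite /= (mem_map val_inj).
have cnt5 (a : 'I_3) (s : seq 'I_3) :
    count_mem a (flatten [seq nseq 5 b | b <- s]) = 5 * count_mem a s.
  elim: s => //= b s ->; case: (b == a); lia.
have uE0 : uniq E by rewrite filter_uniq // enum_uniq.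
have cnt a : count_mem a w' <= 5.
  rewrite count_cat cnt5 (count_uniq_mem a uE0) count_filter.
  case: (boolP (a \in E)) => aE.
    rewrite (@eq_count _ _ pred0) ?count_pred0 // => b /=.
    by have [->|//] := eqVneq b a; rewrite aE.
  rewrite muln0 add0n; apply: (@leq_trans (count_mem a w)).
    by apply: sub_count => b /= /andP[].
  by move: aE; rewrite mem_filter mem_enum andbT; lia.
have szE (s : seq 'I_3) : size s = \sum_a count_mem a s.
  elim: s => [|b s IH] /=; first by rewrite big1.
  by rewrite big_split /= -IH (bigD1 b) //= eqxx big1 // => a /negPf; rewrite eq_sym => ->.
have sz : size w' <= 15.
  rewrite szE; apply: (@leq_trans (\sum_(a < 3) 5)); first exact: leq_sum.
  by rewrite sum_nat_const card_ord.
by exists (Bseq (leqW sz)) => //=; apply/wcls_eq; rewrite (wc_sym C).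
Qed.

Lemma count_cyc_word n c fl (a : nat) :
  count_mem a (cyc_word n c fl) =
  \sum_(l < n) (((l == a :> nat) + (c l == a)).*2 + (n + l == a)).
Proof.
rewrite /cyc_word count_flatten sumnE big_map big_map -[n in iota 0 n]subn0.
rewrite -/(index_iota 0 n) big_mkord; apply: eq_bigr => l _.
by rewrite /cell count_cat /= addn0; case: (fl l) => /=; lia.
Qed.

(** Turning blocks permutes letters, so both sides lose the same letters when
    those with five or more occurrences are collapsed. *)
Lemma perm_cyc_word n c fl fl' :
  perm_eq (cyc_word n c fl) (cyc_word n c fl').
Proof. by apply/allP => a _ /=; rewrite !count_cyc_word. Qed.

Lemma count_cyc_letter n c fl (i : nat) :
  is_cycle n c -> i < n -> count_mem i (cyc_word n c fl) = 4.
Proof.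
move=> cyc ilt; rewrite count_cyc_word big_split /= [X in _ + X]big1 ?addn0; last first.
  by move=> l _; case: eqP => // e; lia.
transitivity ((\sum_(l < n) (l == i :> nat) + \sum_(l < n) (c l == i)).*2).
  by rewrite -big_split (big_morph double doubleD (erefl : 0.*2 = 0)).
have -> : \sum_(l < n) (l == i :> nat) = 1.
  rewrite (bigD1 (Ordinal ilt)) //= eqxx big1 // => l.
  by rewrite -val_eqE /= => /negPf ->.
have [j jn cj] := cycle_surj cyc ilt.
have -> // : \sum_(l < n) (c l == i) = 1.
rewrite (bigD1 (Ordinal jn)) //= cj eqxx big1 // => l.
rewrite -val_eqE /= => lj; case: eqP => // cl; case/eqP: lj.
by apply: (cycle_inj cyc) => //; rewrite cl cj.
Qed.

Lemma count_cyc_pin n c fl (l : nat) :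
  is_cycle n c -> n <= l -> count_mem l (cyc_word n c fl) <= 1.
Proof.
move=> [cn _] nl; rewrite count_cyc_word.
rewrite (eq_bigr (fun i : 'I_n => (n + i == l) : nat)); last first.
  move=> i _; have := ltn_ord i; have := cn i (ltn_ord i).
  by do 2![case: eqP => /= ?]; lia.
case: (ltnP (l - n) n) => h; last first.
  by rewrite big1 // => i _; have := ltn_ord i; case: eqP => //; lia.
rewrite (bigD1 (Ordinal h)) //= big1 => [|i]; first by case: eqP.
by rewrite -val_eqE /= => ih; case: eqP => // e; case/eqP: ih; lia.
Qed.

(** After the removal of the letters with five or more occurrences, no letter of
    the alphabet of three can occur in the images of two letters of the cycle,
    each of which occurs four times. So one of the four or more images is
    empty, and the cycle is broken there. *)
Lemma cyc_sound n c (th : nat -> seq 'I_3) :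
  3 < n -> is_cycle n c ->
  deriv baseS (subst (code th) (cyc_word n c pred0))
              (subst (code th) (cyc_word n c predT)).
Proof.
move=> n3 cyc; set u := subst _ _; set v := subst _ _.
have cuv a : count_mem a u = count_mem a v.
  by rewrite !count_subst; apply: perm_big; exact: perm_cyc_word.
pose E := [seq a <- undup u | 4 < count_mem a u].
have uE : uniq E by rewrite filter_uniq // undup_uniq.
have Eu a : a \in E -> 4 < count_mem a u by rewrite mem_filter => /andP[].
have Ev a : a \in E -> 4 < count_mem a v by move=> /Eu; rewrite cuv.
apply: deriv_trans (kill_letters uE Eu) _.
apply: deriv_trans (deriv_sym (kill_letters uE Ev)).
apply: deriv_catl; rewrite !filter_subst.
pose th' x := filter [predC E] (code th x).
have cnt' a : count_mem a (subst th' (cyc_word n c pred0)) <= 4.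
  rewrite /th' -filter_subst -/u count_filter; have [aE|aE] := boolP (a \in E).
    rewrite (@eq_count _ _ pred0) ?count_pred0 // => b /=.
    by have [->|//] := eqVneq b a; rewrite aE.
  have [au|au] := boolP (a \in u).
    apply: (@leq_trans (count_mem a u)); first by apply: sub_count => b /= /andP[].
    by move: aE; rewrite mem_filter mem_undup au andbT; lia.
  rewrite (@leq_trans (count_mem a u)) //.
    by apply: sub_count => b /= /andP[].
  by rewrite (count_memPn au).
have [j jn thj] : exists2 j, j < n & th' j = [::].
  have [//|no] := pselect (exists2 j, j < n & th' j = [::]).
  have mem_th' i a : a \in th' i -> a < 3.
    by rewrite mem_filter => /andP[_ /mapP[b _ ->]]; exact: ltn_ord.
  have hd (i : 'I_n) : {a : 'I_3 | val a \in th' i}.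
    case e : (th' i) => [|a s]; first by case: no; exists i.
    have alt : a < 3 by apply: (@mem_th' i); rewrite e inE eqxx.
    by exists (Ordinal alt); rewrite inE eqxx.
  pose f i := sval (hd i).
  have f_inj : injective f.
    move=> i i' fii; have [//|ii] := eqVneq i i'; exfalso.
    have h := svalP (hd i); have h' := svalP (hd i'); rewrite -/(f i) in h.
    rewrite -/(f i') -fii in h'.
    have := cnt' (val (f i)); rewrite count_subst leqNgt => /negP[].
    apply: (@leq_trans (\sum_(x <- cyc_word n c pred0) ((x == val i) + (x == val i')))).
      have sumE (a : 'I_n) : \sum_(x <- cyc_word n c pred0) (x == val a : nat) = 4.
        rewrite -(count_cyc_letter pred0 cyc (ltn_ord a)) -sum1_count [RHS]big_mkcond.
        by apply: eq_bigr => x _ /=; case: eqP.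
      by rewrite big_split /= !sumE.
    apply: leq_sum => x _.
    have [->|xi] := eqVneq x (val i).
      by rewrite (negPf (_ : val i != val i')) // addn0 -has_count has_pred1.
    by have [->|//] := eqVneq x (val i'); rewrite add0n -has_count has_pred1.
  by have := leq_card f f_inj; rewrite !card_ord leqNgt n3.
have th0 x : ~~ predC1 j x -> th' x = [::] by move=> /negPn /eqP ->.
rewrite -/th' -(subst_filter (cyc_word n c pred0) th0).
rewrite -(subst_filter (cyc_word n c predT) th0).
by apply: deriv_subst; apply: erased_cycle_deriv => //; lia.
Qed.

(** * Independence of the cyclic identities *)

(** A cycle and its inverse have the same identity up to renaming and exchange
    of the sides. The condition on the neighbours of 0 keeps one of the two. *)
Definition canonical_cycle (n : nat) (c : nat -> nat) : Prop :=
  [/\ 3 < n, is_cycle n c & exists k, [/\ k < n, c k = 0 & c 0 < k]].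

Definition cycS : set identity :=
  [set e | exists n c, canonical_cycle n c /\ e = cyc_id n c]%classic.

Lemma nth_flatten_const (T : Type) (d : T) (f : T -> word) k s i r :
  (forall x, size (f x) = k) -> i < size s -> r < k ->
  nth 0 (flatten (map f s)) (k * i + r) = nth 0 (f (nth d s i)) r.
Proof.
move=> fk; elim: s i => //= x s IH [|i] ilt rk; rewrite nth_cat fk.
  by rewrite muln0 add0n rk.
have -> : k * i.+1 + r < k = false by lia.
by rewrite -IH //; congr nth; lia.
Qed.

Lemma size_cyc_word n c fl : size (cyc_word n c fl) = 5 * n.
Proof.
rewrite -[X in _ = _ * X](size_iota 0 n) /cyc_word; move: (iota 0 n) => s.
elim: s => [|l s IH]; first by rewrite muln0.
by rewrite /= size_cat IH /cell mulnS; case: ifP.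
Qed.

Lemma nth_cyc_word n c fl l r : l < n -> r < 5 ->
  nth 0 (cyc_word n c fl) (5 * l + r) = nth 0 (cell n c fl l) r.
Proof.
move=> ln r5; rewrite (nth_flatten_const 0) ?size_iota ?nth_iota //.
by move=> x; rewrite /cell; case: ifP.
Qed.

Lemma count_cyc_max n c fl (a : nat) :
  is_cycle n c -> count_mem a (cyc_word n c fl) <= 4.
Proof.
move=> cyc; case: (ltnP a n) => an; first by rewrite count_cyc_letter.
exact: leq_trans (count_cyc_pin _ cyc an) _.
Qed.

(** Blocks are separated by letters of their own, and c l differs from l; so
    squares stand only in the middle of blocks. *)
Lemma cyc_word_double n c (a : word) (x : nat) (b : word) : 1 < n -> is_cycle n c -> x < n ->
  cyc_word n c pred0 = a ++ [:: x; x] ++ b ->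
  exists l, [/\ l < n, c l = x & size a = (5 * l).+1].
Proof.
move=> n1 cyc xn E; set w := cyc_word n c pred0 in E.
have sz : size a + 2 <= 5 * n.
  by rewrite -(size_cyc_word n c pred0) -/w E !size_cat /=; lia.
have h0 : nth 0 w (size a) = x by rewrite E nth_cat ltnn subnn.
have h1 : nth 0 w (size a).+1 = x.
  by rewrite E nth_cat ltnNge leqnSn /= subSn // subnn.
have pE : size a = 5 * (size a %/ 5) + size a %% 5 by lia.
set l := size a %/ 5 in pE; set r := size a %% 5 in pE.
have r5 : r < 5 by rewrite ltn_mod.
have ln : l < n by lia.
have cl := cycle_neq cyc n1 ln.
move: h0; rewrite pE nth_cyc_word // => h0.
have [r4|r4] := eqVneq r 4.
  by move: h0; rewrite r4 /cell /=; lia.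
have r1 : r.+1 < 5 by lia.
move: h1; rewrite pE -addnS nth_cyc_word // => h1.
exists l; move: h0 h1; rewrite /cell.
case: r r4 r5 r1 {pE} => [|[|[|[|r]]]] //= _ _ _ h0 h1; rewrite ?addn1.
- by case/eqP: cl; rewrite h1 -h0.
- by [].
- by case/eqP: cl; rewrite h0 -h1.
- by lia.
Qed.

Lemma cyc_word_thick n c (x : nat) : is_cycle n c ->
  1 < count_mem x (cyc_word n c pred0) -> x < n.
Proof.
by move=> cyc h; rewrite ltnNge; apply/negP => /(count_cyc_pin pred0 cyc); lia.
Qed.

(** A factor X Y Y X of a cyclic word consists of letters that occur at least
    twice, so it contains no separating letter and fits into one block. *)
Lemma cyc_word_location n c (a X Y b : word) : 1 < n -> is_cycle n c ->
  X != [::] -> Y != [::] ->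
  cyc_word n c pred0 = a ++ (X ++ Y ++ Y ++ X) ++ b ->
  exists l, [/\ l < n, X = [:: l], Y = [:: c l] & size a = 5 * l].
Proof.
move=> n1 cyc X0 Y0 E; set w := cyc_word n c pred0 in E.
set L := X ++ Y ++ Y ++ X in E.
have thick x : x \in L -> x < n.
  move=> xL; apply: (cyc_word_thick cyc); rewrite -/w E !count_cat.
  have : 0 < count_mem x X + count_mem x Y.
    rewrite -count_cat -has_count has_pred1 mem_cat.
    by move: xL; rewrite !mem_cat => /or4P[]->; rewrite ?orbT.
  by lia.
have szL : size L = (size X + size Y).*2 by rewrite !size_cat; lia.
have sX : 0 < size X by rewrite lt0n size_eq0.
have sY : 0 < size Y by rewrite lt0n size_eq0.
have sz : size a + size L <= 5 * n.
  rewrite -(size_cyc_word n c pred0) -/w E (size_cat a) (size_cat L b).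
  by rewrite leq_add2l leq_addr.
have nthL k : k < size L -> nth 0 w (size a + k) = nth 0 L k.
  by move=> kL; rewrite E nth_cat ltnNge leq_addr /= addKn nth_cat kL.
have npin k : k < size L -> (size a + k) %% 5 != 4.
  move=> kL; apply/eqP => e4.
  have pE : size a + k = 5 * ((size a + k) %/ 5) + 4 by lia.
  have ln : (size a + k) %/ 5 < n by lia.
  have := thick _ (mem_nth 0 kL); rewrite -nthL // pE nth_cyc_word //.
  by rewrite /cell /=; lia.
have [a5 L4] : size a %% 5 = 0 /\ size L = 4.
  have := npin 0; have := npin 1; have := npin 2; have := npin 3.
  by have := npin 4; lia.
have pE : size a = 5 * (size a %/ 5) by lia.
set l := size a %/ 5 in pE.
have ln : l < n by lia.
exists l; move: L4 nthL; rewrite szL /L.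
case: X X0 sX {E L thick szL sz npin} => [//|x X] _ _.
case: Y Y0 sY => [//|y Y] _ _ /= L4.
have [] : size X = 0 /\ size Y = 0 by move: L4; clear; move: (size X) (size Y); lia.
move=> /size0nil -> /size0nil -> h; have := h 0 isT; have := h 1 isT.
by rewrite pE !nth_cyc_word // /cell /= => <- <-.
Qed.

(** No letter of a cyclic word occurs five times, and an instance of an exchange
    would need the squares of both letters of a block outside that block, but
    the square of c l stands in the block of l only. *)
Lemma base_isolates n c v : 1 < n -> is_cycle n c ->
  deriv baseS (cyc_word n c pred0) v -> v = cyc_word n c pred0.
Proof.
move=> n1 cyc; apply: deriv_isolated => a b th e Se.
set w := cyc_word n c pred0.
have big_nil (X p : word) : w = a ++ p ++ b ->
    (forall x, x \in X -> 4 < count_mem x p) -> X = [::].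
  move=> E h; case: X h => // x X /(_ x (mem_head _ _)) h.
  have := count_cyc_max pred0 x cyc; rewrite -/w E !count_cat; lia.
have two_locs (X Y a1 b1 a2 b2 : word) : X != [::] -> Y != [::] ->
    w = a1 ++ (X ++ Y ++ Y ++ X) ++ b1 -> w = a2 ++ (Y ++ Y) ++ b2 ->
    size a2 = size a1 + size X.
  move=> X0 Y0 E1 E2.
  have [l [ln -> YE sa1]] := cyc_word_location n1 cyc X0 Y0 E1.
  have cl : c l < n by case: cyc => cn _; exact: cn.
  move: E2; rewrite YE => /(cyc_word_double n1 cyc cl) [l' [l'n cl' ->]].
  by rewrite (cycle_inj cyc l'n ln cl') sa1 /=; lia.
have exch k (X Y t s : word) : k < 3 ->
    (w = a ++ arrange k (X ++ Y ++ Y ++ X) (X ++ X) (Y ++ Y) t s ++ b \/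
     w = a ++ arrange k (Y ++ X ++ X ++ Y) (X ++ X) (Y ++ Y) t s ++ b) ->
    X = [::] \/ Y = [::].
  move=> k3 E; have [->|X0] := eqVneq X [::]; first by left.
  have [->|Y0] := eqVneq Y [::]; first by right.
  have sX : 0 < size X by rewrite lt0n size_eq0.
  have sY : 0 < size Y by rewrite lt0n size_eq0.
  exfalso; case: k k3 E => [|[|[|k]]] // _ [] E.
  - have := two_locs X Y a (t ++ (X ++ X) ++ s ++ (Y ++ Y) ++ b)
      (a ++ (X ++ Y ++ Y ++ X) ++ t ++ (X ++ X) ++ s) b X0 Y0.
    rewrite {1 2}E /arrange -!catA => /(_ erefl erefl); rewrite !size_cat; lia.
  - have := two_locs Y X a (t ++ (X ++ X) ++ s ++ (Y ++ Y) ++ b)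
      (a ++ (Y ++ X ++ X ++ Y) ++ t) (s ++ (Y ++ Y) ++ b) Y0 X0.
    rewrite {1 2}E /arrange -!catA => /(_ erefl erefl); rewrite !size_cat; lia.
  - have := two_locs X Y (a ++ (X ++ X) ++ t) (s ++ (Y ++ Y) ++ b)
      (a ++ (X ++ X) ++ t ++ (X ++ Y ++ Y ++ X) ++ s) b X0 Y0.
    rewrite {1 2}E /arrange -!catA => /(_ erefl erefl); rewrite !size_cat; lia.
  - have := two_locs Y X (a ++ (X ++ X) ++ t) (s ++ (Y ++ Y) ++ b)
      a (t ++ (Y ++ X ++ X ++ Y) ++ s ++ (Y ++ Y) ++ b) Y0 X0.
    rewrite {1 2}E /arrange -!catA => /(_ erefl erefl); rewrite !size_cat; lia.
  - have := two_locs X Y (a ++ (X ++ X) ++ t ++ (Y ++ Y) ++ s) b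
      (a ++ (X ++ X) ++ t) (s ++ (X ++ Y ++ Y ++ X) ++ b) X0 Y0.
    rewrite {1 2}E /arrange -!catA => /(_ erefl erefl); rewrite !size_cat; lia.
  - have := two_locs Y X (a ++ (X ++ X) ++ t ++ (Y ++ Y) ++ s) b
      a (t ++ (Y ++ Y) ++ s ++ (Y ++ X ++ X ++ Y) ++ b) Y0 X0.
    rewrite {1 2}E /arrange -!catA => /(_ erefl erefl); rewrite !size_cat; lia.
have exchE k : k < 3 -> subst th (exchange k).1 = arrange k
     (th 0 ++ th 1 ++ th 1 ++ th 0) (th 0 ++ th 0) (th 1 ++ th 1) (th 2) (th 3)
   /\ subst th (exchange k).2 = arrange k
     (th 1 ++ th 0 ++ th 0 ++ th 1) (th 0 ++ th 0) (th 1 ++ th 1) (th 2) (th 3).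
  by move=> _; rewrite !subst_arrange /subst /= !cats0.
have exch_triv k : k < 3 -> 
    (w = a ++ subst th (exchange k).1 ++ b \/
     w = a ++ subst th (exchange k).2 ++ b) ->
    subst th (exchange k).1 = subst th (exchange k).2.
  move=> k3; have [-> ->] := exchE k k3 => /(exch _ _ _ _ _ k3) [] -> //=.
    by rewrite !cats0.
  by rewrite !cats0.
have zero0 p : (p = subst th e.1 \/ p = subst th e.2) -> w = a ++ p ++ b ->
    e = collapse \/ e = power_stable -> th 0 = [::].
  move=> pE E ee; apply: (big_nil _ _ E) => x; rewrite -has_pred1 has_count => hx.
  move: hx; case: pE ee => -> [] ->; rewrite /subst /= !count_cat /=;
    move: (count_mem x (th 0)) (count_mem x (th 2)) (count_mem x (th 3));
    by move: (count_mem x (th 4)) (count_mem x (th 5)) (count_mem x (th 6)); lia.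
move: Se zero0; rewrite /baseS /= !inE; case/or4P=> [/eqP->|/eqP->|/eqP->|] zero0.
- by split=> E; have := zero0 _ _ E; rewrite /subst /= => ->; auto.
- by split=> E; have := zero0 _ _ E; rewrite /subst /= => ->; auto.
- by split=> E; apply: exch_triv; auto.
- move: zero0; case/orP => /eqP -> _.
    by split=> E; apply: exch_triv; auto.
  by split=> E; apply: exch_triv; auto.
Qed.

Lemma subst_cyc_word_at n c fl th i : i < n ->
  exists p q, subst th (cyc_word n c fl) =
    p ++ subst th (if fl i then [:: c i; i; i; c i] else [:: i; c i; c i; i])
      ++ subst th [:: n + i] ++ q /\
    p = subst th (flatten [seq cell n c fl l | l <- iota 0 i]).
Proof.
move=> ilt; exists (subst th (flatten [seq cell n c fl l | l <- iota 0 i])).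
exists (subst th (flatten [seq cell n c fl l | l <- iota i.+1 (n - i.+1)])).
split=> //; rewrite /cyc_word (iota_split ilt) map_cat flatten_cat /= subst_cat.
by rewrite /cell !subst_cat -!catA.
Qed.

(** A substitution that erases no letter of the cycle sends blocks to blocks, in
    increasing order, and neighbours on the cycle to neighbours. The blocks
    that are hit are closed under the cycle, so all are hit, and an increasing
    bijection is the identity; fl decides whether the direction of the cycle is
    kept. *)
Lemma cyc_word_match n c m d fl (a b : word) th :
  1 < n -> is_cycle n c -> 1 < m -> is_cycle m d ->
  fl = pred0 \/ fl = predT ->
  (forall i, i < m -> th i != [::]) ->
  cyc_word n c pred0 = a ++ subst th (cyc_word m d fl) ++ b ->
  m = n /\ ((forall i, i < n -> d i = c i) \/ (forall i, i < n -> c (d i) = i)).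
Proof.
move=> n1 cyc m1 cyd flE th0 E; have [cn cc] := cyc; have [dm dd] := cyd.
pose pos i := size a + size (subst th (flatten [seq cell m d fl l | l <- iota 0 i])).
pose out i := if fl i then d i else i.
pose inn i := if fl i then i else d i.
(* g i is the block of the second word into which block i is sent. *)
have /choice[g gP] : forall i, exists l, i < m ->
    [/\ l < n, th (out i) = [:: l], th (inn i) = [:: c l] & pos i = 5 * l].
  move=> i; case: (ltnP i m) => [ilt|]; last by exists 0.
  have [p [q [pq pE]]] := subst_cyc_word_at d fl th ilt.
  move: E; rewrite pq => E.
  have X0 : th (out i) != [::] by apply: th0; rewrite /out; case: (fl i); rewrite ?dm.
  have Y0 : th (inn i) != [::] by apply: th0; rewrite /inn; case: (fl i); rewrite ?dm.
  have EQ : cyc_word n c pred0 = (a ++ p) ++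
      (th (out i) ++ th (inn i) ++ th (inn i) ++ th (out i)) ++
      (subst th [:: m + i] ++ q ++ b).
    rewrite E -!catA /out /inn.
    by case: (fl i); rewrite !subst_cons /subst /= ?cats0 -!catA.
  have [l [ln X Y sz]] := cyc_word_location n1 cyc X0 Y0 EQ.
  by exists l => _; split=> //; rewrite -sz /pos size_cat pE.
have gS i : i.+1 < m -> g i < g i.+1.
  move=> ilt; have [_ X Y Ei] := gP i (ltnW ilt); have [_ _ _ Ei'] := gP _ ilt.
  have : pos i + 4 <= pos i.+1.
    rewrite /pos -addnA leq_add2l -[i.+1]addn1 iotaD map_cat flatten_cat.
    rewrite subst_cat size_cat leq_add2l /= add0n cats0 /cell subst_cat size_cat.
    apply: leq_trans (leq_addr _ _).
    by move: X Y; rewrite /out /inn; case: (fl i) => X Y; rewrite /subst /= X Y.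
  by rewrite Ei Ei'; lia.
have g_mono i j : i < j -> j < m -> g i < g j.
  elim: j => // j IH; rewrite ltnS leq_eqVlt => /orP[/eqP->|ij] jm; first exact: gS.
  exact: ltn_trans (IH ij (ltnW jm)) (gS _ jm).
have g_inj i j : i < m -> j < m -> g i = g j -> i = j.
  move=> im jm e; case: (ltngtP i j) => // ij.
    by have := g_mono _ _ ij jm; rewrite e ltnn.
  by have := g_mono _ _ ij im; rewrite e ltnn.
have m0 : 0 < m by exact: ltnW.
have n0 : 0 < n by exact: ltnW.
have closed l : (exists2 i, i < m & g i = l) -> exists2 i, i < m & g i = c l.
  case=> i im <-; case: flE => flE.
    exists (d i); first exact: dm.
    have [_ X Y _] := gP i im; have [_ X' _ _] := gP _ (dm _ im).
    by move: Y X'; rewrite /inn /out flE /= => -> [].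
  have [k km dk] := cycle_surj cyd im.
  exists k => //.
  have [_ X _ _] := gP k km; have [_ _ Y' _] := gP _ im.
  by move: X Y'; rewrite /inn /out flE /= dk => -> [].
have g_surj l : l < n -> exists2 i, i < m & g i = l.
  move=> ln; have [g0n _ _ _] := gP 0 m0.
  have [k <-] := cc _ _ g0n ln.
  elim: k => [|k IH] /=; first by exists 0.
  exact: closed.
have g_id i : i < m -> g i = i /\ i < n.
  elim: i => [|i IH] im.
    have [k km gk] := g_surj 0 n0; case: k km gk => [//|k] km gk.
    by have := g_mono 0 k.+1 isT km; rewrite gk.
  have [gi iltn] := IH (ltnW im); have gi1 := gS _ im.
  have [gn _ _ _] := gP _ im.
  have i1n : i.+1 < n by lia.
  have [k km gk] := g_surj _ i1n; split=> //.
  case: (ltngtP k i.+1) => ki; last by rewrite -{1}ki gk.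
    have : g k <= g i.
      by case: (ltngtP k i) => [h|h|->] //; [exact: ltnW (g_mono _ _ h (ltnW im))|lia].
    by lia.
  by have := g_mono _ _ ki km; lia.
have mn : m = n.
  apply/eqP; rewrite eqn_leq; apply/andP; split.
    by rewrite -(ltn_predK m1); apply: (g_id m.-1 _).2; rewrite ltn_predL.
  rewrite leqNgt; apply/negP => mltn; have [k km gk] := g_surj _ mltn.
  by move: gk; rewrite (g_id k km).1; lia.
split=> //; case: flE => flE; [left|right] => i iltn;
  have im : i < m by rewrite mn.
  have [_ X Y _] := gP i im; have [_ X' _ _] := gP _ (dm _ im).
  move: Y X'; rewrite /inn /out flE /= => -> [].
  by rewrite (g_id _ im).1 (g_id _ (dm _ im)).1.
have [_ X Y _] := gP i im; have [_ _ Y' _] := gP _ (dm _ im).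
have [k km dk] := cycle_surj cyd im.
move: X Y'; rewrite /inn /out flE /= => -> [].
by rewrite (g_id _ im).1 (g_id _ (dm _ im)).1.
Qed.

Lemma eq_cyc_id n c d : (forall i, i < n -> d i = c i) -> cyc_id n d = cyc_id n c.
Proof.
move=> dc; rewrite /cyc_id /cyc_word; congr (flatten _, flatten _);
  by apply/eq_in_map => l; rewrite mem_iota /= add0n /cell => /dc ->.
Qed.

(** A substitution into the left side that erases a letter of some other cyclic
    word makes this instance derivable from base, and base does not change the
    left side. One that erases no letter shows that the other cycle is c or its
    inverse, and the inverse is not canonical. *)
Lemma cyc_id_independent n c : canonical_cycle n c ->
  ~ consequence ([set e | e \in base \/ cycS e] `\ cyc_id n c)%classic (cyc_id n c).
Proof.
move=> [n3 cyc [k [kn ck c0k]]] /consequence_deriv d.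
have n1 : 1 < n by exact: ltn_trans n3.
suff: cyc_word n c predT = cyc_word n c pred0.
  move=> /(congr1 (nth 0 ^~ (5 * 0 + 0))); rewrite !nth_cyc_word //; try by lia.
  by rewrite /cell /= => e; have := cycle_neq (i := 0) cyc n1 (ltnW n1); rewrite e.
move: d; apply: deriv_isolated => a b th e [/= Se ne].
have stuck : deriv baseS (subst th e.1) (subst th e.2) ->
    (cyc_word n c pred0 = a ++ subst th e.1 ++ b -> subst th e.1 = subst th e.2) /\
    (cyc_word n c pred0 = a ++ subst th e.2 ++ b -> subst th e.1 = subst th e.2).
  have cancel u v : deriv baseS u v ->
      cyc_word n c pred0 = a ++ u ++ b -> u = v.
    move=> h E; have := deriv_cat a b h; rewrite -E => /(base_isolates n1 cyc).
    rewrite E => /(congr1 (drop (size a))); rewrite !drop_size_cat // => /esym uv.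
    have sz : size u = size v by move/(congr1 size): uv; rewrite !size_cat; lia.
    by move/(congr1 (take (size u))): uv; rewrite take_size_cat // sz take_size_cat.
  by move=> h; split=> E; [exact: cancel h E|rewrite (cancel _ _ (deriv_sym h) E)].
case: Se => [eb|[m [d [[m3 cyd [k' [k'm dk' d0k']]] eE]]]].
  apply: stuck; have := deriv_step [::] [::] th (eb : baseS e).
  by rewrite /= !cats0.
have m1 : 1 < m by exact: ltn_trans m3.
have erased j : j < m -> th j = [::] ->
    deriv baseS (subst th e.1) (subst th e.2).
  move=> jm thj; rewrite eE /=.
  have th0 x : ~~ predC1 j x -> th x = [::] by move=> /negPn /eqP ->.
  rewrite -(subst_filter (cyc_word m d pred0) th0).
  rewrite -(subst_filter (cyc_word m d predT) th0).
  by apply: deriv_subst; exact: erased_cycle_deriv.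
have [[j [jm thj]]|noer] := pselect (exists j, j < m /\ th j = [::]).
  exact: stuck (erased j jm thj).
have th0 i : i < m -> th i != [::].
  by move=> im; apply/eqP => thi; apply: noer; exists i.
have no fl : fl = pred0 \/ fl = predT ->
    cyc_word n c pred0 = a ++ subst th (cyc_word m d fl) ++ b -> False.
  move=> flE /(cyc_word_match n1 cyc m1 cyd flE th0) [mn [dc|cd]].
    by apply: ne; rewrite eE mn; exact: eq_cyc_id.
  rewrite mn in k'm; have k'E : c 0 = k' by rewrite -dk' cd.
  have d0 : d 0 = k.
    apply: (cycle_inj cyc) => //; last by rewrite cd ?(ltnW n1) // ck.
    by rewrite -mn; case: cyd => dm _; apply: dm; rewrite mn ltnW.
  by move: c0k d0k'; rewrite k'E d0; lia.
split=> E; exfalso.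
  by apply: (no pred0 (or_introl erefl)); rewrite E eE.
by apply: (no predT (or_intror erefl)); rewrite E eE.
Qed.

(** * Words on three letters *)

Definition limited (w : word) : Prop := forall a : nat, count_mem a w <= 4.

(** In words where no letter occurs five times these are the only nontrivial
    instances of base. *)
Definition exch (w w' : word) : Prop :=
  exists k X Y a t s b, [/\ k < 3, X != [::], Y != [::],
    w = a ++ arrange k (X ++ Y ++ Y ++ X) (X ++ X) (Y ++ Y) t s ++ b &
    w' = a ++ arrange k (Y ++ X ++ X ++ Y) (X ++ X) (Y ++ Y) t s ++ b].

Lemma limited_deriv u v : deriv baseS u v -> limited u -> limited v.
Proof.
by move=> d lu a; have := base_count_min a d; have := lu a; lia.
Qed.

Lemma base_step_limited a b th e : baseS e -> limited (a ++ subst th e.1 ++ b) ->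
  subst th e.1 = subst th e.2 \/
  exch (a ++ subst th e.1 ++ b) (a ++ subst th e.2 ++ b).
Proof.
move=> Se lim.
have th0 : e = collapse \/ e = power_stable -> th 0 = [::].
  case E : (th 0) => [//|x s] ee; have := lim x; rewrite !count_cat.
  have : 0 < count_mem x (th 0) by rewrite E /= eqxx.
  case: ee => ->; rewrite /subst /= !count_cat /=;
    move: (count_mem x (th 0)) (count_mem x (th 2)) (count_mem x (th 3));
    by move: (count_mem x (th 4)) (count_mem x (th 5)) (count_mem x (th 6)); lia.
have exchE k : k < 3 -> subst th (exchange k).1 = subst th (exchange k).2 \/
   exch (a ++ subst th (exchange k).1 ++ b) (a ++ subst th (exchange k).2 ++ b).
  move=> k3.
  have -> : subst th (exchange k).1 = arrange k
     (th 0 ++ th 1 ++ th 1 ++ th 0) (th 0 ++ th 0) (th 1 ++ th 1) (th 2) (th 3).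
    by rewrite !subst_arrange /subst /= !cats0.
  have -> : subst th (exchange k).2 = arrange k
     (th 1 ++ th 0 ++ th 0 ++ th 1) (th 0 ++ th 0) (th 1 ++ th 1) (th 2) (th 3).
    by rewrite !subst_arrange /subst /= !cats0.
  have [->|X0] := eqVneq (th 0) [::]; first by left; rewrite /= !cats0.
  have [->|Y0] := eqVneq (th 1) [::]; first by left; rewrite /= !cats0.
  by right; exists k, (th 0), (th 1), a, (th 2), (th 3), b.
move: Se th0; rewrite /baseS /= !inE.
case/or4P=> [/eqP->|/eqP->|/eqP->|/orP[]/eqP->] th0; try exact: exchE.
- by left; rewrite /subst /= th0; auto.
- by left; rewrite /subst /= th0; auto.
Qed.

Lemma exch_deriv w w' : exch w w' -> deriv baseS w w'.
Proof.
case=> k [X [Y [a [t [s [b [_ _ _ -> ->]]]]]]]; apply: deriv_cat.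
exact: exchange_deriv.
Qed.

(** ** Enumeration of the exchanges *)

Fixpoint words3 (n : nat) : seq word :=
  if n is n'.+1 then [seq x :: s | x <- [:: 0; 1; 2], s <- words3 n'] else [:: [::]].

Definition pairs3 : seq (word * word) :=
  [seq (take i s, drop i s) | s <- filter uniq (words3 2 ++ words3 3), i <- [:: 1; 2]].

Definition good_pairs3 : seq (word * word) :=
  filter (fun p => (p.1 != [::]) && (p.2 != [::])) pairs3.

(** All words obtained from w by one exchange, in either direction. *)
Definition steps3 (w : word) : seq word :=
  flatten [seq let X := p.1 in let Y := p.2 in let L := X ++ Y ++ Y ++ X in
    [seq take i w ++ (Y ++ X ++ X ++ Y) ++ drop (i + size L) w
      | i <- iota 0 (size w).+1 &
        if prefix L (drop i w) then
          let a := take i w in let b := drop (i + size L) w in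
          (infix (X ++ X) a || infix (X ++ X) b) &&
          (infix (Y ++ Y) a || infix (Y ++ Y) b)
        else false] | p <- good_pairs3].

Lemma mem_words3 s : all (fun x => x < 3) s -> s \in words3 (size s).
Proof.
elim: s => //= x s IH /andP[x3 /IH h].
have xin : x \in [:: 0; 1; 2] by case: x x3 => [|[|[|x]]].
have : x :: s \in [seq y :: t | y <- [:: 0; 1; 2], t <- words3 (size s)].
  by apply/allpairsP; exists (x, s).
by [].
Qed.

Definition on3 (w : word) : Prop := all (fun x => x < 3) w.

(** The exchanged words X and Y occur four times in w, so that together they
    have distinct letters, at most three of them. *)
Lemma exch_pairs3 (w X Y a b c : word) :
  limited w -> on3 w -> X != [::] -> Y != [::] ->
  perm_eq w ((X ++ Y) ++ (X ++ Y) ++ (X ++ Y) ++ (X ++ Y) ++ a ++ b ++ c) ->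
  (X, Y) \in good_pairs3.
Proof.
move=> lim o3 X0 Y0 pw; rewrite mem_filter /= X0 Y0 /=.
have mem x : x \in X ++ Y -> x < 3.
  move=> xin; apply: (allP o3); rewrite (perm_mem pw).
  by rewrite mem_cat xin.
have un : uniq (X ++ Y).
  apply: count_mem_uniq => x; have := lim x.
  rewrite (seq.permP pw) !(count_cat _ (X ++ Y)) -has_pred1 has_count.
  by move: (count_mem x (X ++ Y)) => [|[|n]] //=; lia.
have sz : size (X ++ Y) <= 3.
  rewrite -[3](size_iota 0); apply: uniq_leq_size => // x /mem.
  by rewrite mem_iota.
have X1 : 0 < size X by rewrite lt0n size_eq0.
have Y1 : 0 < size Y by rewrite lt0n size_eq0.
apply/allpairsP; exists (X ++ Y, size X); split.
- change (X ++ Y \in filter uniq (words3 2 ++ words3 3)).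
  rewrite mem_filter un andTb mem_cat.
  have : X ++ Y \in words3 (size (X ++ Y)) by apply: mem_words3; apply/allP.
  have [->|->] : size (X ++ Y) = 2 \/ size (X ++ Y) = 3.
    by move: sz; rewrite size_cat; lia.
  - by move=> ->.
  - by move=> ->; rewrite orbT.
- by move: sz; rewrite size_cat [_.2]/= !inE; lia.
- by rewrite [_.1]/= [_.2]/= take_size_cat // drop_size_cat.
Qed.

Lemma mem_steps3 (X Y a b : word) : (X, Y) \in good_pairs3 ->
  infix (X ++ X) a || infix (X ++ X) b -> infix (Y ++ Y) a || infix (Y ++ Y) b ->
  a ++ (Y ++ X ++ X ++ Y) ++ b \in steps3 (a ++ (X ++ Y ++ Y ++ X) ++ b).
Proof.
move=> XY iX iY; apply/flattenP.
set w := a ++ (X ++ Y ++ Y ++ X) ++ b.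
eexists; first by apply/mapP; exists (X, Y).
have ta : take (size a) w = a by rewrite /w take_size_cat.
have db : drop (size a + size (X ++ Y ++ Y ++ X)) w = b.
  by rewrite /w (catA a) drop_size_cat // (size_cat a).
apply/mapP; exists (size a); last by rewrite ta db.
rewrite mem_filter; apply/andP; split; last first.
  by rewrite mem_iota leq0n add0n ltnS [size w]size_cat leq_addr.
cbv zeta; rewrite [_.1]/= [_.2]/= ta db iX iY.
by rewrite /w drop_size_cat // prefix_prefix.
Qed.

Lemma exch_steps3 w w' : limited w -> on3 w -> exch w w' \/ exch w' w ->
  w' \in steps3 w.
Proof.
move=> lim o3.
have main k (X Y a t s b : word) : k < 3 -> X != [::] -> Y != [::] ->
    w = a ++ arrange k (X ++ Y ++ Y ++ X) (X ++ X) (Y ++ Y) t s ++ b \/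
    w = a ++ arrange k (X ++ Y ++ Y ++ X) (Y ++ Y) (X ++ X) t s ++ b ->
    (X, Y) \in good_pairs3.
  move=> k3 X0 Y0 E; apply: (@exch_pairs3 w X Y a (t ++ s) b) => //.
  by apply/seq.permP => x; case: E => ->; case: k k3 => [|[|[|]]] // _;
    rewrite /arrange !count_cat; lia.
have infE (P A1 A2 A3 : word) : infix P (A1 ++ (A2 ++ P) ++ A3).
  by apply: infix_catl; apply: infix_catr; apply: infix_catl; exact: infix_refl.
case=> [] [k [X [Y [a [t [s [b [k3 X0 Y0 E E']]]]]]]].
  have XY := main _ _ _ _ _ _ _ k3 X0 Y0 (or_introl E).
  case: k k3 {main} E E' => [|[|[|]]] // _ -> ->; rewrite /arrange.
  - have := @mem_steps3 X Y a (t ++ (X ++ X) ++ s ++ (Y ++ Y) ++ b) XY.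
    rewrite -!catA; apply; apply/orP; right.
      by have := infE (X ++ X) t [::] (s ++ Y ++ Y ++ b); rewrite -!catA.
    by have := infE (Y ++ Y) (t ++ X ++ X ++ s) [::] b; rewrite -!catA.
  - have := @mem_steps3 X Y (a ++ (X ++ X) ++ t) (s ++ (Y ++ Y) ++ b) XY.
    rewrite -!catA; apply; apply/orP; [left|right].
      by have := infE (X ++ X) a [::] t; rewrite -!catA.
    by have := infE (Y ++ Y) s [::] b; rewrite -!catA.
  - have := @mem_steps3 X Y (a ++ (X ++ X) ++ t ++ (Y ++ Y) ++ s) b XY.
    rewrite -!catA; apply; apply/orP; left.
      by have := infE (X ++ X) a [::] (t ++ (Y ++ Y) ++ s); rewrite -!catA.
    by have := infE (Y ++ Y) (a ++ (X ++ X) ++ t) [::] s; rewrite -!catA.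
have XY := main _ _ _ _ _ _ _ k3 Y0 X0 (or_intror E').
case: k k3 {main} E E' => [|[|[|]]] // _ -> ->; rewrite /arrange.
- have := @mem_steps3 Y X a (t ++ (X ++ X) ++ s ++ (Y ++ Y) ++ b) XY.
  rewrite -!catA; apply; apply/orP; right.
    by have := infE (Y ++ Y) (t ++ X ++ X ++ s) [::] b; rewrite -!catA.
  by have := infE (X ++ X) t [::] (s ++ Y ++ Y ++ b); rewrite -!catA.
- have := @mem_steps3 Y X (a ++ (X ++ X) ++ t) (s ++ (Y ++ Y) ++ b) XY.
  rewrite -!catA; apply; apply/orP; [right|left].
    by have := infE (Y ++ Y) s [::] b; rewrite -!catA.
  by have := infE (X ++ X) a [::] t; rewrite -!catA.
- have := @mem_steps3 Y X (a ++ (X ++ X) ++ t ++ (Y ++ Y) ++ s) b XY.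
  rewrite -!catA; apply; apply/orP; left.
    by have := infE (Y ++ Y) (a ++ (X ++ X) ++ t) [::] s; rewrite -!catA.
  by have := infE (X ++ X) a [::] (t ++ (Y ++ Y) ++ s); rewrite -!catA.
Qed.

(** ** Relative positions of occurrences *)

(** Counts the occurrences of x that precede occurrence j of y. Occurrences are
    numbered from 0; for a missing one, the whole word is counted. *)
Fixpoint before (x y j : nat) (w : word) : nat :=
  if w is a :: w' then
    if a == y then (if j is j'.+1 then before x y j' w' else 0)
    else (a == x) + before x y j w'
  else 0.

(** L x i y j says that occurrence i of x precedes occurrence j of y, for letters
    coded by 0, 1, 2. The names nm make the same boolean tests apply to a word
    on three letters and to three letters of any word. *)
Definition occ_rel := nat -> nat -> nat -> nat -> bool.

Definition prec (nm : nat -> nat) (w : word) : occ_rel := fun x i y j =>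
  [&& x < 3, y < 3 & i < before (nm x) (nm y) j w].

(** Occurrences I, I+1 of a enclose J, J+1 of b, and nothing else of a and b
    stands in between. Since I and J are 0 or 2, the remaining occurrences are
    2-I, 3-I and 2-J, 3-J; each of these two pairs is free of the other
    letter. *)
Definition enclb (L : occ_rel) (a b I J : nat) : bool :=
  [&& L a I b J, L b J.+1 a I.+1,
      all (fun j => L a (3 - I) b j || L b j a (2 - I)) (iota 0 4),
      all (fun j => L b j a I || L a I.+1 b j) [:: 2 - J; 3 - J] &
      all (fun i => L a i b (2 - J) || L b (3 - J) a i) (iota 0 4)].

Definition outb (L : occ_rel) (a e b k : nat) : bool := L b k a e || L a e.+1 b k.

Definition twinb (L : occ_rel) (a b c : nat) : bool :=
  all (fun i => [&& L a i b i, (i == 3) || L b i a i.+1 &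
    all (fun k => L c k a i || L b i c k) (iota 0 4)]) (iota 0 4).

Definition awayb (L L' : occ_rel) (m I J : nat) : bool :=
  all (fun k => [&& outb L 0 I 2 k, outb L 0 (2 - I) 2 k, outb L 1 (2 - J) 2 k &
    all (fun j => L 1 j 2 k == L' 1 j 2 k) (iota 0 4)]) (iota 0 m).

Definition nextb (L L' : occ_rel) (m I J K : nat) : bool :=
  [&& m == 4, enclb L 1 2 (2 - J) K, enclb L' 2 1 K (2 - J),
      all (fun k => outb L 0 I 2 k && outb L 0 (2 - I) 2 k) (iota 0 4) &
      all (fun i => outb L 2 (2 - K) 0 i) (iota 0 4)].

Definition twin_outerb (L L' : occ_rel) (m I J a b : nat) : bool :=
  [&& m == 4, twinb L a b 1, twinb L' a b 1, enclb L 2 1 I J & enclb L' 1 2 J I].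

Definition twin_innerb (L L' : occ_rel) (m I J a b : nat) : bool :=
  [&& m == 4, twinb L a b 0, twinb L' a b 0, enclb L 0 2 I J & enclb L' 2 0 J I].

(** The possible places of letter 2, which occurs m times, when 0 encloses 1: it
    avoids all four pairs of occurrences; or it is enclosed by the other pair
    of 1, and exchanged with it; or it is a twin of 0; or it is a twin of 1. *)
Definition third_letterb (L L' : occ_rel) (m I J : nat) : bool :=
  if awayb L L' m I J then true else
  [|| nextb L L' m I J 0, nextb L L' m I J 2,
      twin_outerb L L' m I J 0 2, twin_outerb L L' m I J 2 0,
      twin_innerb L L' m I J 1 2 | twin_innerb L L' m I J 2 1].

(** In the second word, 1 encloses 0 at the same place; all else agrees. *)
Definition switchedb (L L' : occ_rel) (I J : nat) : bool :=
  enclb L' 1 0 J I &&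
  all (fun i => all (fun j => ((i \in [:: I; I.+1]) && (j \in [:: J; J.+1])) ||
    (L 0 i 1 j == L' 0 i 1 j)) (iota 0 4)) (iota 0 4).

(** The facts that hold whenever 0 and 1 are in different order in two
    equivalent words on three letters. *)
Definition triple_okb (L L' : occ_rel) (n0 n1 m : nat) : bool :=
  (n0 == 4) && (n1 == 4) &&
  has (fun I => has (fun J => enclb L 0 1 I J || enclb L 1 0 J I) [:: 0; 2]) [:: 0; 2] &&
  all (fun I => all (fun J => if enclb L 0 1 I J then
    switchedb L L' I J && third_letterb L L' m I J else true) [:: 0; 2]) [:: 0; 2].

Definition only01 (w : word) : word := filter (fun x => x < 2) w.

(** ** The classes of words on three letters in which 0 and 1 are exchanged *)

(** In an exchange that is visible on 0 and 1, one of X and Y contains 0 and the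
    other one 1; the letter 2 belongs to at most one of them. *)
Definition blocks3 : seq (word * word) :=
  [:: ([:: 0], [:: 1]); ([:: 0; 2], [:: 1]); ([:: 2; 0], [:: 1]);
      ([:: 0], [:: 1; 2]); ([:: 0], [:: 2; 1])].

(** Outside the exchanged factor and its squares only the letter 2 is left, at
    most four times in the four gaps. *)
Definition gaps3 : seq (nat * nat * nat * nat) :=
  [seq q <- [seq (p, i) | p <- [seq (p, i) | p <- [seq (i, j) | i <- iota 0 5, j <- iota 0 5],
     i <- iota 0 5], i <- iota 0 5] | q.1.1.1 + q.1.1.2 + q.1.2 + q.2 <= 4].

Definition fill (k : nat) (p : word * word) (o : bool) (q : nat * nat * nat * nat) : word :=
  let X := p.1 in let Y := p.2 in let two n := nseq n 2 in
  let A := if o then Y ++ Y else X ++ X in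
  let B := if o then X ++ X else Y ++ Y in
  two q.1.1.1 ++ arrange k (X ++ Y ++ Y ++ X) A B (two q.1.1.2) (two q.1.2) ++ two q.2.

(** For each exchange visible on 0 and 1, its side in which 0 is the outer letter. *)
Definition seeds3 : seq word :=
  [seq w <- [seq fill r.1.1 r.1.2 r.2 q | r <- [seq (p, o) |
      p <- [seq (k, p) | k <- [:: 0; 1; 2], p <- blocks3], o <- [:: true; false]],
      q <- gaps3] | count_mem 2 w <= 4].

(** Two rounds of exchanges reach the whole class of a seed; class_okb verifies
    that this set is closed. *)
Definition class3 (w : word) : seq word :=
  let C := undup (w :: steps3 w) in undup (C ++ flatten (map steps3 C)).

Definition class_okb (C : seq word) : bool :=
  all (fun w => all (mem C) (steps3 w)) C &&
  all (fun w => let L := prec id w in let m := count_mem 2 w in all (fun w' =>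
    if only01 w == only01 w' then true else triple_okb L (prec id w') (count_mem 0 w) (count_mem 1 w) m) C) C.

Lemma classes_ok : all (fun w => class_okb (class3 w)) seeds3.
Proof. by vm_cast_no_check (erefl true). Qed.

Lemma on3_deriv u v : deriv baseS u v -> on3 u -> on3 v.
Proof.
move=> d /allP ou; apply/allP => x xv; apply: ou.
have := base_count_min x d; rewrite -has_pred1 has_count.
by move: xv; rewrite -has_pred1 has_count; lia.
Qed.

(** With 0 and 1 used up, a word on three letters is a power of 2. *)
Lemma only2 (s : word) : on3 s -> count_mem 0 s = 0 -> count_mem 1 s = 0 ->
  s = nseq (size s) 2.
Proof.
elim: s => //= x s IH /andP[x3 o3]; case: x x3 => [|[|[|x]]] //= _.
by rewrite !add0n => h h'; congr cons; exact: IH.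
Qed.

Lemma exch_seeds3 k X Y a t s b o : k < 3 ->
  let w := a ++ arrange k (X ++ Y ++ Y ++ X) (if o then Y ++ Y else X ++ X)
             (if o then X ++ X else Y ++ Y) t s ++ b in
  limited w -> on3 w -> (X, Y) \in good_pairs3 -> 0 \in X -> 1 \in Y -> w \in seeds3.
Proof.
move=> k3 w lim o3 XY X0 Y1.
have bl : (X, Y) \in blocks3.
  have : all (fun p => (0 \in p.1) && (1 \in p.2) ==> (p \in blocks3)) good_pairs3.
    by vm_compute.
  by move/allP=> /(_ _ XY); rewrite X0 Y1.
have cw (x : nat) : count_mem x w = 4 * count_mem x (X ++ Y) +
    (count_mem x a + count_mem x t + count_mem x s + count_mem x b).
  by rewrite /w; clear -k3; case: k k3 => [|[|[|]]] // _; case: o;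
    rewrite /arrange !count_cat; lia.
have XY0 : 0 < count_mem 0 (X ++ Y) by rewrite -has_count has_pred1 mem_cat X0.
have XY1 : 0 < count_mem 1 (X ++ Y) by rewrite -has_count has_pred1 mem_cat Y1 orbT.
have w0 := lim 0; have w1 := lim 1; rewrite !cw in w0 w1.
have sub (p : word) : {subset p <= w} -> on3 p.
  by move=> h; apply/allP => x /h /(allP o3).
have mw x : (x \in a) || (x \in t) || (x \in s) || (x \in b) -> x \in w.
  rewrite /w; case: k k3 {w lim o3 cw w0 w1 sub} => [|[|[|]]] // _;
    by rewrite /arrange !mem_cat => /orP[/orP[/orP[]|]|] ->; rewrite ?orbT.
have aE : a = nseq (size a) 2.
  by apply: only2; [apply: sub => x xa; apply: mw; rewrite xa|lia|lia].
have tE : t = nseq (size t) 2.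
  by apply: only2; [apply: sub => x xa; apply: mw; rewrite xa ?orbT|lia|lia].
have sE : s = nseq (size s) 2.
  by apply: only2; [apply: sub => x xa; apply: mw; rewrite xa ?orbT|lia|lia].
have bE : b = nseq (size b) 2.
  by apply: only2; [apply: sub => x xa; apply: mw; rewrite xa ?orbT|lia|lia].
have c2 (p : word) : p = nseq (size p) 2 -> count_mem 2 p = size p.
  by move=> ->; rewrite count_nseq size_nseq /= mul1n.
have w2 := lim 2; rewrite cw (c2 a) // (c2 t) // (c2 s) // (c2 b) // in w2.
rewrite mem_filter; apply/andP; split; first exact: lim.
pose q := (size a, size t, size s, size b).
have qin : q \in gaps3.
  rewrite mem_filter; apply/andP; split; first by rewrite /q [X in X <= _]/=; lia.
  have [ia it is_ ib] : [/\ size a < 5, size t < 5, size s < 5 & size b < 5].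
    by split; lia.
  have i5 n : n < 5 -> n \in iota 0 5 by rewrite mem_iota.
  apply/allpairsP; exists ((size a, size t, size s), size b).
  split; [|exact: i5|by []].
  apply/allpairsP; exists ((size a, size t), size s); split; [|exact: i5|by []].
  by apply/allpairsP; exists (size a, size t); split; [exact: i5|exact: i5|].
apply/allpairsP; exists ((k, (X, Y), o), q); split; [|exact: qin|]; last first.
  by rewrite /fill /q /w {1}aE {1}tE {1}sE {1}bE.
apply/allpairsP; exists ((k, (X, Y)), o); split; [|by case: (o)|by []].
apply/allpairsP; exists (k, (X, Y)); split; [|exact: bl|by []].
by case: (k) k3 => [|[|[|]]].
Qed.

Lemma only01_cat u v : only01 (u ++ v) = only01 u ++ only01 v.
Proof. exact: filter_cat. Qed.

(** An exchange that is visible on the letters 0 and 1 takes place inside a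
    class of the list. *)
Lemma exch_class3 w w' : limited w -> on3 w -> exch w w' -> only01 w != only01 w' ->
  exists2 s, s \in seeds3 & (w == s) || (w' == s).
Proof.
move=> lim o3 e ne.
have d := exch_deriv e.
have lim' := limited_deriv d lim; have o3' := on3_deriv d o3.
case: e => k [X [Y [a [t [s [b [k3 X0 Y0 wE w'E]]]]]]].
have XY : (X, Y) \in good_pairs3.
  apply: (@exch_pairs3 w X Y a (t ++ s) b) => //.
  by apply/seq.permP => x; rewrite wE; case: (k) k3 => [|[|[|]]] // _;
    rewrite /arrange !count_cat; lia.
have YX : (Y, X) \in good_pairs3.
  have : all (fun p => (p.2, p.1) \in good_pairs3) good_pairs3 by vm_compute.
  by move/allP=> /(_ _ XY).
have : all (fun p => let X := p.1 in let Y := p.2 in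
    [|| (0 \in X) && (1 \in Y), (1 \in X) && (0 \in Y) |
        only01 (X ++ Y ++ Y ++ X) == only01 (Y ++ X ++ X ++ Y)]) good_pairs3 by vm_compute.
move/allP=> /(_ _ XY) /= /or3P[/andP[x y]|/andP[x y]|/eqP eq01].
- exists w; last by rewrite eqxx.
  by rewrite wE in lim o3 *; exact: (@exch_seeds3 k X Y a t s b false).
- exists w'; last by rewrite eqxx orbT.
  by rewrite w'E in lim' o3' *; exact: (@exch_seeds3 k Y X a t s b true).
- have same (L L' A B : word) : only01 L = only01 L' ->
      only01 (a ++ arrange k L A B t s ++ b) = only01 (a ++ arrange k L' A B t s ++ b).
    by case: (k) => [|[|n]] h; rewrite /arrange !only01_cat h.
  by case/eqP: ne; rewrite wE w'E; exact: same.
Qed.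

(** If the restrictions to 0 and 1 differ, some exchange in the derivation is
    visible on them; so w lies in the class of a seed, and so does w', and the
    computation applies to both. *)
Lemma triple_ok w w' : limited w -> on3 w -> deriv baseS w w' ->
  only01 w != only01 w' ->
  triple_okb (prec id w) (prec id w') (count_mem 0 w) (count_mem 1 w) (count_mem 2 w).
Proof.
move=> lim o3 d ne.
have closed s u v : s \in seeds3 -> limited u -> on3 u -> deriv baseS u v ->
    u \in class3 s -> v \in class3 s.
  move=> sin; have /andP[/allP cl _] := allP classes_ok s sin.
  suff main x y : deriv baseS x y -> limited x -> on3 x ->
      (x \in class3 s) = (y \in class3 s).
    by move=> lu ou /main <-.
  elim=> {x y} [//|a b th e Se|x y dxy IH|y x z dxy IH1 dyz IH2] lx ox; last 2 first.
  - by rewrite IH //; [exact: limited_deriv (deriv_sym dxy) lx|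
                       exact: on3_deriv (deriv_sym dxy) ox].
  - by rewrite IH1 // IH2 //; [exact: limited_deriv lx|exact: on3_deriv ox].
  have [->//|ex] := base_step_limited Se lx.
  have dx := exch_deriv ex.
  have ly := limited_deriv dx lx; have oy := on3_deriv dx ox.
  apply/idP/idP => h.
    have /allP := cl _ h; apply; apply: exch_steps3 => //; by left.
  have /allP := cl _ h; apply; apply: exch_steps3 => //; by right.
have [/eqP|[s sin ws]] : only01 w = only01 w' \/
    exists2 s, s \in seeds3 & w \in class3 s.
- move: ne => _; elim: d lim o3 => {w w'}
    [w|a b th e Se|x y dxy IH|y x z dxy IH1 dyz IH2] lx ox.
  + by left.
  + have [->|ex] := base_step_limited Se lx; first by left.
    have [//|ne] := eqVneq (only01 (a ++ subst th e.1 ++ b)) (only01 (a ++ subst th e.2 ++ b)).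
      by left.
    have dx := exch_deriv ex.
    have ly := limited_deriv dx lx; have oy := on3_deriv dx ox.
    have [s sin /orP[]/eqP E] := exch_class3 lx ox ex ne; right; exists s => //.
      by rewrite E mem_undup mem_cat mem_undup inE eqxx.
    apply: (closed s (a ++ subst th e.2 ++ b)) => //; first exact: deriv_sym.
    by rewrite E mem_undup mem_cat mem_undup inE eqxx.
  + have lx' := limited_deriv (deriv_sym dxy) lx; have ox' := on3_deriv (deriv_sym dxy) ox.
    case: (IH lx' ox') => [->|[s sin h]]; first by left.
    by right; exists s => //; exact: closed h.
  + have ly := limited_deriv dxy lx; have oy := on3_deriv dxy ox.
    case: (IH1 lx ox) => [->|]; last by right.
    case: (IH2 ly oy) => [->|[s sin h]]; first by left.
    by right; exists s => //; exact: closed (deriv_sym dxy) h.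
- by rewrite (negPf ne).
have ws' := closed s w w' sin lim o3 d ws.
have /andP[_ /allP h] := allP classes_ok s sin.
by have /allP := h _ ws; move=> /(_ _ ws'); rewrite (negPf ne).
Qed.

(** * Positions of occurrences in arbitrary words *)

(** If x has no occurrence i, this is the size of w. *)
Fixpoint pos (x i : nat) (w : word) : nat :=
  if w is a :: w' then
    if a == x then (if i is i'.+1 then (pos x i' w').+1 else 0)
    else (pos x i w').+1
  else 0.

(** Links the count on which the computation is based to positions. *)
Lemma before_pos x y i j w : x != y ->
  i < count_mem x w -> j < count_mem y w ->
  (i < before x y j w) = (pos x i w < pos y j w).
Proof.
move=> xy; elim: w i j => //= a w IH i j.
have [->|ay] := eqVneq a y.
  rewrite eq_sym (negPf xy) add0n => ic; case: j => [|j] jc; first by rewrite ltn0.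
  by rewrite IH.
have [_|ax] := eqVneq a x; last by rewrite !add0n => ic jc; rewrite IH.
by case: i => [|i] ic jc //=; rewrite add1n ltnS IH.
Qed.

Lemma nth_pos x i w : i < count_mem x w -> nth 0 w (pos x i w) = x.
Proof.
elim: w i => //= a w IH i; have [->|ax] := eqVneq a x; last by rewrite add0n => /IH.
by case: i => [|i] //= ic; rewrite IH.
Qed.

Lemma pos_size x i w : i < count_mem x w -> pos x i w < size w.
Proof.
elim: w i => //= a w IH i; have [_|ax] := eqVneq a x; last by rewrite add0n => /IH.
by case: i => [|i] //= ic; rewrite ltnS; apply: IH.
Qed.

Lemma pos_lt x i j w : i < j -> j < count_mem x w -> pos x i w < pos x j w.
Proof.
elim: w i j => //= a w IH i j; have [_|ax] := eqVneq a x.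
  by case: j => // j; case: i => // i ij jc; rewrite ltnS IH.
by rewrite add0n ltnS; exact: IH.
Qed.

Lemma pos_exists w k : k < size w ->
  exists2 i, i < count_mem (nth 0 w k) w & pos (nth 0 w k) i w = k.
Proof.
elim: w k => //= a w IH [|k] /= kw; first by exists 0; rewrite eqxx.
have [i ic ik] := IH k kw; have [E|ax] := eqVneq a (nth 0 w k).
  by exists i.+1; rewrite ?ik // -E.
by exists i; rewrite ?ik.
Qed.

Lemma pos_neq x y i j w : x != y -> i < count_mem x w -> j < count_mem y w ->
  pos x i w != pos y j w.
Proof.
move=> xy ic jc; apply: contraNneq xy => e.
by rewrite -(nth_pos ic) e nth_pos.
Qed.

(** ** Restriction to three letters *)

(** Renames x, y, p to 0, 1, 2 and erases all other letters. *)
Definition sub3 (x y p z : nat) : word :=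
  if z == x then [:: 0] else if z == y then [:: 1] else if z == p then [:: 2] else [::].

Definition nm3 (x y p a : nat) : nat := nth 0 [:: x; y; p] a.

Lemma count_sub3 x y p u a : uniq [:: x; y; p] -> a < 3 ->
  count_mem a (subst (sub3 x y p) u) = count_mem (nm3 x y p a) u.
Proof.
rewrite /= !inE !negb_or => /and3P[/andP[xy xp] yp _] a3.
elim: u => //= z u IH; rewrite subst_cons count_cat IH; congr addn; rewrite /sub3.
have yx : y == x = false by rewrite eq_sym; apply: negPf.
have px : p == x = false by rewrite eq_sym; apply: negPf.
have py : p == y = false by rewrite eq_sym; apply: negPf.
have [->|zx] := eqVneq z x; last have [->|zy] := eqVneq z y;
  last have [->|zp] := eqVneq z p; case: a a3 {IH} => [|[|[|a]]] //= _;
  rewrite ?eqxx ?yx ?px ?py ?(negPf xy) ?(negPf xp) ?(negPf yp)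
    ?(negPf zx) ?(negPf zy) ?(negPf zp) //.
Qed.

Lemma on3_sub3 x y p u : on3 (subst (sub3 x y p) u).
Proof.
rewrite /on3; elim: u => //= z u IH; rewrite subst_cons all_cat IH andbT /sub3.
by case: ifP => // _; case: ifP => // _; case: ifP.
Qed.

Lemma limited_sub3 x y p u : uniq [:: x; y; p] -> limited u ->
  limited (subst (sub3 x y p) u).
Proof.
move=> un lu a; case: (ltnP a 3) => a3; first by rewrite count_sub3.
rewrite leqNgt; apply/negP => h.
have /(allP (on3_sub3 x y p u)) : a \in subst (sub3 x y p) u.
  by rewrite -has_pred1 has_count; lia.
by lia.
Qed.

Lemma only01_sub3 x y p u : x != y ->
  filter (pred2 x y) u =
  subst (fun i => [:: if i == 0 then x else y]) (only01 (subst (sub3 x y p) u)).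
Proof.
move=> xy; elim: u => //= z u IH; rewrite subst_cons only01_cat subst_cat -IH.
rewrite /sub3; have [->|zx] /= := eqVneq z x; first by [].
have [->|zy] /= := eqVneq z y; first by [].
by case: (z == p).
Qed.

Lemma prec_sub3 x y p u : uniq [:: x; y; p] ->
  prec id (subst (sub3 x y p) u) = prec (nm3 x y p) u.
Proof.
rewrite /= !inE !negb_or => /and3P[/andP[xy xp] yp _].
have yx : y == x = false by rewrite eq_sym; apply: negPf.
have px : p == x = false by rewrite eq_sym; apply: negPf.
have py : p == y = false by rewrite eq_sym; apply: negPf.
apply/funext => a; apply/funext => i; apply/funext => b; apply/funext => j.
rewrite /prec; case a3: (a < 3) => //; case b3: (b < 3) => //=.
suff -> : before a b j (subst (sub3 x y p) u) =
    before (nm3 x y p a) (nm3 x y p b) j u by [].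
elim: u j => //= z u IH j; rewrite subst_cons /sub3.
have [->|zx] := eqVneq z x; last have [->|zy] := eqVneq z y;
  last have [->|zp] := eqVneq z p; move: IH;
  case: a a3 => [|[|[|a]]] // _; case: b b3 => [|[|[|b]]] // _ IH /=;
  rewrite /nm3 /= ?eqxx ?yx ?px ?py ?(negPf xy) ?(negPf xp) ?(negPf yp)
    ?(negPf zx) ?(negPf zy) ?(negPf zp) /= ?IH //; by case: j.
Qed.

(** * Letters exchanged between two equivalent words *)

(** The identity of u and v holds in the finite monoid. *)
Definition sim (u v : word) : Prop :=
  forall th : nat -> seq 'I_3, deriv baseS (subst (code th) u) (subst (code th) v).

Lemma sim_sym u v : sim u v -> sim v u.
Proof. by move=> s th; apply: deriv_sym. Qed.

Lemma sim_trans v u w : sim u v -> sim v w -> sim u w.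
Proof. by move=> s s' th; apply: deriv_trans (s th) (s' th). Qed.

Lemma sim_sub3 x y p u v : sim u v ->
  deriv baseS (subst (sub3 x y p) u) (subst (sub3 x y p) v).
Proof.
move=> s; pose th z : seq 'I_3 := map inord (sub3 x y p z).
have E w : subst (code th) w = subst (sub3 x y p) w.
  apply: eq_subst => z _; rewrite /code /th -map_comp /sub3.
  by case: ifP => _; [|case: ifP => _; [|case: ifP => _]]; rewrite //= inordK.
by rewrite -!E.
Qed.

Lemma sim_count u v a : sim u v -> limited u -> limited v ->
  count_mem a u = count_mem a v.
Proof.
move=> s lu lv; have := base_count_min 0 (@sim_sub3 a a.+1 a.+2 _ _ s).
have un : uniq [:: a; a.+1; a.+2] by rewrite /= !inE; lia.
rewrite !count_sub3 //; have := lu a; have := lv a.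
by rewrite -[nm3 _ _ _ 0]/a; move: (count_mem a u) (count_mem a v); lia.
Qed.

Definition differ (u v : word) (x y : nat) : bool :=
  filter (pred2 x y) u != filter (pred2 x y) v.

Lemma differ_sym u v x y : differ u v x y = differ u v y x.
Proof.
by rewrite /differ !(@eq_filter _ (pred2 x y) (pred2 y x)) // => z /=; rewrite orbC.
Qed.

Lemma differC u v x y : differ u v x y = differ v u x y.
Proof. by rewrite /differ eq_sym. Qed.

Lemma differ_only01 u v x y p : x != y -> differ u v x y ->
  only01 (subst (sub3 x y p) u) != only01 (subst (sub3 x y p) v).
Proof.
move=> xy; rewrite /differ !(only01_sub3 p _ xy); by apply: contra_neq => ->.
Qed.

Definition outside (u : word) (a e b k : nat) : Prop :=
  pos b k u < pos a e u \/ pos a e.+1 u < pos b k u.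

(** The factor x y y x that an exchange acts on, once other letters are
    disregarded: occurrences I, I+1 of x around J, J+1 of y, with I and J in
    {0, 2}. The remaining occurrences 2-I, 3-I of x form a pair free of y, and
    2-J, 3-J of y one free of x. *)
Record encl (u : word) (x y I J : nat) : Prop := Encl {
  encl_left : pos x I u < pos y J u;
  encl_right : pos y J.+1 u < pos x I.+1 u;
  encl_gapx : forall j, j < 4 -> outside u x (2 - I) y j;
  encl_other2 : outside u x I y (2 - J);
  encl_other3 : outside u x I y (3 - J);
  encl_gapy : forall i, i < 4 -> outside u y (2 - J) x i }.

(** In the restriction to a, b, c, the letters a and b occur only in factors
    ab. *)
Definition twin (u : word) (a b c : nat) : Prop :=
  forall i, i < 4 -> [/\ pos a i u < pos b i u,
    (i < 3 -> pos b i u < pos a i.+1 u) &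
    forall k, k < 4 -> pos c k u < pos a i u \/ pos b i u < pos c k u].

(** The place of a further letter p when x encloses y in u and y encloses x in
    v. Next is the link of a chain: the other pair of y encloses p, and y and p
    are exchanged too. In the two last cases p is inseparable from x or from
    y, as far as these three letters can tell. *)
Inductive third (u v : word) (x y p I J : nat) : Prop :=
| Away of
    (forall k, k < count_mem p u ->
      [/\ outside u x I p k, outside u x (2 - I) p k & outside u y (2 - J) p k]) &
    (forall j k, j < 4 -> k < count_mem p u ->
      (pos y j u < pos p k u) = (pos y j v < pos p k v))
| Next K of K = 0 \/ K = 2 & count_mem p u = 4 &
    encl u y p (2 - J) K & encl v p y K (2 - J) &
    (forall k, k < 4 -> outside u x I p k /\ outside u x (2 - I) p k) &
    (forall i, i < 4 -> outside u p (2 - K) x i)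
| TwinOuter of count_mem p u = 4 &
    (twin u x p y /\ twin v x p y) \/ (twin u p x y /\ twin v p x y) &
    encl u p y I J & encl v y p J I
| TwinInner of count_mem p u = 4 &
    (twin u y p x /\ twin v y p x) \/ (twin u p y x /\ twin v p y x) &
    encl u x p I J & encl v p x J I.

Definition even2 (I : nat) : Prop := I = 0 \/ I = 2.

Lemma precE nm u a b i j : a < 3 -> b < 3 -> nm a != nm b ->
  i < count_mem (nm a) u -> j < count_mem (nm b) u ->
  prec nm u a i b j = (pos (nm a) i u < pos (nm b) j u).
Proof. by move=> a3 b3 ab ic jc; rewrite /prec a3 b3 /= before_pos. Qed.

Lemma outP nm u a e b k : a < 3 -> b < 3 -> nm a != nm b ->
  e.+1 < count_mem (nm a) u -> k < count_mem (nm b) u ->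
  reflect (outside u (nm a) e (nm b) k) (outb (prec nm u) a e b k).
Proof.
move=> a3 b3 ab ec kc; rewrite /outb !precE ?(ltnW ec) //; last by rewrite eq_sym.
exact: orP.
Qed.

Lemma enclP nm u a b I J : a < 3 -> b < 3 -> nm a != nm b ->
  count_mem (nm a) u = 4 -> count_mem (nm b) u = 4 -> even2 I -> even2 J ->
  reflect (encl u (nm a) (nm b) I J) (enclb (prec nm u) a b I J).
Proof.
move=> a3 b3 ab ca cb I2 J2; have ba : nm b != nm a by rewrite eq_sym.
have I3 : (2 - I).+1 = 3 - I by case: I2 => ->.
have J3 : (2 - J).+1 = 3 - J by case: J2 => ->.
have lts : [/\ I.+1 < 4, J.+1 < 4, I < 4, J < 4 & (2 - I).+1 < 4 /\ (2 - J).+1 < 4].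
  by case: I2 => ->; case: J2 => ->.
case: lts => I4 J4 I4' J4' [I5 J5].
rewrite /enclb -I3 -J3 !precE ?ca ?cb //.
apply: (iffP and5P) => [[h1 h2 /allP h3 /allP h4 /allP h5]|[h1 h2 h3 h4 h4' h5]].
  split=> //.
  - move=> j j4; have := h3 j; rewrite mem_iota => /(_ j4).
    by rewrite !precE ?ca ?cb ?(ltnW I5) // orbC => /orP.
  - have := h4 (2 - J); rewrite inE eqxx => /(_ isT).
    by rewrite !precE ?ca ?cb ?(ltnW J5) // => /orP.
  - have := h4 (3 - J); rewrite -J3 !inE eqxx orbT => /(_ isT).
    by rewrite !precE ?ca ?cb // => /orP.
  - move=> i i4; have := h5 i; rewrite mem_iota => /(_ i4).
    by rewrite !precE ?ca ?cb ?(ltnW J5) // => /orP.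
split=> //.
- apply/allP => j; rewrite mem_iota add0n => /andP[_ j4].
  by rewrite !precE ?ca ?cb ?(ltnW I5) // orbC; apply/orP; exact: h3.
- apply/allP => j; rewrite !inE => /orP[]/eqP->; rewrite !precE ?ca ?cb ?(ltnW J5) //.
    exact/orP.
  by apply/orP; rewrite J3.
- apply/allP => i; rewrite mem_iota add0n => /andP[_ i4].
  by rewrite !precE ?ca ?cb ?(ltnW J5) //; apply/orP; exact: h5.
Qed.

Lemma twinP nm u a b c : a < 3 -> b < 3 -> c < 3 ->
  nm a != nm b -> nm a != nm c -> nm b != nm c ->
  count_mem (nm a) u = 4 -> count_mem (nm b) u = 4 -> count_mem (nm c) u = 4 ->
  twinb (prec nm u) a b c -> twin u (nm a) (nm b) (nm c).
Proof.
move=> a3 b3 c3 ab ac bc ca cb cc /allP h i i4.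
have ba : nm b != nm a by rewrite eq_sym.
have ca' : nm c != nm a by rewrite eq_sym.
have := h i; rewrite mem_iota => /(_ i4) /and3P[].
rewrite precE ?ca ?cb // => h1 h2 /allP h3; split=> // [i3|k k4].
  by move: h2; rewrite precE ?ca ?cb // => /orP[/eqP|//]; lia.
have := h3 k; rewrite mem_iota => /(_ k4).
by rewrite !precE ?ca ?cb ?cc // => /orP.
Qed.

Lemma sim_triple u v x y p : sim u v -> limited u -> uniq [:: x; y; p] ->
  differ u v x y ->
  triple_okb (prec (nm3 x y p) u) (prec (nm3 x y p) v)
    (count_mem x u) (count_mem y u) (count_mem p u).
Proof.
move=> s lu un d.
have xy : x != y by move: un; rewrite /= !inE; case: eqVneq.
have := triple_ok (limited_sub3 un lu) (on3_sub3 x y p u) (sim_sub3 x y p s)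
  (differ_only01 p xy d).
by rewrite !prec_sub3 // !count_sub3.
Qed.

Lemma even2P I : reflect (even2 I) (I \in [:: 0; 2]).
Proof. by rewrite !inE; apply: (iffP orP) => -[/eqP|/eqP]; [left|right|left|right]. Qed.

Lemma fresh3 (x y : nat) : x != y -> uniq [:: x; y; (x + y).+1].
Proof. by rewrite /= !inE; lia. Qed.

(** Any third letter will do to apply the computation to a pair. *)
Lemma differ_encl u v x y : sim u v -> limited u -> x != y -> differ u v x y ->
  [/\ count_mem x u = 4, count_mem y u = 4 &
    exists I J, [/\ even2 I, even2 J & encl u x y I J \/ encl u y x J I]].
Proof.
move=> s lu xy d; have un := fresh3 xy.
have /andP[/andP[/andP[/eqP cx /eqP cy] /hasP[I I2 /hasP[J J2 h]]] _] := sim_triple s lu un d.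
split=> //; exists I, J; split; [exact/even2P|exact/even2P|].
have yx : y != x by rewrite eq_sym.
case/orP: h => h; [left|right].
  by have /enclP := h; apply => //; exact/even2P.
by have /enclP := h; apply => //; exact/even2P.
Qed.

Lemma encl_switched u v x y I J : sim u v -> limited u -> limited v -> x != y ->
  differ u v x y -> even2 I -> even2 J -> encl u x y I J ->
  encl v y x J I /\ forall i j, i < 4 -> j < 4 ->
    (i \in [:: I; I.+1]) && (j \in [:: J; J.+1]) = false ->
    (pos x i u < pos y j u) = (pos x i v < pos y j v).
Proof.
move=> s lu lv xy d I2 J2 ov; have un := fresh3 xy.
have [cx cy _] := differ_encl s lu xy d.
have yx : y != x by rewrite eq_sym.
have cx' : count_mem x v = 4 by rewrite -(sim_count x s lu lv).
have cy' : count_mem y v = 4 by rewrite -(sim_count y s lu lv).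
have /andP[_ /allP h] := sim_triple s lu un d.
have /allP := h _ (introT (even2P I) I2); move=> /(_ _ (introT (even2P J) J2)).
have -> : enclb (prec (nm3 x y (x + y).+1) u) 0 1 I J.
  by apply/enclP => //.
case/andP => /andP[ov' /allP sw] _; split.
  by have /enclP := ov'; apply.
move=> i j i4 j4 ij; have := sw i; rewrite mem_iota => /(_ i4) /allP h'.
have := h' j; rewrite mem_iota => /(_ j4); rewrite ij /= => /eqP.
by rewrite !precE ?cx ?cy ?cx' ?cy'.
Qed.

Lemma encl_third u v x y p I J : sim u v -> limited u -> limited v ->
  uniq [:: x; y; p] -> differ u v x y -> even2 I -> even2 J -> encl u x y I J ->
  third u v x y p I J.
Proof.
move=> s lu lv un d I2 J2 ov.
have [xy [xp yp]] : x != y /\ x != p /\ y != p.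
  by move: un; rewrite /= !inE; lia.
have [cx cy _] := differ_encl s lu xy d.
have yx : y != x by rewrite eq_sym.
have px : p != x by rewrite eq_sym.
have py : p != y by rewrite eq_sym.
have cE a := sim_count a s lu lv.
have cx' : count_mem x v = 4 by rewrite -cE.
have cy' : count_mem y v = 4 by rewrite -cE.
have /andP[_ /allP h] := sim_triple s lu un d.
have /allP := h _ (introT (even2P I) I2); move=> /(_ _ (introT (even2P J) J2)).
have -> : enclb (prec (nm3 x y p) u) 0 1 I J by apply/enclP => //.
case/andP => _; set L := prec _ u; set L' := prec _ v.
have I3 : I.+1 < 4 /\ (2 - I).+1 < 4 by case: I2 => ->.
have J3 : J.+1 < 4 /\ (2 - J).+1 < 4 by case: J2 => ->.
have J22 : even2 (2 - J) by case: J2 => ->; [right|left].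
rewrite /third_letterb; case: ifP => [aw _|_].
  apply: Away => [k kc|j k j4 kc].
    have /allP := aw => /(_ k); rewrite mem_iota => /(_ kc) /and4P[h1 h2 h3 _].
    split.
    - by have /outP := h1; apply; rewrite ?cx //; case: I3.
    - by have /outP := h2; apply; rewrite ?cx //; case: I3.
    - by have /outP := h3; apply; rewrite ?cy //; case: J3.
  have /allP := aw => /(_ k); rewrite mem_iota => /(_ kc) /and4P[_ _ _ /allP h4].
  have := h4 j; rewrite mem_iota => /(_ j4) /eqP.
  by rewrite /L /L' !precE ?cy ?cy' -?cE.
have next K : even2 K -> nextb L L' (count_mem p u) I J K -> third u v x y p I J.
  move=> K2 /and5P[/eqP cp h1 h2 /allP h3 /allP h4].
  have cp' : count_mem p v = 4 by rewrite -cE.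
  apply: (Next (K := K)) => //.
  - by have /enclP := h1; apply.
  - by have /enclP := h2; apply.
  - move=> k k4; have := h3 k; rewrite mem_iota => /(_ k4) /andP[h31 h32].
    split.
      by have /outP := h31; apply; rewrite ?cx ?cp //; case: I3.
    by have /outP := h32; apply; rewrite ?cx ?cp //; case: I3.
  - move=> i i4; have := h4 i; rewrite mem_iota => /(_ i4) h5.
    by have /outP := h5; apply; rewrite ?cp ?cx //; case: K2 => ->.
case/or4P => [|||/or3P[]].
- by apply: next; left.
- by apply: next; right.
- case/and5P => /eqP cp t t' o o'; have cp' : count_mem p v = 4 by rewrite -cE.
  apply: TwinOuter => //.
  + by left; split; [apply: (twinP _ _ _ _ _ _ _ _ _ t)|apply: (twinP _ _ _ _ _ _ _ _ _ t')].
  + by have /enclP := o; apply.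
  + by have /enclP := o'; apply.
- case/and5P => /eqP cp t t' o o'; have cp' : count_mem p v = 4 by rewrite -cE.
  apply: TwinOuter => //.
  + by right; split; [apply: (twinP _ _ _ _ _ _ _ _ _ t)|apply: (twinP _ _ _ _ _ _ _ _ _ t')].
  + by have /enclP := o; apply.
  + by have /enclP := o'; apply.
- case/and5P => /eqP cp t t' o o'; have cp' : count_mem p v = 4 by rewrite -cE.
  apply: TwinInner => //.
  + by left; split; [apply: (twinP _ _ _ _ _ _ _ _ _ t)|apply: (twinP _ _ _ _ _ _ _ _ _ t')].
  + by have /enclP := o; apply.
  + by have /enclP := o'; apply.
- case/and5P => /eqP cp t t' o o'; have cp' : count_mem p v = 4 by rewrite -cE.
  apply: TwinInner => //.
  + by right; split; [apply: (twinP _ _ _ _ _ _ _ _ _ t)|apply: (twinP _ _ _ _ _ _ _ _ _ t')].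
  + by have /enclP := o; apply.
  + by have /enclP := o'; apply.
Qed.

Lemma before_filter x y j w :
  before x y j (filter (pred2 x y) w) = before x y j w.
Proof.
elim: w j => [//|a w IH] j.
have -> : filter (pred2 x y) (a :: w) =
    if (a == x) || (a == y) then a :: filter (pred2 x y) w else filter (pred2 x y) w by [].
rewrite [RHS]/=; case ay: (a == y).
  by rewrite orbT /= ay; case: j => [|j] //; rewrite IH.
by case ax: (a == x); rewrite /= ?ay ?ax IH.
Qed.

Lemma differ_order u v x y i j : x != y ->
  i < count_mem x u -> j < count_mem y u -> i < count_mem x v -> j < count_mem y v ->
  (pos x i u < pos y j u) != (pos x i v < pos y j v) -> differ u v x y.
Proof.
move=> xy iu ju iv jv; apply: contra_neqN => /eqP e.
by rewrite -!before_pos // -before_filter e before_filter.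
Qed.

Lemma pos_mono4 u x : count_mem x u = 4 ->
  [/\ pos x 0 u < pos x 1 u, pos x 1 u < pos x 2 u & pos x 2 u < pos x 3 u].
Proof. by move=> c; split; apply: pos_lt; rewrite ?c. Qed.

(** Such letters are glued: they can be treated as a single letter. *)
Definition follows (u : word) (a b : nat) : Prop :=
  [/\ a != b, count_mem a u = 4, count_mem b u = 4 &
      forall i, i < 4 -> pos b i u = (pos a i u).+1].

Lemma twin_spec u a b c : twin u a b c ->
  [/\ [/\ pos a 0 u < pos b 0 u, pos a 1 u < pos b 1 u, pos a 2 u < pos b 2 u &
          pos a 3 u < pos b 3 u],
      [/\ pos b 0 u < pos a 1 u, pos b 1 u < pos a 2 u & pos b 2 u < pos a 3 u] &
      forall i k, i < 4 -> k < 4 -> pos c k u < pos a i u \/ pos b i u < pos c k u].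
Proof.
move=> t; split; [split|split|].
- by case: (t 0 isT).
- by case: (t 1 isT).
- by case: (t 2 isT).
- by case: (t 3 isT).
- by case: (t 0 isT) => _ h _; apply: h.
- by case: (t 1 isT) => _ h _; apply: h.
- by case: (t 2 isT) => _ h _; apply: h.
- by move=> i k i4 k4; case: (t i i4) => _ _; apply.
Qed.

Ltac norm_idx :=
  rewrite -?[2 - 0]/2 -?[2 - 2]/0 -?[3 - 0]/3 -?[3 - 2]/1.

(** A twin p that does not follow x immediately is separated from it by a letter,
    which differs from y because p is a twin with respect to y. *)
Lemma not_follows u x p y : x != p -> y != x -> y != p -> count_mem x u = 4 -> count_mem p u = 4 ->
  count_mem y u = 4 -> twin u x p y -> ~ follows u x p ->
  exists i r k, [/\ i < 4, uniq [:: x; y; r] && uniq [:: p; y; r],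
    k < count_mem r u, pos x i u < pos r k u & pos r k u < pos p i u].
Proof.
move=> xp yx yp cx cp cy t nf.
have [i [i4 ne]] : exists i, i < 4 /\ pos p i u != (pos x i u).+1.
  apply: contrapT => no; apply: nf; split=> // i i4.
  by apply/eqP; apply: contrapT => /negP h; apply: no; exists i.
have [ti _ _] := t i i4.
have lt : (pos x i u).+1 < pos p i u by move: ne ti; case: ltngtP; lia.
have szp : pos p i u < size u by apply: pos_size; rewrite cp.
have [k kc kE] := pos_exists (ltn_trans lt szp).
set r := nth 0 u _ in kc kE.
have [mx1 mx2 mx3] := pos_mono4 cx; have [mp1 mp2 mp3] := pos_mono4 cp.
have [[a0 a1 a2 a3] [b0 b1 b2] cc] := twin_spec t.
exists i, r, k; rewrite kE; split=> //.
have rx : r != x.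
  apply/eqP => rx; rewrite rx cx in kc kE.
  by clear -i4 kc kE lt mx1 mx2 mx3 b0 b1 b2; move: i4 kc kE lt;
    case: i => [|[|[|[|i]]]]; case: k => [|[|[|[|k]]]]; lia.
have rp : r != p.
  apply/eqP => rp; rewrite rp cp in kc kE.
  by clear -i4 kc kE lt mp1 mp2 mp3 mx1 mx2 mx3 b0 b1 b2; move: i4 kc kE lt;
    case: i => [|[|[|[|i]]]]; case: k => [|[|[|[|k]]]]; lia.
have ry : r != y.
  apply/eqP => ry; rewrite ry cy in kc kE.
  by have := cc i k i4 kc; lia.
by rewrite /= !inE; move: rx rp ry yx yp; clear; lia.
Qed.

(** Suppose that p does not follow x, and let r stand between them. With
    respect to x, y the letter r has one of the places of the definition of
    third, and likewise with respect to p, y. These are compatible only if r is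
    a twin of x as well, closer to x than p; so the nearest twin follows x. *)
Lemma outer_follows u v x y p I J :
  sim u v -> limited u -> limited v -> x != y -> differ u v x y ->
  even2 I -> even2 J -> encl u x y I J ->
  p != x -> p != y -> count_mem p u = 4 -> twin u x p y ->
  encl u p y I J -> encl v y p J I -> exists q, follows u x q.
Proof.
move=> s lu lv xy d I2 J2 ov.
have [cx cy _] := differ_encl s lu xy d.
have cE a := sim_count a s lu lv.
have [n] := ubnP (pos p I u); elim: n p => // n IH p pn px py cp tp op op'.
have [|nf] := pselect (follows u x p); first by exists p.
have xp : x != p by rewrite eq_sym.
have yx : y != x by rewrite eq_sym.
have yp : y != p by rewrite eq_sym.
have [i [r [k [i4 /andP[un un'] kc lt1 lt2]]]] := not_follows xp yx yp cx cp cy tp nf.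
have I4 : I < 4 by case: I2 => ->.
have J4 : J < 4 by case: J2 => ->.
have dp : differ u v p y.
  apply: (@differ_order u v p y I J) => //; rewrite -?cE ?cp ?cy //.
  by case: op => -> _ _ _ _ _; case: op' => h _ _ _ _ _; rewrite ltnNge (ltnW h).
have t1 := encl_third s lu lv un d I2 J2 ov.
have t2 := encl_third s lu lv un' dp I2 J2 op.
have [mx1 mx2 mx3] := pos_mono4 cx; have [mp1 mp2 mp3] := pos_mono4 cp.
have [my1 my2 my3] := pos_mono4 cy.
have [[a0 a1 a2 a3] [b0 b1 b2] cc] := twin_spec tp.
have k4 : k < 4 by apply: leq_trans kc (lu r).
have [rx [rp ry]] : r != x /\ r != p /\ r != y.
  by move: un un'; rewrite /= !inE; clear; lia.
(* If r avoids both pairs of x, it stands after an occurrence of x that closes a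
   pair, and then inside a pair of p. *)
have odd_i : (outside u x I r k /\ outside u x (2 - I) r k) -> i = I.+1 \/ i = 3 - I.
  rewrite /outside => -[]; clear -I2 i4 lt1 lt2 mx1 mx2 mx3 b0 b1 b2.
  by case: I2 => ->; case: i i4 lt1 lt2 => [|[|[|[|i]]]] //=; norm_idx; lia.
have even_i : i = I.+1 \/ i = 3 - I -> outside u p I r k -> outside u p (2 - I) r k -> False.
  rewrite /outside; clear -I2 i4 lt1 lt2 mp1 mp2 mp3 a0 a1 a2 a3 b0 b1 b2.
  by case: I2 => ->; case: i i4 lt1 lt2 => [|[|[|[|i]]]] //=; norm_idx; lia.
have r_outside_x : (forall k, k < count_mem r u ->
     outside u x I r k /\ outside u x (2 - I) r k) ->
   (count_mem r u = 4 -> encl u r y I J -> encl v y r J I -> False) -> False.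
  move=> out no.
  have oi := odd_i (out k kc).
  case: t2 => [out2 _|K _ _ _ _ out2 _|cr [[tw _]|[tw _]] o2 o2'|cr [[tw _]|[tw _]] _ _].
  - by have [h1 h2 _] := out2 k kc; exact: even_i oi h1 h2.
  - by have [h1 h2] := out2 k k4; exact: even_i oi h1 h2.
  - exact: no.
  - exact: no.
  - have Jc : J < count_mem r u by rewrite cr.
    have [h _] := out J Jc.
    have [[c0 c1 c2 c3] [d0 d1 d2] _] := twin_spec tw.
    case: ov op h => o1 o2 _ _ _ _ _.
    rewrite /outside; clear -I2 J2 o1 o2 c0 c1 c2 c3 d0 d1 d2 my1 my2 my3.
    by move: o1 o2; case: I2 => ->; case: J2 => -> /=; norm_idx; lia.
  - have Jc : J.+1 < count_mem r u by rewrite cr; case: J2 => ->.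
    have [h _] := out J.+1 Jc.
    have [[c0 c1 c2 c3] [d0 d1 d2] _] := twin_spec tw.
    case: ov op h => o1 o2 _ _ _ _ _.
    rewrite /outside; clear -I2 J2 o1 o2 c0 c1 c2 c3 d0 d1 d2 my1 my2 my3.
    by move: o1 o2; case: I2 => ->; case: J2 => -> /=; norm_idx; lia.
case: t1 => [out1 ord1|K K2 cr o1 o1' out1 _|cr [[tw _]|[tw _]] o1 o1'|cr tw o1 _].
- exfalso; apply: r_outside_x => [k' k'c|cr o o'].
    by have [] := out1 k' k'c.
  have I4c : I < count_mem r u by rewrite cr.
  have := ord1 J I J4 I4c.
  by case: o => h _ _ _ _ _; case: o' => h' _ _ _ _ _; rewrite h' ltnNge (ltnW h).
- exfalso; apply: r_outside_x => [k' k'c|_ o o'].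
    by apply: out1; rewrite -cr.
  have [mr1 mr2 mr3] := pos_mono4 cr.
  case: o o1 => h1 h2 _ _ _ hg [g1 g2 _ _ _ _].
  have g3 := hg (2 - I); have g4 := hg (3 - I).
  rewrite /outside in g3 g4.
  move: h1 h2 g1 g2; clear -I2 J2 K2 g3 g4 my1 my2 my3 mr1 mr2 mr3.
  by move: g3 g4; case: I2 => ->; case: J2 => ->; case: K2 => -> /=; norm_idx; lia.
- have [rp_lt|pr_le] := ltnP (pos r I u) (pos p I u).
    by apply: (IH r) => //; exact: leq_trans rp_lt pn.
  exfalso.
  have I4c : I < count_mem r u by rewrite cr.
  have I4p : I < count_mem p u by rewrite cp.
  have pr_lt : pos p I u < pos r I u.
    by rewrite ltn_neqAle pr_le pos_neq // eq_sym.
  have [mr1 mr2 mr3] := pos_mono4 cr.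
  have [[c0 c1 c2 c3] [d0 d1 d2] ccr] := twin_spec tw.
  have ki : k = i.
    clear -i4 k4 lt1 lt2 mr1 mr2 mr3 c0 c1 c2 c3 d0 d1 d2 b0 b1 b2.
    by case: i i4 lt1 lt2 => [|[|[|[|i]]]] //; case: k k4 => [|[|[|[|k]]]] //; lia.
  subst k.
  have in_gap : ~ outside u p I r I.
    case: op o1 => _ o2 _ _ _ _ [o3 _ _ _ _ _]; rewrite /outside.
    clear -pr_lt o2 o3 J2 my1 my2 my3.
    by case: J2 o2 o3 => ->; lia.
  case: t2 => [out2 _|K _ _ _ _ out2 _|_ [[tw2 _]|[tw2 _]] _ _|_ [[tw2 _]|[tw2 _]] _ _].
  + by case: (out2 I I4c).
  + by case: (out2 I I4).
  + by have [h _ _] := tw2 i i4; lia.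
  + by have [h _ _] := tw2 I I4; lia.
  + have := ccr J J J4 J4; have [h1 _ _] := tw J J4; have [h3 h2 _] := tw2 J J4.
    case: ov => o2 o3 _ _ _ _; clear -I2 J2 h1 h2 h3 o2 o3 mx1 mx2 mx3 my1 my2 my3.
    by move: h1 h2 h3 o2 o3; case: I2 => ->; case: J2 => -> /=; lia.
  + have J41 : J.+1 < 4 by case: J2 => ->.
    have := ccr _ _ J41 J4; have [h1 _ _] := tw _ J41; have [h3 _ _] := tw2 _ J41.
    have [_ h2 _] := tw2 J J4.
    case: ov => o2 o3 _ _ _ _; clear -I2 J2 h1 h2 h3 o2 o3 mx1 mx2 mx3 my1 my2 my3.
    by move: h1 h2 h3 o2 o3; case: I2 => ->; case: J2 => -> /=; lia.
- exfalso; have [mr1 mr2 mr3] := pos_mono4 cr.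
  have I41 : I.+1 < 4 by case: I2 => ->.
  have [[c0 c1 c2 c3] [d0 d1 d2] ccr] := twin_spec tw.
  have ki : k = i.+1.
    clear -i4 k4 lt1 lt2 mr1 mr2 mr3 c0 c1 c2 c3 d0 d1 d2 b0 b1 b2.
    by case: i i4 lt1 lt2 => [|[|[|[|i]]]] //; case: k k4 => [|[|[|[|k]]]] //; lia.
  subst k.
  have in_gap : ~ outside u p I r I.+1.
    have [h _ _] := tw _ I41; have [h' _ _] := tp _ I41.
    case: op o1 => o2 _ _ _ _ _ [_ o3 _ _ _ _]; rewrite /outside.
    clear -o2 o3 J2 my1 my2 my3 h h'.
    by case: J2 o2 o3 => ->; lia.
  case: t2 => [out2 _|K _ _ _ _ out2 _|_ [[tw2 _]|[tw2 _]] _ _|_ [[tw2 _]|[tw2 _]] _ _].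
  + by case: (out2 I.+1); rewrite ?cr.
  + by case: (out2 I.+1 I41).
  + by have [h _ _] := tw2 I I4; have [h1 _ _] := tw I I4; have [h2 _ _] := tp I I4; lia.
  + by have [_ h _] := tw2 i i4; have := h k4; lia.
  + have J41 : J.+1 < 4 by case: J2 => ->.
    have := ccr _ _ J4 J41; have [h1 _ _] := tw J J4; have [h3 h2 _] := tw2 J J4.
    case: ov => o2 o3 _ _ _ _; clear -I2 J2 h1 h2 h3 o2 o3 mx1 mx2 mx3 my1 my2 my3.
    by move: h1 h2 h3 o2 o3; case: I2 => ->; case: J2 => -> /=; lia.
  + have J41 : J.+1 < 4 by case: J2 => ->.
    have := ccr _ _ J41 J41; have [h1 _ _] := tw _ J41; have [h3 _ _] := tw2 _ J41.
    have [_ h2 _] := tw2 J J4.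
    case: ov => o2 o3 _ _ _ _; clear -I2 J2 h1 h2 h3 o2 o3 mx1 mx2 mx3 my1 my2 my3.
    by move: h1 h2 h3 o2 o3; case: I2 => ->; case: J2 => -> /=; lia.
- exfalso; have [mr1 mr2 mr3] := pos_mono4 cr.
  have J41 : J.+1 < 4 by case: J2 => ->.
  have yr : pos y J u < pos r J.+1 u.
    case: tw => -[tw _].
      have [h _ _] := tw _ J41; clear -h J2 my1 my2 my3.
      by case: J2 h => -> /=; lia.
    by have [_ h _] := tw J J4; apply: h; case: J2 => ->.
  have in_gap : ~ outside u p I r J.+1.
    have I41 : I.+1 < 4 by case: I2 => ->.
    have [h' _ _] := tp _ I41.
    case: op o1 => o2 _ _ _ _ _ [_ o3 _ _ _ _]; rewrite /outside.
    clear -o2 o3 yr h'; lia.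
  case: t2 => [out2 _|K _ _ _ _ out2 _|_ [[tw2 _]|[tw2 _]] o2 _|_ tw2 o2 _].
  + by case: (out2 J.+1); rewrite ?cr.
  + by case: (out2 J.+1 J41).
  + have [[c0 c1 c2 c3] [d0 d1 d2] _] := twin_spec tw2.
    case: o1 o2 => _ o3 _ _ _ _ [o4 _ _ _ _ _].
    clear -I2 J2 yr o3 o4 c0 c1 c2 c3 d0 d1 d2 a0 a1 a2 a3 b0 b1 b2 mr1 mr2 mr3 mx1 mx2 mx3.
    by move: yr o3 o4; case: I2 => ->; case: J2 => -> /=; lia.
  + case: o2 => o3 o4 _ _ _ _.
    have ry' : pos r J u < pos y J.+1 u.
      case: tw => -[tw _]; last by have [h _ _] := tw J J4; clear -h J2 my1 my2 my3; case: J2 h => -> /=; lia.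
      by have [_ h _] := tw J J4; apply: h; case: J2 => ->.
    have ry2 : pos y J u < pos r J u \/ pos r J.+1 u < pos y J.+1 u.
      case: tw => -[tw _]; first by left; case: (tw J J4).
      by right; case: (tw _ J41).
    clear -I2 J2 yr ry' ry2 o3 o4 mr1 mr2 mr3 my1 my2 my3.
    by move: yr ry' ry2 o3 o4; case: I2 => ->; case: J2 => -> /=; lia.
  + case: o1 o2 => _ o3 o4 o5 o6 _ [o7 _ o8 o9 o10 _].
    have h1 := o4 k k4; have h2 := o8 k k4; clear o4 o8.
    rewrite /outside in h1 h2 o5 o6 o9 o10.
    clear -I2 J2 i4 k4 lt1 lt2 o3 o5 o6 o7 o9 o10 h1 h2 mx1 mx2 mx3 mp1 mp2 mp3 mr1 mr2 mr3
      a0 a1 a2 a3 b0 b1 b2.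
    move: o3 o5 o6 o7 o9 o10 h1 h2; case: I2 => ->; case: J2 => ->; norm_idx => /=;
      move: lt1 lt2 i4 k4; case: i => [|[|[|[|i]]]] //; case: k => [|[|[|[|k]]]] // *; lia.
Qed.

(** The same for twins that come before x; the nearest one now has the last
    possible position. *)
Lemma outer_preceded u v x y p I J :
  sim u v -> limited u -> limited v -> x != y -> differ u v x y ->
  even2 I -> even2 J -> encl u x y I J ->
  p != x -> p != y -> count_mem p u = 4 -> twin u p x y ->
  encl u p y I J -> encl v y p J I -> exists q, follows u q x.
Proof.
move=> s lu lv xy d I2 J2 ov.
have [cx cy _] := differ_encl s lu xy d.
have cE a := sim_count a s lu lv.
have [n] := ubnP (size u - pos p I.+1 u); elim: n p => // n IH p pn px py cp tp op op'.
have [|nf] := pselect (follows u p x); first by exists p.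
have xp : x != p by rewrite eq_sym.
have yx : y != x by rewrite eq_sym.
have yp : y != p by rewrite eq_sym.
have [i [r [k [i4 /andP[un' un] kc lt1 lt2]]]] := not_follows px yp yx cp cx cy tp nf.
have I4 : I < 4 by case: I2 => ->.
have I41 : I.+1 < 4 by case: I2 => ->.
have J4 : J < 4 by case: J2 => ->.
have J41 : J.+1 < 4 by case: J2 => ->.
have dp : differ u v p y.
  apply: (@differ_order u v p y I J) => //; rewrite -?cE ?cp ?cy //.
  by case: op => -> _ _ _ _ _; case: op' => h _ _ _ _ _; rewrite ltnNge (ltnW h).
have t1 := encl_third s lu lv un d I2 J2 ov.
have t2 := encl_third s lu lv un' dp I2 J2 op.
have [mx1 mx2 mx3] := pos_mono4 cx; have [mp1 mp2 mp3] := pos_mono4 cp.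
have [my1 my2 my3] := pos_mono4 cy.
have [[a0 a1 a2 a3] [b0 b1 b2] cc] := twin_spec tp.
have k4 : k < 4 by apply: leq_trans kc (lu r).
have [rx [rp ry]] : r != x /\ r != p /\ r != y.
  by move: un un'; rewrite /= !inE; clear; lia.
(* If r avoids both pairs of x, it stands before an occurrence of x that opens a
   pair, and then inside a pair of p. *)
have even_i : (outside u x I r k /\ outside u x (2 - I) r k) -> i = I \/ i = 2 - I.
  rewrite /outside => -[]; clear -I2 i4 lt1 lt2 mx1 mx2 mx3 b0 b1 b2.
  by case: I2 => ->; case: i i4 lt1 lt2 => [|[|[|[|i]]]] //=; norm_idx; lia.
have odd_i : i = I \/ i = 2 - I -> outside u p I r k -> outside u p (2 - I) r k -> False.
  rewrite /outside; clear -I2 i4 lt1 lt2 mp1 mp2 mp3 a0 a1 a2 a3 b0 b1 b2.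
  by case: I2 => ->; case: i i4 lt1 lt2 => [|[|[|[|i]]]] //=; norm_idx; lia.
have r_outside_x : (forall k, k < count_mem r u ->
     outside u x I r k /\ outside u x (2 - I) r k) ->
   (count_mem r u = 4 -> encl u r y I J -> encl v y r J I -> False) -> False.
  move=> out no.
  have oi := even_i (out k kc).
  case: t2 => [out2 _|K _ _ _ _ out2 _|cr [[tw _]|[tw _]] o2 o2'|cr [[tw _]|[tw _]] _ _].
  - by have [h1 h2 _] := out2 k kc; exact: odd_i oi h1 h2.
  - by have [h1 h2] := out2 k k4; exact: odd_i oi h1 h2.
  - exact: no.
  - exact: no.
  - have Jc : J < count_mem r u by rewrite cr.
    have [h _] := out J Jc.
    have [[c0 c1 c2 c3] [d0 d1 d2] _] := twin_spec tw.
    case: ov op h => o1 o2 _ _ _ _ _.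
    rewrite /outside; clear -I2 J2 o1 o2 c0 c1 c2 c3 d0 d1 d2 my1 my2 my3.
    by move: o1 o2; case: I2 => ->; case: J2 => -> /=; norm_idx; lia.
  - have Jc : J.+1 < count_mem r u by rewrite cr; case: J2 => ->.
    have [h _] := out J.+1 Jc.
    have [[c0 c1 c2 c3] [d0 d1 d2] _] := twin_spec tw.
    case: ov op h => o1 o2 _ _ _ _ _.
    rewrite /outside; clear -I2 J2 o1 o2 c0 c1 c2 c3 d0 d1 d2 my1 my2 my3.
    by move: o1 o2; case: I2 => ->; case: J2 => -> /=; norm_idx; lia.
case: t1 => [out1 ord1|K K2 cr o1 o1' out1 _|cr [[tw _]|[tw _]] o1 o1'|cr tw o1 _].
- exfalso; apply: r_outside_x => [k' k'c|cr o o'].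
    by have [] := out1 k' k'c.
  have I4c : I < count_mem r u by rewrite cr.
  have := ord1 J I J4 I4c.
  by case: o => h _ _ _ _ _; case: o' => h' _ _ _ _ _; rewrite h' ltnNge (ltnW h).
- exfalso; apply: r_outside_x => [k' k'c|_ o o'].
    by apply: out1; rewrite -cr.
  have [mr1 mr2 mr3] := pos_mono4 cr.
  case: o o1 => h1 h2 _ _ _ hg [g1 g2 _ _ _ _].
  have g3 := hg (2 - I); have g4 := hg (3 - I).
  rewrite /outside in g3 g4.
  move: h1 h2 g1 g2; clear -I2 J2 K2 g3 g4 my1 my2 my3 mr1 mr2 mr3.
  by move: g3 g4; case: I2 => ->; case: J2 => ->; case: K2 => -> /=; norm_idx; lia.
- exfalso; have [mr1 mr2 mr3] := pos_mono4 cr.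
  have [[c0 c1 c2 c3] [d0 d1 d2] ccr] := twin_spec tw.
  have ki : i = k.+1.
    clear -i4 k4 lt1 lt2 mr1 mr2 mr3 c0 c1 c2 c3 d0 d1 d2 b0 b1 b2.
    by case: i i4 lt1 lt2 => [|[|[|[|i]]]] //; case: k k4 => [|[|[|[|k]]]] //; lia.
  subst i.
  have in_gap : ~ outside u p I r I.
    have [h _ _] := tw _ I4; have [h' _ _] := tp _ I4.
    case: op o1 => _ o2 _ _ _ _ [o3 _ _ _ _ _]; rewrite /outside.
    clear -o2 o3 J2 my1 my2 my3 h h'.
    by case: J2 o2 o3 => ->; lia.
  case: t2 => [out2 _|K _ _ _ _ out2 _|_ [[tw2 _]|[tw2 _]] _ _|_ [[tw2 _]|[tw2 _]] _ _].
  + by case: (out2 I); rewrite ?cr.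
  + by case: (out2 I I4).
  + by have [_ h _] := tw2 k k4; have := h i4; lia.
  + by have [h _ _] := tw2 I I4; have [h1 _ _] := tw I I4; have [h2 _ _] := tp I I4; lia.
  + have := ccr J J J4 J4; have [h1 _ _] := tw J J4; have [h3 h2 _] := tw2 J J4.
    case: ov => o2 o3 _ _ _ _; clear -I2 J2 h1 h2 h3 o2 o3 mx1 mx2 mx3 my1 my2 my3.
    by move: h1 h2 h3 o2 o3; case: I2 => ->; case: J2 => -> /=; norm_idx; lia.
  + have := ccr _ _ J41 J4; have [h1 _ _] := tw _ J41; have [h3 _ _] := tw2 _ J41.
    have [_ h2 _] := tw2 J J4.
    case: ov => o2 o3 _ _ _ _; clear -I2 J2 h1 h2 h3 o2 o3 mx1 mx2 mx3 my1 my2 my3.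
    by move: h1 h2 h3 o2 o3; case: I2 => ->; case: J2 => -> /=; norm_idx; lia.
- have I4c : I.+1 < count_mem r u by rewrite cr.
  have I4p : I.+1 < count_mem p u by rewrite cp.
  have [rp_lt|pr_le] := ltnP (pos p I.+1 u) (pos r I.+1 u).
    have sz : size u - pos r I.+1 u < n.
      have := pos_size I4c; move: pn rp_lt; clear.
      by move: (size u) (pos r I.+1 u) (pos p I.+1 u); lia.
    exact: (IH r).
  exfalso.
  have pr_lt : pos r I.+1 u < pos p I.+1 u.
    by rewrite ltn_neqAle pr_le pos_neq.
  have [mr1 mr2 mr3] := pos_mono4 cr.
  have [[c0 c1 c2 c3] [d0 d1 d2] ccr] := twin_spec tw.
  have ki : k = i.
    clear -i4 k4 lt1 lt2 mr1 mr2 mr3 c0 c1 c2 c3 d0 d1 d2 b0 b1 b2.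
    by case: i i4 lt1 lt2 => [|[|[|[|i]]]] //; case: k k4 => [|[|[|[|k]]]] //; lia.
  subst k.
  have in_gap : ~ outside u p I r I.+1.
    case: op o1 => o2 _ _ _ _ _ [_ o3 _ _ _ _]; rewrite /outside.
    clear -pr_lt o2 o3 J2 my1 my2 my3.
    by case: J2 o2 o3 => ->; lia.
  case: t2 => [out2 _|K _ _ _ _ out2 _|_ [[tw2 _]|[tw2 _]] _ _|_ [[tw2 _]|[tw2 _]] _ _].
  + by case: (out2 I.+1 I4c).
  + by case: (out2 I.+1 I41).
  + by have [h _ _] := tw2 _ I41; lia.
  + by have [h _ _] := tw2 i i4; lia.
  + have := ccr _ _ J4 J41; have [h1 _ _] := tw J J4; have [h3 h2 _] := tw2 J J4.
    case: ov => o2 o3 _ _ _ _; clear -I2 J2 h1 h2 h3 o2 o3 mx1 mx2 mx3 my1 my2 my3.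
    by move: h1 h2 h3 o2 o3; case: I2 => ->; case: J2 => -> /=; norm_idx; lia.
  + have := ccr _ _ J41 J41; have [h1 _ _] := tw _ J41; have [h3 _ _] := tw2 _ J41.
    have [_ h2 _] := tw2 J J4.
    case: ov => o2 o3 _ _ _ _; clear -I2 J2 h1 h2 h3 o2 o3 mx1 mx2 mx3 my1 my2 my3.
    by move: h1 h2 h3 o2 o3; case: I2 => ->; case: J2 => -> /=; norm_idx; lia.
- exfalso; have [mr1 mr2 mr3] := pos_mono4 cr.
  have [yr ry' ry2] : [/\ pos y J u < pos r J.+1 u, pos r J u < pos y J.+1 u &
      pos y J u < pos r J u \/ pos r J.+1 u < pos y J.+1 u].
    case: tw => -[tw _]; have [h1 h2 _] := tw J J4; have [h3 _ _] := tw _ J41.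
      split; [|by apply: h2; case: J2 => ->|by left].
      by clear -h1 h2 h3 J2 my1 my2 my3; case: J2 h1 h2 h3 => -> /=; lia.
    split; [by apply: h2; case: J2 => ->| |by right].
    by clear -h1 h2 h3 J2 my1 my2 my3; case: J2 h1 h2 h3 => -> /=; lia.
  have in_gap : ~ outside u p I r J.
    have [h' _ _] := tp _ I4.
    case: op o1 => _ o2 _ _ _ _ [o3 _ _ _ _ _]; rewrite /outside.
    by clear -o2 o3 ry' h'; lia.
  have no_encl : encl u r y I J -> False.
    case=> o3 o4 _ _ _ _.
    clear -I2 J2 yr ry' ry2 o3 o4 mr1 mr2 mr3 my1 my2 my3.
    by move: yr ry' ry2 o3 o4; case: I2 => ->; case: J2 => -> /=; norm_idx; lia.
  case: t2 => [out2 _|K _ _ _ _ out2 _|_ tw2 o2 _|_ tw2 o2 _].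
  + by case: (out2 J); rewrite ?cr.
  + by case: (out2 J J4).
  + exact: no_encl.
  + case: o1 o2 => o3 _ o4 o5 o6 _ [_ o7 o8 o9 o10 _].
    have h1 := o4 k k4; have h2 := o8 k k4; clear o4 o8.
    rewrite /outside in h1 h2 o5 o6 o9 o10.
    clear -I2 J2 i4 k4 lt1 lt2 o3 o5 o6 o7 o9 o10 h1 h2 mx1 mx2 mx3 mp1 mp2 mp3 mr1 mr2 mr3
      a0 a1 a2 a3 b0 b1 b2.
    move: o3 o5 o6 o7 o9 o10 h1 h2; case: I2 => ->; case: J2 => ->; norm_idx => /=;
      move: lt1 lt2 i4 k4; case: i => [|[|[|[|i]]]] //; case: k => [|[|[|[|k]]]] // *; lia.
Qed.

Lemma same_order u v x y i j : x != y -> differ u v x y = false ->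
  i < count_mem x u -> j < count_mem y u -> i < count_mem x v -> j < count_mem y v ->
  (pos x i u < pos y j u) = (pos x i v < pos y j v).
Proof.
move=> xy d iu ju iv jv; have [//|h] := eqVneq (pos x i u < pos y j u) (pos x i v < pos y j v).
by rewrite (differ_order xy iu ju iv jv h) in d.
Qed.

Lemma gap_letter u x y i j : i < count_mem x u -> j < count_mem y u ->
  pos x i u < pos y j u -> pos y j u != (pos x i u).+1 ->
  exists r k, [/\ k < count_mem r u, pos x i u < pos r k u & pos r k u < pos y j u].
Proof.
move=> ix jy lt ne; have lt1 : (pos x i u).+1 < pos y j u.
  by rewrite ltn_neqAle eq_sym ne lt.
have [k kc kE] := pos_exists (ltn_trans lt1 (pos_size jy)).
by eexists; exists k; split; first exact: kc; rewrite kE.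
Qed.

Lemma follows_no_encl u a b I J : follows u a b -> even2 I -> even2 J ->
  ~ encl u a b I J /\ ~ encl u b a I J.
Proof.
move=> [ab ca cb h] I2 J2; have [m1 m2 m3] := pos_mono4 ca.
have := h 0 isT; have := h 1 isT; have := h 2 isT; have := h 3 isT.
move=> h3 h2 h1 h0.
split=> -[o1 o2 _ _ _ _]; move: o1 o2; case: I2 => ->; case: J2 => ->;
  rewrite ?h0 ?h1 ?h2 ?h3; move: m1 m2 m3; clear; lia.
Qed.

(** If c stood between a and b in v, then c would change its order with a or b,
    and the place of the remaining letter as a third letter is impossible,
    because in u the letters a and b are adjacent everywhere. *)
Lemma follows_sim u v a b : sim u v -> limited u -> limited v ->
  follows u a b -> follows v a b.
Proof.
move=> s lu lv f; have [ab ca cb h] := f.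
have cE z := sim_count z s lu lv.
have ba : b != a by rewrite eq_sym.
have [m1 m2 m3] := pos_mono4 ca; have [n1 n2 n3] := pos_mono4 cb.
have := h 0 isT; have := h 1 isT; have := h 2 isT; have := h 3 isT => h3 h2 h1 h0.
have nd : differ u v a b = false.
  case d : (differ u v a b) => //; exfalso; have [_ _ [I [J [I2 J2 o]]]] := differ_encl s lu ab d.
  have [na _] := follows_no_encl f I2 J2; have [_ nb] := follows_no_encl f J2 I2.
  by case: o => [/na|/nb].
have ca' : count_mem a v = 4 by rewrite -cE.
have cb' : count_mem b v = 4 by rewrite -cE.
have ltv i : i < 4 -> pos a i v < pos b i v.
  by move=> i4; rewrite -(same_order ab nd) ?ca ?cb ?ca' ?cb' // h.
have gtv i : i < 3 -> pos b i v < pos a i.+1 v.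
  move=> i3; have dba : differ u v b a = false by rewrite differ_sym.
  have i4 : i < 4 by exact: ltnW.
  have ib : i < count_mem b u by rewrite cb.
  have ia : i.+1 < count_mem a u by rewrite ca.
  rewrite -(same_order ba dba) ?ca' ?cb' //.
  have := pos_neq ba ib ia; have := pos_lt (ltnSn i) ia; rewrite h //; clear; lia.
have [w1 w2 w3] := pos_mono4 ca'; have [z1 z2 z3] := pos_mono4 cb'.
split=> // i i4; apply/eqP; apply: contraT => ne; exfalso.
have ia : i < count_mem a v by rewrite ca'.
have ib : i < count_mem b v by rewrite cb'.
have [c [k [kc l1 l2]]] := gap_letter ia ib (ltv i i4) ne.
have k4 : k < 4 by exact: leq_trans kc (lv c).
have [g0 g1 g2] : [/\ pos b 0 v < pos a 1 v, pos b 1 v < pos a 2 v & pos b 2 v < pos a 3 v].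
  by split; apply: gtv.
have cna : c != a.
  apply/eqP => E; rewrite {}E in l1 l2 kc.
  clear -i4 k4 l1 l2 w1 w2 w3 g0 g1 g2; move: i4 l1 l2;
    case: i => [|[|[|[|i]]]]; case: k k4 => [|[|[|[|k]]]]; lia.
have cnb : c != b.
  have l0 := ltv 0 isT; have l1' := ltv 1 isT; have l2' := ltv 2 isT; have l3 := ltv 3 isT.
  apply/eqP => E; rewrite {}E in l1 l2 kc.
  clear -i4 k4 l1 l2 z1 z2 z3 g0 g1 g2 l0 l1' l2' l3; move: i4 l1 l2;
    case: i => [|[|[|[|i]]]]; case: k k4 => [|[|[|[|k]]]]; lia.
have kcu : k < count_mem c u by rewrite cE.
have iau : i < count_mem a u by rewrite ca.
have ibu : i < count_mem b u by rewrite cb.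
have twin_v : ~ twin v a b c.
  by move=> t; have [_ _ /(_ k k4)] := t i i4; move: l1 l2; clear; lia.
have twin_u : ~ twin u b a c by move=> t; have [] := t 0 isT; rewrite h0; lia.
have [cab|abc] : pos c k u < pos a i u \/ pos b i u < pos c k u.
  rewrite h //; have := pos_neq cna kcu iau; have := pos_neq cnb kcu ibu; rewrite h //.
  by clear; lia.
- have d : differ u v a c.
    apply: (@differ_order u v a c i k); rewrite 1?eq_sym // l1.
    by rewrite ltnNge ltnW.
  have ac : a != c by rewrite eq_sym.
  have [_ cc [I [J [I2 J2 o]]]] := differ_encl s lu ac d.
  have nE := follows_no_encl f.
  case: o => o.
    have un : uniq [:: a; c; b] by rewrite /= !inE; move: ab cna cnb; clear; lia.
    have gap : ~ outside u a I b I.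
      by rewrite /outside; clear -I2 h0 h2 m1 m2 m3; case: I2 => ->; lia.
    case: (encl_third s lu lv un d I2 J2 o)
      => [o1 _|K _ _ _ _ o1 _|_ [[_ t]|[t _]] _ _|_ _ o1 _].
    + by case: (o1 I); rewrite ?cb //; case: I2 => ->.
    + by case: (o1 I) => //; case: I2 => ->.
    + exact: twin_v t.
    + exact: twin_u t.
    + by case: (nE I J I2 J2).
  move: I J I2 J2 o => J I J2 I2 o.
  have un : uniq [:: c; a; b] by rewrite /= !inE; move: ab cna cnb; clear; lia.
  have gap : ~ outside u a (2 - J) b (2 - J).
    by rewrite /outside; clear -J2 h0 h2 m1 m2 m3; case: J2 => ->; norm_idx; lia.
  have J22 : even2 (2 - J) by case: J2 => ->; [right|left].
  have J24 : 2 - J < 4 by case: J2 => ->.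
  rewrite differ_sym in d.
  case: (encl_third s lu lv un d I2 J2 o)
      => [o1 _|K K2 _ o1 _ _ _|_ _ o1 _|_ [[_ t]|[t _]] _ _].
  + by case: (o1 (2 - J)); rewrite ?cb.
  + by case: (nE _ _ J22 K2).
  + by case: (nE _ _ I2 J2).
  + exact: twin_v t.
  + exact: twin_u t.
have d : differ u v b c.
  apply: (@differ_order u v b c i k); rewrite 1?eq_sym // abc.
  by rewrite ltnNge (ltnW l2).
have bc : b != c by rewrite eq_sym.
have [_ cc [I [J [I2 J2 o]]]] := differ_encl s lu bc d.
have nE := follows_no_encl f.
case: o => o.
  have un : uniq [:: b; c; a] by rewrite /= !inE; move: ab cna cnb; clear; lia.
  have I41 : I.+1 < 4 by case: I2 => ->.
  have gap : ~ outside u b I a I.+1.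
    by rewrite /outside; clear -I2 h0 h1 h2 h3 m1 m2 m3 n1 n2 n3; case: I2 => ->; lia.
  case: (encl_third s lu lv un d I2 J2 o)
      => [o1 _|K _ _ _ _ o1 _|_ [[t _]|[_ t]] _ _|_ _ o1 _].
  + by case: (o1 I.+1); rewrite ?ca.
  + by case: (o1 I.+1).
  + exact: twin_u t.
  + exact: twin_v t.
  + by case: (nE I J I2 J2).
move: I J I2 J2 o => J I J2 I2 o.
have un : uniq [:: c; b; a] by rewrite /= !inE; move: ab cna cnb; clear; lia.
have gap : ~ outside u b (2 - J) a (3 - J).
  rewrite /outside; clear -J2 h0 h1 h2 h3 m1 m2 m3 n1 n2 n3.
  by case: J2 => ->; norm_idx; lia.
have J22 : even2 (2 - J) by case: J2 => ->; [right|left].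
have J34 : 3 - J < 4 by case: J2 => ->.
rewrite differ_sym in d.
case: (encl_third s lu lv un d I2 J2 o)
      => [o1 _|K K2 _ o1 _ _ _|_ _ o1 _|_ [[t _]|[_ t]] _ _].
+ by case: (o1 (3 - J)); rewrite ?ca.
+ by case: (nE _ _ J22 K2).
+ by case: (nE _ _ I2 J2).
+ exact: twin_u t.
+ exact: twin_v t.
Qed.

(** ** Words without glued letters *)

Definition unglued (u : word) : Prop := forall a b, ~ follows u a b.

(** Twins of x, or of y, would make some letter follow another one, in u or in v. *)
Lemma unglued_third u v x y p I J : sim u v -> limited u -> limited v ->
  unglued u -> x != y -> differ u v x y -> even2 I -> even2 J -> encl u x y I J ->
  p != x -> p != y ->
  (forall k, k < count_mem p u -> outside u x I p k /\ outside u x (2 - I) p k) /\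
  ((forall k, k < count_mem p u -> outside u y (2 - J) p k) \/
   exists K, [/\ even2 K, count_mem p u = 4, encl u y p (2 - J) K,
     encl v p y K (2 - J) & forall i, i < 4 -> outside u p (2 - K) x i]).
Proof.
move=> s lu lv ug xy d I2 J2 o px py.
have un : uniq [:: x; y; p] by rewrite /= !inE; move: px py xy; clear; lia.
have [ov _] := encl_switched s lu lv xy d I2 J2 o.
have yx : y != x by rewrite eq_sym.
have d' : differ v u y x by rewrite differC differ_sym.
have uv z := sim_count z s lu lv.
have ugv a b : ~ follows v a b.
  by move=> /(follows_sim (sim_sym s) lv lu); exact: ug.
case: (encl_third s lu lv un d I2 J2 o)
      => [o1 _|K K2 cp o1 o2 o3 o4|cp t o1 o2|cp t o1 o2].
- split=> [k kc|]; first by case: (o1 k kc).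
  by left=> k kc; case: (o1 k kc).
- split=> [k kc|]; first by apply: o3; rewrite -cp.
  by right; exists K.
- exfalso; case: t => -[t _].
    by have [q /ug] := outer_follows s lu lv xy d I2 J2 o px py cp t o1 o2.
  by have [q /ug] := outer_preceded s lu lv xy d I2 J2 o px py cp t o1 o2.
- exfalso; rewrite uv in cp; case: t => -[_ t].
    by have [q /ugv] := outer_follows (sim_sym s) lv lu yx d' J2 I2 ov py px cp t o2 o1.
  by have [q /ugv] := outer_preceded (sim_sym s) lv lu yx d' J2 I2 ov py px cp t o2 o1.
Qed.

Lemma contiguous u x y i j : i < count_mem x u -> j < count_mem y u ->
  pos x i u < pos y j u ->
  (forall r k, k < count_mem r u -> pos x i u < pos r k u -> pos r k u < pos y j u ->
     False) ->
  pos y j u = (pos x i u).+1.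
Proof.
move=> ix jy lt no; apply/eqP; apply: contraT => ne; exfalso.
by have [r [k [kc l1 l2]]] := gap_letter ix jy lt ne; exact: no kc l1 l2.
Qed.

(** A letter in one of these gaps would contradict unglued_third, so the
    enclosing factor and the other pair of x are factors of u itself. *)
Lemma unglued_location u v x y I J : sim u v -> limited u -> limited v ->
  unglued u -> x != y -> differ u v x y -> even2 I -> even2 J -> encl u x y I J ->
  [/\ pos y J u = (pos x I u).+1, pos y J.+1 u = (pos y J u).+1,
      pos x I.+1 u = (pos y J.+1 u).+1 & pos x (3 - I) u = (pos x (2 - I) u).+1].
Proof.
move=> s lu lv ug xy d I2 J2 o.
have [cx cy _] := differ_encl s lu xy d.
have [mx1 mx2 mx3] := pos_mono4 cx; have [my1 my2 my3] := pos_mono4 cy.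
have third r := @unglued_third u v x y r I J s lu lv ug xy d I2 J2 o.
have [I4 I41 J4 J41] : [/\ I < 4, I.+1 < 4, J < 4 & J.+1 < 4].
  by case: I2 => ->; case: J2 => ->.
have [o1 o2 o3 o4 o5 o6] := o.
have yJ : pos y J u < pos y J.+1 u by apply: pos_lt; rewrite ?cy.
have inside r k : k < count_mem r u -> pos x I u < pos r k u ->
    pos r k u < pos x I.+1 u -> pos r k u = pos y J u \/ pos r k u = pos y J.+1 u.
  move=> kc l1 l2; have [E|rx] := eqVneq r x.
    exfalso; rewrite {}E cx in kc l1 l2.
    clear -I2 kc l1 l2 mx1 mx2 mx3; move: l1 l2.
    by case: I2 => ->; case: k kc => [|[|[|[|k]]]]; lia.
  have [E|ry] := eqVneq r y.
    rewrite {}E cy in kc l1 l2 *; rewrite /outside in o4 o5.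
    clear -J2 kc l1 l2 o4 o5 mx1 mx2 mx3; move: l1 l2 o4 o5.
    by case: J2 => ->; norm_idx; case: k kc => [|[|[|[|k]]]] // _; auto; lia.
  have [h _] := third r rx ry; have [h1 _] := h k kc.
  by exfalso; move: h1 l1 l2; rewrite /outside; clear; lia.
have E1 : pos y J u = (pos x I u).+1.
  apply: contiguous; rewrite ?cx ?cy // => r k kc l1 l2.
  have l3 : pos r k u < pos x I.+1 u by move: l2 yJ o2; clear; lia.
  by case: (inside r k kc l1 l3); move: l2 yJ; clear; lia.
have E2 : pos y J.+1 u = (pos y J u).+1.
  apply: contiguous; rewrite ?cx ?cy // => r k kc l1 l2.
  have l3 : pos x I u < pos r k u by move: l1 o1; clear; lia.
  have l4 : pos r k u < pos x I.+1 u by move: l2 o2; clear; lia.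
  by case: (inside r k kc l3 l4); move: l1 l2; clear; lia.
have E3 : pos x I.+1 u = (pos y J.+1 u).+1.
  apply: contiguous; rewrite ?cx ?cy // => r k kc l1 l2.
  have l3 : pos x I u < pos r k u by move: l1 o1 yJ; clear; lia.
  by case: (inside r k kc l3 l2); move: l1 yJ; clear; lia.
split=> //; have lt : pos x (2 - I) u < pos x (3 - I) u.
  by apply: pos_lt; rewrite ?cx; case: I2 => ->.
apply: contiguous; rewrite ?cx //; try by case: I2 => ->.
move=> r k kc l1 l2; have [E|rx] := eqVneq r x.
  rewrite {}E cx in kc l1 l2; move: l1 l2.
  by clear -I2 kc mx1 mx2 mx3; case: I2 => ->; norm_idx;
    case: k kc => [|[|[|[|k]]]]; lia.
have I3 : (2 - I).+1 = 3 - I by case: I2 => ->.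
have [E|ry] := eqVneq r y.
  rewrite {}E cy in kc l1 l2; have := o3 k kc; rewrite /outside I3.
  by move: l1 l2; clear; lia.
have [h _] := third r rx ry; have [_] := h k kc; rewrite /outside I3.
by move: l1 l2; clear; lia.
Qed.

(** A letter between the other two occurrences of y must be placed as in the
    case Next. *)
Lemma unglued_next u v x y I J : sim u v -> limited u -> limited v ->
  unglued u -> x != y -> differ u v x y -> even2 I -> even2 J -> encl u x y I J ->
  pos y (3 - J) u = (pos y (2 - J) u).+1 \/
  exists q K, [/\ q != x, y != q, even2 K, encl u y q (2 - J) K & differ u v y q].
Proof.
move=> s lu lv ug xy d I2 J2 o.
have [cx cy _] := differ_encl s lu xy d.
have [mx1 mx2 mx3] := pos_mono4 cx; have [my1 my2 my3] := pos_mono4 cy.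
have J3 : (2 - J).+1 = 3 - J by case: J2 => ->.
have lt : pos y (2 - J) u < pos y (3 - J) u.
  by apply: pos_lt; rewrite ?cy; case: J2 => ->.
have J24 : 2 - J < 4 by case: J2 => ->.
have iy : 2 - J < count_mem y u by rewrite cy.
have jy : 3 - J < count_mem y u by rewrite cy; case: J2 => ->.
have [->|ne] := eqVneq (pos y (3 - J) u) (pos y (2 - J) u).+1; first by left.
have [r [k [kc l1 l2]]] := gap_letter iy jy lt ne.
right; have rx : r != x.
  apply/eqP => E; rewrite E cx in kc l1 l2.
  by have := encl_gapy o kc; rewrite /outside J3; lia.
have ry : r != y.
  apply/eqP => E; rewrite E cy in kc l1 l2.
  move: l1 l2; clear -J2 kc my1 my2 my3; case: J2 => ->; norm_idx;
    by case: k kc => [|[|[|[|k]]]]; lia.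
have [_ [h|[K [K2 cr o1 o2 _]]]] := unglued_third s lu lv ug xy d I2 J2 o rx ry.
  by have := h k kc; rewrite /outside J3; lia.
exists r, K; split=> //; first by rewrite eq_sym.
have cE z := sim_count z s lu lv.
have K4 : K < 4 by case: K2 => ->.
apply: (@differ_order u v y r (2 - J) K); rewrite 1?eq_sym // -?cE ?cr ?cy //.
by rewrite (encl_left o1) ltnNge (ltnW (encl_left o2)).
Qed.

Lemma split4 (u : word) s a b c d : s + 4 <= size u ->
  nth 0 u s = a -> nth 0 u s.+1 = b -> nth 0 u s.+2 = c -> nth 0 u s.+3 = d ->
  u = take s u ++ [:: a; b; c; d] ++ drop (s + 4) u.
Proof.
move=> sz <- <- <- <-; rewrite -[LHS](cat_take_drop s); congr cat.
rewrite (drop_nth 0) ?(drop_nth 0 (n := s.+1)) ?(drop_nth 0 (n := s.+2))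
  ?(drop_nth 0 (n := s.+3)); try by lia.
by rewrite !addnS addn0.
Qed.

Lemma infix_double_nth (u : word) (s t p x : nat) : s <= t -> t <= size u ->
  nth 0 u p = x -> nth 0 u p.+1 = x ->
  p.+2 <= s \/ t <= p /\ p.+2 <= size u -> flanked x (take s u) (drop t u).
Proof.
move=> st tu h0 h1 [ps|[tp pu]]; [left|right]; apply/infixP.
  exists (take p u), (drop p.+2 (take s u)).
  rewrite -[LHS](cat_take_drop p) take_takel; last by lia.
  congr cat; have sz : size (take s u) = s by rewrite size_takel //; lia.
  rewrite (drop_nth 0) ?sz; last by lia.
  rewrite (drop_nth 0 (n := p.+1)) ?sz; last by lia.
  by rewrite !nth_take ?h0 ?h1 //; lia.
exists (take (p - t) (drop t u)), (drop p.+2 u).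
rewrite -[LHS](cat_take_drop (p - t)); congr cat.
rewrite drop_drop subnK // (drop_nth 0); last by lia.
by rewrite h0 (drop_nth 0) ?h1 //; lia.
Qed.

(** The conditions under which an exchange of x and y applies in u; the square
    of y may be missing. *)
Lemma unglued_split u v x y I J : sim u v -> limited u -> limited v ->
  unglued u -> x != y -> differ u v x y -> even2 I -> even2 J -> encl u x y I J ->
  exists a b, [/\ u = a ++ [:: x; y; y; x] ++ b, flanked x a b &
    pos y (3 - J) u = (pos y (2 - J) u).+1 -> flanked y a b].
Proof.
move=> s lu lv ug xy d I2 J2 o.
have [cx cy _] := differ_encl s lu xy d.
have [E1 E2 E3 E4] := unglued_location s lu lv ug xy d I2 J2 o.
have [I4 I41 J4 J41] : [/\ I < 4, I.+1 < 4, J < 4 & J.+1 < 4].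
  by case: I2 => ->; case: J2 => ->.
have [I24 I34] : 2 - I < 4 /\ 3 - I < 4 by case: I2 => ->.
have [J24 J34] : 2 - J < 4 /\ 3 - J < 4 by case: J2 => ->.
have px i : i < 4 -> nth 0 u (pos x i u) = x by move=> i4; apply: nth_pos; rewrite cx.
have py i : i < 4 -> nth 0 u (pos y i u) = y by move=> i4; apply: nth_pos; rewrite cy.
have szx i : i < 4 -> pos x i u < size u by move=> i4; apply: pos_size; rewrite cx.
have szy i : i < 4 -> pos y i u < size u by move=> i4; apply: pos_size; rewrite cy.
set p := pos x I u in E1 *.
have sz : p + 4 <= size u by have := szx _ I41; lia.
have uE : u = take p u ++ [:: x; y; y; x] ++ drop (p + 4) u.
  apply: split4 => //; first exact: px.
  - by rewrite -E1 py.
  - by rewrite -E1 -E2 py.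
  - by rewrite -E1 -E2 -E3 px.
exists (take p u), (drop (p + 4) u); split=> //.
  apply: (infix_double_nth (p := pos x (2 - I) u)); rewrite ?leq_addr ?px //.
    by rewrite -E4 px.
  have := szx _ I34; rewrite E4 => h.
  have [m1 m2 m3] := pos_mono4 cx; move: E1 E2 E3 E4 h; rewrite /p.
  by clear -I2 m1 m2 m3; case: I2 => ->; norm_idx; lia.
move=> E5; apply: (infix_double_nth (p := pos y (2 - J) u)); rewrite ?leq_addr ?py //.
  by rewrite -E5 py.
have := szy _ J34; rewrite E5 => h.
have [m1 m2 m3] := pos_mono4 cy; move: (encl_other2 o) (encl_other3 o) E1 E2 E3 E5 h; rewrite /p /outside.
by clear -J2 m1 m2 m3; case: J2 => ->; norm_idx; lia.
Qed.

Lemma filter_loc2 (x y c d : nat) (a b : word) : x != y ->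
  (pred2 c d x && pred2 c d y) = false ->
  filter (pred2 c d) (a ++ [:: x; y; y; x] ++ b) =
  filter (pred2 c d) (a ++ [:: y; x; x; y] ++ b).
Proof.
move=> xy h; rewrite !filter_cat.
suff -> : filter (pred2 c d) [:: x; y; y; x] = filter (pred2 c d) [:: y; x; x; y] by [].
by move: h => /=; case: ((x == c) || (x == d)); case: ((y == c) || (y == d)).
Qed.

(** The restrictions to x and y agree up to the exchanged factor, where they
    continue with different letters. *)
Lemma differ_loc2 (x y : nat) (a b a' b' : word) : x != y ->
  filter (pred2 x y) a = filter (pred2 x y) a' ->
  differ (a ++ [:: x; y; y; x] ++ b) (a' ++ [:: y; x; x; y] ++ b') x y.
Proof.
move=> xy E; rewrite /differ !filter_cat E; apply/eqP.
move/(congr1 (nth 0 ^~ (size (filter (pred2 x y) a')))).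
rewrite !nth_cat ltnn subnn /= !eqxx /= orbT /= => e.
by rewrite e eqxx in xy.
Qed.

Lemma pred2_both (c d x y : nat) : x != y -> pred2 c d x -> pred2 c d y ->
  (c = x /\ d = y) \/ (c = y /\ d = x).
Proof.
move=> xy /orP[]/eqP e /orP[]/eqP e'; auto.
all: by case/eqP: xy; rewrite e e'.
Qed.

(** Both v and u' order x and y differently from u, so in both of them y
    encloses x. If they differed from one another, x would enclose y in
    one of them. *)
Lemma agree_after u u' v x y I J : sim u v -> sim u u' -> limited u -> limited v ->
  limited u' -> x != y -> differ u v x y -> even2 I -> even2 J -> encl u x y I J ->
  differ u u' x y -> differ u' v x y = false.
Proof.
move=> s s' lu lv lu' xy d I2 J2 o d'.
have [o1 _] := encl_switched s lu lv xy d I2 J2 o.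
have [o2 _] := encl_switched s' lu lu' xy d' I2 J2 o.
case E : (differ u' v x y) => //; rewrite differ_sym in E.
have yx : y != x by rewrite eq_sym.
have [o3 _] := encl_switched (sim_trans (sim_sym s') s) lu' lv yx E J2 I2 o2.
by have := encl_left o1; have := encl_left o3; lia.
Qed.

(** ** Cells spread over a word *)

Definition cell_at (f : nat -> nat) (z : nat) : word := [:: z; f z; f z; z].

(** Two such factors that overlap share a letter in different roles. An overlap
    by 1 or 4 letters would identify z with z', one by 3 letters f z with f z';
    an overlap by 2 letters gives f (f z) = z or f (f z') = z'. *)
Lemma cells_disjoint f (u a b : word) z z' : u = a ++ cell_at f z ++ b -> z != z' -> f z != f z' ->
  f (f z) != z -> f (f z') != z' ->
  infix (cell_at f z') u ->
  infix (cell_at f z') a \/ infix (cell_at f z') b.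
Proof.
move=> uE zz ff f2 f2' /infixP[a' [b' E]].
have h k : k < 4 -> nth 0 u (size a + k) = nth 0 (cell_at f z) k.
  move=> k4; rewrite uE nth_cat ifF ?ltnNge ?leq_addr // addKn nth_cat ifT //.
have h' k : k < 4 -> nth 0 u (size a' + k) = nth 0 (cell_at f z') k.
  move=> k4; rewrite E nth_cat ifF ?ltnNge ?leq_addr // addKn nth_cat ifT //.
have clash (k k' : nat) : k < 4 -> k' < 4 -> size a + k = size a' + k' ->
    nth 0 (cell_at f z) k = nth 0 (cell_at f z') k'.
  by move=> k4 k4' e; rewrite -h // -h' // e.
have sz : size a + 4 + size b = size a' + 4 + size b'.
  by move/(congr1 size): E; rewrite uE !size_cat /=; lia.
have [le|gt] := leqP (size a' + 4) (size a).
  left; apply/infixP; exists a', (drop (size a' + 4) a).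
  rewrite catA -[LHS](cat_take_drop (size a' + 4)); congr cat.
  have <- : take (size a) u = a by rewrite uE take_size_cat.
  by rewrite take_takel // E (catA a') take_size_cat // size_cat.
have [le|gt'] := leqP (size a + 4) (size a').
  right; apply/infixP; exists (take (size a' - (size a + 4)) b), b'.
  rewrite -[LHS](cat_take_drop (size a' - (size a + 4))); congr cat.
  have <- : drop (size a + 4) u = b by rewrite uE (catA a) drop_size_cat ?size_cat.
  by rewrite drop_drop subnK // E drop_size_cat.
exfalso.
have [e|[[e|e]|[[e|e]|[e|e]]]] : size a = size a' \/ (size a = size a' + 2 \/ size a' = size a + 2) \/
   (size a = size a' + 1 \/ size a' = size a + 1) \/
   (size a = size a' + 3 \/ size a' = size a + 3) by lia.
- by have /= e' := clash 0 0 isT isT ltac:(lia); rewrite e' eqxx in zz.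
- have /= e1 := clash 0 2 isT isT ltac:(lia); have /= e2 := clash 1 3 isT isT ltac:(lia).
  by move: f2'; rewrite -e1 e2 eqxx.
- have /= e1 := clash 2 0 isT isT ltac:(lia); have /= e2 := clash 3 1 isT isT ltac:(lia).
  by move: f2; rewrite e1 -e2 eqxx.
- by have /= e1 := clash 1 2 isT isT ltac:(lia); rewrite e1 eqxx in ff.
- by have /= e1 := clash 2 1 isT isT ltac:(lia); rewrite e1 eqxx in ff.
- by have /= e1 := clash 0 3 isT isT ltac:(lia); rewrite e1 eqxx in zz.
- by have /= e1 := clash 3 0 isT isT ltac:(lia); rewrite e1 eqxx in zz.
Qed.

Definition cells_gaps (f : nat -> nat) (ps : seq (nat * word)) : word :=
  flatten [seq cell_at f p.1 ++ p.2 | p <- ps].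

(** By induction: every cell other than the one of z stands before or after the
    latter. *)
Lemma cells_split f (Z : seq nat) (u : word) : uniq Z ->
  {in Z &, injective f} -> {in Z, forall z, f (f z) != z} ->
  {in Z, forall z, infix (cell_at f z) u} ->
  exists (w0 : word) (ps : seq (nat * word)),
    perm_eq (map fst ps) Z /\ u = w0 ++ cells_gaps f ps.
Proof.
elim: {Z}(size Z) {-2}Z (leqnn (size Z)) u => [|k IH] Z sz u uZ inj f2 inf.
  by case: Z sz uZ inj f2 inf => // *; exists u, [::]; rewrite cats0.
case: Z sz uZ inj f2 inf => [|z Z] /= sz uZ inj f2 inf.
  by exists u, [::]; rewrite cats0.
case/andP: uZ => zZ uZ; have /infixP[a [b uE]] := inf z (mem_head _ _).
pose inA z' := infix (cell_at f z') a.
have sub (P : pred nat) : {subset filter P Z <= z :: Z}.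
  by move=> z'; rewrite mem_filter inE => /andP[_ ->]; rewrite orbT.
have part (P : pred nat) (w : word) : {in filter P Z, forall z', infix (cell_at f z') w} ->
    exists (w0 : word) (ps : seq (nat * word)),
      perm_eq (map fst ps) (filter P Z) /\ w = w0 ++ cells_gaps f ps.
  move=> h; apply: IH => //.
  - by rewrite size_filter; move: (count_size P Z) sz; lia.
  - exact: filter_uniq.
  - by move=> x y /sub xZ /sub yZ; exact: inj.
  - by move=> x /sub; exact: f2.
have [|wa [psa [pa aE]]] := part inA a.
  by move=> z'; rewrite mem_filter => /andP[].
have [|wb [psb [pb bE]]] := part (predC inA) b.
  move=> z' z'F; have zF := sub _ _ z'F; move: z'F; rewrite mem_filter /= => /andP[na z'Z].
  have zz : z != z' by apply: contraNneq zZ => ->.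
  have ff : f z != f z' by apply: contra_neq zz => /inj; apply; rewrite ?mem_head.
  have [ha|//] := cells_disjoint uE zz ff (f2 _ (mem_head _ _)) (f2 _ zF) (inf _ zF).
  by rewrite /inA ha in na.
exists wa, (psa ++ (z, wb) :: psb); split.
  apply/seq.permP => P; have := seq.permP (permEl (perm_filterC inA Z)) P.
  by move: (seq.permP pa P) (seq.permP pb P); rewrite map_cat !count_cat /=; lia.
by rewrite uE {1}aE {1}bE /cells_gaps map_cat flatten_cat /= -!catA.
Qed.

(** ** Chains of exchanged letters *)

(** The links of the chains: x is the outer and y the inner letter of a pair in
    different order. *)
Definition encloses (u v : word) (x y : nat) : Prop :=
  [/\ x != y, differ u v x y & exists I J, [/\ even2 I, even2 J & encl u x y I J]].

Lemma differ_cases u v x y : sim u v -> limited u -> x != y -> differ u v x y ->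
  encloses u v x y \/ encloses u v y x.
Proof.
move=> s lu xy d; have [_ _ [I [J [I2 J2 [o|o]]]]] := differ_encl s lu xy d.
  by left; split=> //; exists I, J.
by right; split; [rewrite eq_sym|rewrite differ_sym|exists J, I].
Qed.

Lemma even2_lt I : even2 I -> [/\ I < 4, I.+1 < 4, 2 - I < 4, 3 - I < 4 & (2 - I).+1 = 3 - I].
Proof. by case=> ->. Qed.

Lemma even2_eq I J : even2 I -> even2 J -> I = J \/ I = 2 - J.
Proof. by case=> ->; case=> ->; auto. Qed.

(** In this section no exchange in u corrects the order of a pair. *)
Section Chain.
Variables u v : word.
Hypotheses (s : sim u v) (lu : limited u) (lv : limited v) (ug : unglued u).

Definition exchangeable (x y : nat) : Prop := exists a b,
  [/\ u = a ++ [:: x; y; y; x] ++ b, flanked x a b & flanked y a b].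

Hypothesis stuck : forall x y, encloses u v x y -> ~ exchangeable x y.

(** If these occurrences were adjacent, the exchange would have both squares. *)
Lemma split_gap x y I J : x != y -> differ u v x y -> even2 I -> even2 J -> encl u x y I J ->
  pos y (3 - J) u != (pos y (2 - J) u).+1.
Proof.
move=> xy d I2 J2 o; apply/eqP => E.
have [a [b [h1 h2 h3]]] := unglued_split s lu lv ug xy d I2 J2 o.
by apply: (@stuck x y); [split=> //; exists I, J|exists a, b; split=> //; exact: h3].
Qed.

(** The pair of y that is enclosed by x is adjacent, so y can only enclose
    something with its other pair. *)
Lemma next_even x y q I J K K' : x != y -> differ u v x y -> even2 I -> even2 J ->
  encl u x y I J -> y != q -> differ u v y q -> even2 K -> even2 K' ->
  encl u y q K K' -> K = 2 - J.
Proof.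
move=> xy d I2 J2 o yq d' K2 K'2 o'.
have [e|//] := even2_eq K2 J2; exfalso.
have [_ h _ _] := unglued_location s lu lv ug xy d I2 J2 o.
have [g1 g2 g3 _] := unglued_location s lu lv ug yq d' K2 K'2 o'.
by move: h g1 g2 g3; rewrite e; clear; lia.
Qed.

(** Two letters enclosing y enclose the same pair of y, because the other pair
    is not adjacent; and the letter before that pair is determined. *)
Lemma encloses_unique x x' y : encloses u v x y -> encloses u v x' y -> x = x'.
Proof.
move=> [xy d [I [J [I2 J2 o]]]] [xy' d' [I' [J' [I2' J2' o']]]].
have [cx cy _] := differ_encl s lu xy d; have [cx' _ _] := differ_encl s lu xy' d'.
have [h1 h2 _ _] := unglued_location s lu lv ug xy d I2 J2 o.
have [h1' h2' _ _] := unglued_location s lu lv ug xy' d' I2' J2' o'.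
have [e|e] := even2_eq J2' J2.
  rewrite e in h1'; have e1 : pos x I u = pos x' I' u by move: h1 h1'; clear; lia.
  have [i4 _ _ _ _] := even2_lt I2; have [i4' _ _ _ _] := even2_lt I2'.
  by rewrite -(@nth_pos x I u) ?cx // e1 nth_pos ?cx'.
have := split_gap xy d I2 J2 o; have [_ _ _ _ <-] := even2_lt J2.
by rewrite -e h2' eqxx.
Qed.

Lemma next_unique x y q q' I J K K' : x != y -> differ u v x y -> even2 I -> even2 J ->
  encl u x y I J -> y != q -> differ u v y q -> even2 K -> even2 K' ->
  encl u y q K K' -> encloses u v y q' -> q = q'.
Proof.
move=> xy d I2 J2 o yq d' K2 K2' o' [yq' d'' [M [M' [M2 M2' o'']]]].
have e := next_even xy d I2 J2 o yq d' K2 K2' o'.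
have e' := next_even xy d I2 J2 o yq' d'' M2 M2' o''.
have [_ cq _] := differ_encl s lu yq d'; have [_ cq' _] := differ_encl s lu yq' d''.
have [h1 _ _ _] := unglued_location s lu lv ug yq d' K2 K2' o'.
have [h1' _ _ _] := unglued_location s lu lv ug yq' d'' M2 M2' o''.
have [i4 _ _ _ _] := even2_lt K2'; have [i4' _ _ _ _] := even2_lt M2'.
by rewrite -(@nth_pos q K' u) ?cq // h1 e -e' -h1' nth_pos ?cq'.
Qed.

Lemma encloses_next x y : encloses u v x y -> exists2 q, encloses u v y q & q != x.
Proof.
move=> [xy d [I [J [I2 J2 o]]]].
have [/eqP h|[q [K [qx yq K2 o' d']]]] := unglued_next s lu lv ug xy d I2 J2 o.
  by rewrite (negPf (split_gap xy d I2 J2 o)) in h.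
by exists q => //; split=> //; exists (2 - J), K; split=> //; case: J2 => ->; [right|left].
Qed.

Lemma no_two_cycle x y q : encloses u v x y -> encloses u v y q -> q != x.
Proof.
move=> xy yq; have [q' [yq' d' [K [K' [K2 K2' o']]]] q'x] := encloses_next xy.
have [xy' d [I [J [I2 J2 o]]]] := xy.
by rewrite -(next_unique xy' d I2 J2 o yq' d' K2 K2' o' yq).
Qed.

(** By unglued_third the pair of q with which q can enclose a letter contains no
    occurrence of x. *)
Lemma no_three_cycle x y q : encloses u v x y -> encloses u v y q -> ~ encloses u v q x.
Proof.
move=> xy yq [qx dq [M [M' [M2 M2' oM]]]].
have qx' := no_two_cycle xy yq.
have [yq' d' [K [K' [K2 K2' o']]]] := yq; have [xy' d [I [J [I2 J2 o]]]] := xy.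
have qy : q != y by rewrite eq_sym.
have [i4 i41 j4 j41 e4] := even2_lt M2'.
have [i4' _ _ _ _] := even2_lt K2'; have [j4' _ _ _ _] := even2_lt J2.
have [_ cq _] := differ_encl s lu yq' d'.
have eK := next_even xy' d I2 J2 o yq' d' K2 K2' o'.
have eM := next_even yq' d' K2 K2' o' qx dq M2 M2' oM.
have [_ [h|[N [N2 cN oN _ hN]]]] := unglued_third s lu lv ug xy' d I2 J2 o qx' qy.
  have := h K'; rewrite cq => /(_ i4'); rewrite /outside -eK.
  have := encl_left o'; have := encl_right o'.
  have : pos q K' u < pos q K'.+1 u by apply: pos_lt; rewrite ?cq; case: K2' => ->.
  by clear; lia.
have eN : M = 2 - N.
  apply: (@next_even y q x K N M M') => //; by rewrite eK.
have := hN M' i4; rewrite -eN /outside.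
have := encl_left oM; have := encl_right oM.
have cx : count_mem x u = 4 by have [] := differ_encl s lu xy' d.
have : pos x M' u < pos x M'.+1 u by apply: pos_lt; rewrite ?cx.
by clear; lia.
Qed.

(** The map from outer to inner letters is injective on the letters that enclose
    something and maps them to such letters. So its orbits are cycles, which
    have more than three elements by the preceding lemmas. *)
Lemma chain_cycle x0 y0 : encloses u v x0 y0 -> exists (f : nat -> nat) z n,
  [/\ 3 < n, uniq (traject f z n), iter n f z = z &
    {in traject f z n, forall x, encloses u v x (f x)}].
Proof.
move=> xy0; have /choice[f fP] : forall x, exists y, (exists y', encloses u v x y') -> encloses u v x y.
  by move=> x; have [[y xy]|no] := pselect (exists y, encloses u v x y); [exists y|exists 0].
have fo k : encloses u v (iter k f x0) (iter k.+1 f x0).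
  elim: k => [|k IH]; first by apply: fP; exists y0.
  by apply: fP; have [q] := encloses_next IH; exists q.
have mem k : iter k f x0 \in undup u.
  have [xy d _] := fo k; have [cx _ _] := differ_encl s lu xy d.
  by rewrite mem_undup -has_pred1 has_count cx.
have ex : exists m, looping f x0 m.
  exists (size (undup u)).+1; rewrite -[looping _ _ _]negbK -looping_uniq; apply/negP => un.
  have sub : {subset traject f x0 (size (undup u)).+2 <= undup u}.
    by move=> x /trajectP[i _ ->].
  by have := uniq_leq_size un sub; rewrite size_traject; lia.
have [n lo min] := ex_minnP ex.
have n0 : 0 < n by case: n lo {min}; rewrite /looping //= in_nil.
have un : uniq (traject f x0 n).
  rewrite -(prednK n0) looping_uniq; apply/negP => /min; lia.
have /trajectP[i i_n iE] := lo.
have inj k l : iter k.+1 f x0 = iter l.+1 f x0 -> iter k f x0 = iter l f x0.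
  by move=> e; apply: encloses_unique (fo k) _; rewrite e; exact: fo.
have cyc : iter n f x0 = x0.
  case: i i_n iE => [//|i] i_n; rewrite -(prednK n0) => /inj e; exfalso.
  have : looping f x0 n.-1 by apply/trajectP; exists i => //; lia.
  by move/min; lia.
exists f, x0, n; split=> //.
  have n1 : n != 1.
    by apply/eqP => e; rewrite e in cyc; have [/eqP h _ _] := fo 0; apply: h; rewrite cyc.
  have n2 : n != 2.
    by apply/eqP => e; have := no_two_cycle (fo 0) (fo 1); rewrite e in cyc; rewrite cyc eqxx.
  have n3 : n != 3.
    apply/eqP => e; rewrite e in cyc; apply: (no_three_cycle (fo 0) (fo 1)).
    by have := fo 2; rewrite cyc.
  by lia.
by move=> x /trajectP[k _ ->]; exact: fo.
Qed.

End Chain.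

(** ** From chains to cyclic identities *)

Lemma cycle_inverse n c : is_cycle n c -> exists d,
  [/\ is_cycle n d, forall i, i < n -> d (c i) = i & forall i, i < n -> c (d i) = i].
Proof.
move=> cyc; have [cn cc] := cyc.
have /choice[d dP] : forall i, exists j, i < n -> j < n /\ c j = i.
  move=> i; case: (ltnP i n) => [ilt|]; last by exists 0.
  by have [j jn cj] := cycle_surj cyc ilt; exists j.
have dn i : i < n -> d i < n by move=> /dP[].
have cd i : i < n -> c (d i) = i by move=> /dP[].
have dc i : i < n -> d (c i) = i.
  by move=> ilt; apply: (cycle_inj cyc) => //; rewrite ?dn ?cd ?cn.
exists d; split=> //; split=> // i j ilt jlt.
have [m <-] := cc j i jlt ilt; exists m.
elim: m => //= m IH; rewrite -iterS iterSr dc //.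
by elim: m {IH} => //= m; exact: cn.
Qed.

(** Renaming each letter l into c l turns the identity of the inverse of c,
    read from right to left, into the identity of c; and c or its inverse is
    canonical. *)
Lemma cycle_deriv n c : 3 < n -> is_cycle n c ->
  deriv cycS (cyc_word n c pred0) (cyc_word n c predT).
Proof.
move=> n3 cyc; have [cn cc] := cyc; have n0 : 0 < n by lia.
have [k kn ck] := cycle_surj cyc n0.
have [lt|gt|E] := ltngtP (c 0) k.
- by apply: (@deriv_id cycS (cyc_id n c)); exists n, c; split=> //; split=> //; exists k.
- have [d [cyd dc cd]] := cycle_inverse cyc.
  have can : cycS (cyc_id n d).
    exists n, d; split=> //; split=> //; exists (c 0).
    by rewrite dc ?cn // -[d 0](congr1 d ck) dc.
  pose th x : word := [:: if x < n then c x else x].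
  have thE fl fl' : (forall l, fl' l = ~~ fl l) ->
      subst th (cyc_word n d fl) = cyc_word n c fl'.
    move=> h; rewrite /cyc_word.
    have : {subset iota 0 n <= gtn n} by move=> l; rewrite mem_iota.
    elim: (iota 0 n) => //= l r IH sub; rewrite subst_cat IH; last first.
      by move=> x xr; apply: sub; rewrite inE xr orbT.
    have ln : l < n by have := sub l; rewrite mem_head => /(_ isT).
    congr cat; rewrite /cell subst_cat h; congr cat; last first.
      by rewrite /subst /th /= ltnNge leq_addr.
    have [dn _] := cyd.
    by case: (fl l); rewrite /subst /th /= dn // ln cd.
  have := deriv_subst th (deriv_id can); rewrite /= (thE _ predT) // (thE _ pred0) //.
  exact: deriv_sym.
- exfalso; have c2 m : iter m c 0 = 0 \/ iter m c 0 = c 0.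
    elim: m => [|m IH] /=; first by left.
    by case: IH => ->; [right|left; rewrite E].
  have [j [jn j0 jc]] : exists j, [/\ j < n, j != 0 & j != c 0].
    have [e|e] := eqVneq (c 0) 1; [exists 2|exists 1]; split=> //; try by lia.
  have [m mj] := cc 0 j n0 jn; case: (c2 m); rewrite mj => e.
    by rewrite e in j0.
  by rewrite e eqxx in jc.
Qed.

Definition gaps_switched (f : nat -> nat) (ps : seq (nat * word)) : word :=
  flatten [seq [:: f p.1; p.1; p.1; f p.1] ++ p.2 | p <- ps].

Lemma cells_gaps_cons f p ps :
  cells_gaps f (p :: ps) = [:: p.1; f p.1; f p.1; p.1] ++ p.2 ++ cells_gaps f ps.
Proof. by []. Qed.

Lemma gaps_switched_cons f p ps :
  gaps_switched f (p :: ps) = [:: f p.1; p.1; p.1; f p.1] ++ p.2 ++ gaps_switched f ps.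
Proof. by []. Qed.

(** Cells on an orbit of f, in whatever order they stand, form an instance of a
    cyclic word: number them in the order of the word, and let c map the number
    of z to that of f z. *)
Lemma cells_deriv f z n ps : 3 < n -> uniq (traject f z n) -> iter n f z = z ->
  perm_eq (map fst ps) (traject f z n) ->
  deriv cycS (cells_gaps f ps) (gaps_switched f ps).
Proof.
move=> n3 un cyc pm; pose zs := map fst ps.
have sz : size zs = n by rewrite (perm_size pm) size_traject.
have szp : size ps = n by rewrite -sz size_map.
have uz : uniq zs by rewrite (perm_uniq pm).
have zsE x : (x \in zs) = (x \in traject f z n) by rewrite (perm_mem pm).
have n0 : 0 < n by lia.
have fzs x : x \in zs -> f x \in zs.
  rewrite !zsE => /trajectP[i i_n ->]; apply/trajectP.
  have [e|lt] : i.+1 = n \/ i.+1 < n by lia.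
    by exists 0 => //; rewrite -iterS e.
  by exists i.+1.
pose c l := index (f (nth 0 zs l)) zs.
have cn i : i < n -> c i < n.
  by move=> i_n; rewrite /c -sz index_mem fzs // mem_nth ?sz.
have nc i : i < n -> nth 0 zs (c i) = f (nth 0 zs i).
  by move=> i_n; rewrite nth_index // fzs // mem_nth ?sz.
have itn m i : i < n -> iter m c i < n /\ nth 0 zs (iter m c i) = iter m f (nth 0 zs i).
  move=> i_n; elim: m => //= m [h1 h2]; split; first exact: cn.
  by rewrite nc // h2.
have cy : is_cycle n c.
  split=> // i j i_n j_n.
  have /trajectP[a a_n aE] : nth 0 zs i \in traject f z n by rewrite -zsE mem_nth ?sz.
  have /trajectP[b b_n bE] : nth 0 zs j \in traject f z n by rewrite -zsE mem_nth ?sz.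
  exists (b + (n - a)); have [h1 h2] := itn (b + (n - a)) i i_n.
  apply/eqP; rewrite -(nth_uniq 0 _ _ uz) ?sz // h2 aE bE.
  by rewrite -iterD -addnA subnK ?(ltnW a_n) // iterD cyc.
pose th x : word := if x < n then [:: nth 0 zs x] else (nth (0, [::]) ps (x - n)).2.
have psE : ps = [seq nth (0, [::]) ps l | l <- iota 0 n].
  by rewrite -szp -/(mkseq _ _) mkseq_nth.
have key (g : nat * word -> word) fl :
    (forall l, l < n -> subst th (cell n c fl l) = g (nth (0, [::]) ps l)) ->
    subst th (cyc_word n c fl) = flatten (map g ps).
  move=> h; rewrite [in RHS]psE -map_comp /cyc_word.
  have : {subset iota 0 n <= gtn n} by move=> l; rewrite mem_iota.
  elim: (iota 0 n) => //= l r IH sub; rewrite subst_cat IH; last first.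
    by move=> x xr; apply: sub; rewrite inE xr orbT.
  by rewrite h //; have := sub l; rewrite mem_head => /(_ isT).
have thl l : l < n -> [/\ th l = [:: (nth (0, [::]) ps l).1],
    th (c l) = [:: f (nth (0, [::]) ps l).1] & th (n + l) = (nth (0, [::]) ps l).2].
  move=> ln; have e : nth 0 zs l = (nth (0, [::]) ps l).1.
    by rewrite (nth_map (0, [::])) ?szp.
  split; first by rewrite /th ln e.
    by rewrite /th cn // nc // e.
  by rewrite /th ltnNge leq_addr addKn.
have := deriv_subst th (cycle_deriv n3 cy).
rewrite (key (fun p => cell_at f p.1 ++ p.2)) ?(key (fun p => [:: f p.1; p.1; p.1; f p.1] ++ p.2)) //.
- by move=> l ln; have [e1 e2 e3] := thl l ln; rewrite /cell !subst_cat !subst_cons e1 e2 e3 /subst /= cats0.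
- by move=> l ln; have [e1 e2 e3] := thl l ln; rewrite /cell !subst_cat !subst_cons e1 e2 e3 /subst /= cats0.
Qed.

(** A cell affects only the order of its own two letters. *)
Lemma differ_cells (f : nat -> nat) (ps : seq (nat * word)) w0 c d :
  {in map fst ps, forall x : nat, x != f x} ->
  differ (w0 ++ cells_gaps f ps) (w0 ++ gaps_switched f ps) c d ->
  exists2 x, x \in map fst ps & (c = x /\ d = f x) \/ (c = f x /\ d = x).
Proof.
move=> fx; rewrite /differ !filter_cat.
have cE (s t t' : word) : t = t' -> s ++ t = s ++ t' by move=> ->.
have [[x xp h]|no] := pselect (exists2 x, x \in map fst ps & pred2 c d x && pred2 c d (f x)).
  by move=> _; exists x => //; case/andP: h => h1 h2; exact: pred2_both (fx _ xp) h1 h2.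
case/eqP; apply: cE.
elim: ps no fx => [|p ps IH] no fx; first by [].
have h : (pred2 c d p.1 && pred2 c d (f p.1)) = false.
  by apply/negP => h; apply: no; exists p.1; rewrite ?mem_head.
have {}IH : filter (pred2 c d) (cells_gaps f ps) = filter (pred2 c d) (gaps_switched f ps).
  apply: IH; first by case=> x xp hx; apply: no; exists x => //; rewrite inE xp orbT.
  by move=> x xp; apply: fx; rewrite inE xp orbT.
have := @filter_loc2 _ _ c d [::] (p.2 ++ cells_gaps f ps) (fx _ (mem_head _ _)) h.
rewrite cells_gaps_cons gaps_switched_cons !cat0s => ->.
by rewrite !filter_cat IH.
Qed.

Definition Sig : set identity := [set e | e \in base \/ cycS e]%classic.

(** Either an exchange is possible for some pair, or all chains close up, and a
    cyclic identity corrects all pairs on one of them. In both cases no other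
    pair is affected. *)
Lemma step_exists (u v : word) (x y : nat) : sim u v -> limited u -> limited v -> unglued u ->
  x != y -> differ u v x y ->
  exists u', [/\ deriv Sig u u',
    forall c d, differ u u' c d -> encloses u v c d \/ encloses u v d c &
    exists c d, encloses u v c d /\ differ u u' c d].
Proof.
move=> s lu lv ug xy0 d0.
have {x y xy0 d0} [x [y xy]] : exists x y, encloses u v x y.
  by case: (differ_cases s lu xy0 d0); [exists x, y|exists y, x].
have [[c [d [cd [a [b [uE fc fd]]]]]]|no] :=
    pselect (exists c d, encloses u v c d /\ exchangeable u c d).
  have cnd : c != d by have [] := cd.
  exists (a ++ [:: d; c; c; d] ++ b); split.
  - apply: (@deriv_mono baseS); first by move=> e; left.
    by rewrite uE; exact: exchange_letters.
  - move=> p q; rewrite /differ {1}uE.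
    case h : (pred2 p q c && pred2 p q d); last by rewrite (filter_loc2 _ _ cnd h) eqxx.
    move=> _; case/andP: h => h1 h2.
    by case: (pred2_both cnd h1 h2) => -[-> ->]; [left|right].
  - by exists c, d; split=> //; rewrite {1}uE; apply: differ_loc2.
have stuck c d : encloses u v c d -> ~ exchangeable u c d.
  by move=> h1 h2; apply: no; exists c, d.
have [f [z [n [n3 un cyc fo]]]] := chain_cycle s lu lv ug stuck xy.
have ffo : {in traject f z n, forall x, f x \in traject f z n}.
  move=> t /trajectP[i i_n ->]; apply/trajectP.
  have [e|lt] : i.+1 = n \/ i.+1 < n by lia.
    by exists 0; rewrite // -?iterS ?e //; lia.
  by exists i.+1.
have inj : {in traject f z n &, injective f}.
  by move=> t t' tz t'z e; apply: (encloses_unique s lu lv ug stuck (fo t tz)); rewrite e; exact: fo.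
have f2 : {in traject f z n, forall t, f (f t) != t}.
  move=> t tz; exact: (no_two_cycle s lu lv ug stuck (fo _ tz) (fo _ (ffo _ tz))).
have inf : {in traject f z n, forall t, infix (cell_at f t) u}.
  move=> t tz; have [tf d [I [J [I2 J2 o]]]] := fo t tz.
  have [a [b [-> _ _]]] := unglued_split s lu lv ug tf d I2 J2 o.
  by apply/infixP; exists a, b.
have [w0 [ps [pm uE]]] := cells_split un inj f2 inf.
have memE t : (t \in map fst ps) = (t \in traject f z n) by rewrite (perm_mem pm).
exists (w0 ++ gaps_switched f ps); split.
- rewrite uE; apply: deriv_catl; apply: (@deriv_mono cycS); first by move=> e; right.
  exact: cells_deriv n3 un cyc pm.
- move=> c d; rewrite {1}uE => /differ_cells[|t tp h].
    by move=> t; rewrite memE => /fo[].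
  by rewrite memE in tp; case: h => -[-> ->]; [left|right]; exact: fo.
- case: ps pm uE memE => [|p ps] pm uE memE.
    by have := perm_size pm; rewrite size_traject /=; lia.
  have pz : p.1 \in traject f z n by rewrite -memE mem_head.
  exists p.1, (f p.1); split; first exact: fo.
  have [pf _ _] := fo _ pz; rewrite {1}uE.
  rewrite cells_gaps_cons gaps_switched_cons.
  exact: (@differ_loc2 _ _ w0 _ w0 _ pf erefl).
Qed.

(** * Soundness and completeness *)

Lemma deriv_sim u v : deriv Sig u v -> sim u v.
Proof.
move=> + th; elim=> {u v} [w|a b th' e Se|u v _ IH|v u w _ IH1 _ IH2].
- exact: deriv_refl.
- rewrite !subst_cat; apply: deriv_cat; case: Se => [eb|[n [c [[n3 cyc _] ->]]]] /=.
    by apply: deriv_subst; apply: deriv_subst; exact: (@deriv_id baseS).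
  have E w : subst (code th) (subst th' w) =
      subst (code (fun x => flatten (map th (th' x)))) w.
    by rewrite subst_comp; apply: eq_subst => x _; rewrite /code map_flatten -map_comp.
  by rewrite !E; exact: cyc_sound.
- exact: deriv_sym.
- exact: deriv_trans IH1 IH2.
Qed.

Lemma sim_count_min u v a : sim u v ->
  minn 5 (count_mem a u) = minn 5 (count_mem a v).
Proof.
move=> s; have un : uniq [:: a; a.+1; a.+2] by rewrite /= !inE; lia.
have := base_count_min 0 (@sim_sub3 a a.+1 a.+2 _ _ s).
by rewrite !count_sub3.
Qed.

Lemma sim_limited u v : sim u v -> limited u -> limited v.
Proof.
by move=> s lu a; have := sim_count_min a s; have := lu a; lia.
Qed.

Lemma sim_filter (P : pred nat) u v : sim u v -> sim (filter P u) (filter P v).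
Proof.
move=> s th; have E w : subst (code th) (filter P w) =
    subst (code (fun x => if P x then th x else [::])) w.
  rewrite filter_as_subst subst_comp; apply: eq_subst => x _.
  by rewrite {2}/code; case: (P x); rewrite /subst /= ?cats0.
by rewrite !E; exact: s.
Qed.

Lemma limited_filter (P : pred nat) u : limited u -> limited (filter P u).
Proof.
move=> lu a; rewrite count_filter; apply: leq_trans (lu a).
by apply: sub_count => x /= /andP[].
Qed.

(** The restrictions to one and to two letters determine the first letter. *)
Lemma eq_of_pairs (u v : word) : (forall x y, differ u v x y = false) -> u = v.
Proof.
have E w w' x y : differ w w' x y = false -> filter (pred2 x y) w = filter (pred2 x y) w'.
  by move/negbT; rewrite negbK => /eqP.
elim: u v => [|a u IH] [|b v] // h.
- by have /E := h b b; rewrite /= eqxx.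
- by have /E := h a a; rewrite /= eqxx.
have ab : a = b.
  by have /E := h a b; rewrite /= !eqxx orbT /= => -[].
rewrite -ab in h *; congr cons; apply: IH => x y.
apply/negbTE; rewrite negbK; have /E /= := h x y.
by case: ifP => _ => [[->]|->].
Qed.

(** ** Correcting one pair after the other *)

Definition disagreements (u v : word) : nat :=
  count (fun p => differ u v p.1 p.2) (allpairs pair (undup v) (undup v)).

(** Induction on the number of pairs in different order: a step corrects the
    pairs that it changes, and the new word is again without glued letters
    because glueing is the same in all equivalent words. *)
Lemma unglued_complete u v : sim u v -> limited u -> limited v -> unglued u ->
  deriv Sig u v.
Proof.
have [k] := ubnP (disagreements u v); elim: k u => // k IH u dk s lu lv ug.
have [[x [y [xy d]]]|no] := pselect (exists x y, x != y /\ differ u v x y); last first.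
  rewrite (@eq_of_pairs u v); first exact: deriv_refl.
  move=> x y; have [<-|xy] := eqVneq x y; last first.
    by case d : (differ u v x y) => //; case: no; exists x, y.
  apply/negbTE; rewrite negbK; apply/eqP.
  have E w : filter (pred2 x x) w = nseq (count_mem x w) x.
    by elim: w => //= z w ->; rewrite orbb; have [->|] := eqVneq z x.
  by rewrite !E (sim_count x s lu lv).
have [u' [st only [c [e [ce dce]]]]] := step_exists s lu lv ug xy d.
have s' := deriv_sim st; have lu' := sim_limited s' lu.
have fixed p q : differ u u' p q -> differ u' v p q = false.
  have main p' q' : encloses u v p' q' -> differ u u' p' q' -> differ u' v p' q' = false.
    by move=> [pq dpq [I [J [I2 J2 o]]]]; exact: (agree_after s s' lu lv lu' pq dpq I2 J2 o).
  move=> dpq; case: (only _ _ dpq) => h; first exact: main.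
  by rewrite differ_sym; apply: main => //; rewrite differ_sym.
apply: deriv_trans st _; apply: IH => //.
- suff : disagreements u' v < disagreements u v by move: dk; clear; lia.
  have [cne dv _] := ce.
  have [cc ee _] := differ_encl s lu cne dv.
  have mem z : count_mem z u = 4 -> z \in undup v.
    by move=> cz; rewrite mem_undup -has_pred1 has_count -(sim_count z s lu lv) cz.
  have cem : (c, e) \in allpairs pair (undup v) (undup v).
    by apply/allpairsP; exists (c, e); rewrite /= !mem.
  have sub : subpred (fun p => differ u' v p.1 p.2) (fun p => differ u v p.1 p.2).
    move=> [p q] /=; case dpq : (differ u u' p q); first by rewrite fixed.
    by move/negbT: dpq; rewrite negbK /differ => /eqP ->.
  rewrite /disagreements.
  have /perm_to_rem pr := cem; rewrite !(seq.permP pr) /= fixed // dv add0n add1n ltnS.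
  exact: sub_count.
- exact: sim_trans (sim_sym s') s.
- by move=> a b /(follows_sim (sim_sym s') lu' lu); exact: ug.
Qed.

(** ** Contracting glued letters *)

(** If b always follows a, then b can be erased and restored by a
    substitution. *)
Lemma follows_factor (a b : nat) (w : word) n : a != b ->
  count_mem a w = n -> count_mem b w = n ->
  (forall i, i < n -> pos b i w = (pos a i w).+1) ->
  w = subst (fun x => if x == a then [:: a; b] else [:: x]) (filter (predC1 b) w).
Proof.
move=> ab; have ba : b == a = false by rewrite eq_sym; apply: negPf.
have [k] := ubnP (size w); elim: k w n => // k IH [|z w] n //= sz.
have [->|za] := eqVneq z a.
  rewrite (negPf ab) add0n; case: n => [|n] //= [ca] cb h.
  have [p0] := h 0 isT.
  have := @nth_pos b 0 w; rewrite cb p0 => /(_ isT).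
  case: w sz ca cb h {p0} => [|y w] /= sz ca cb h.
    by [].
  move=> yb; rewrite {y}yb eqxx /= in ca cb h *; rewrite ba add0n in ca.
  have [cb'] := cb; rewrite subst_cons eqxx /=; congr [:: _, _ & _].
  apply: (IH w n) => //; first by move: sz; clear; lia.
  by move=> i i_n; have := h i.+1 i_n; rewrite ba; case.
have [->|zb] := eqVneq z b.
  by case: n => [|n] //= _ _ /(_ 0 isT).
rewrite !add0n subst_cons (negPf za) /= => ca cb h; congr cons.
apply: (IH w n) => // i i_n.
by have := h i i_n; case.
Qed.

(** A letter b that follows a in u does so in v as well, by follows_sim; hence
    the same substitution restores it in both words. *)
Lemma limited_complete u v : sim u v -> limited u -> limited v -> deriv Sig u v.
Proof.
have [k] := ubnP (size u); elim: k u v => // k IH u v sz s lu lv.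
have [[a [b f]]|no] := pselect (exists a b, follows u a b); last first.
  by apply: unglued_complete => // a b f; apply: no; exists a, b.
have [ab ca cb h] := f; have [_ ca' cb' h'] := follows_sim s lu lv f.
rewrite (follows_factor ab ca cb h) (follows_factor ab ca' cb' h').
apply: deriv_subst; apply: IH; [|exact: sim_filter|exact: limited_filter..].
have E : count_mem b u + count (predC1 b) u = size u by exact: (count_predC (pred1 b) u).
apply: (@leq_trans (size u)); last by rewrite -ltnS.
by rewrite size_filter -E cb addSn ltnS leq_addl.
Qed.

(** Both words lose the same letters, which leave equal prefixes. *)
Lemma sim_complete u v : sim u v -> deriv Sig u v.
Proof.
move=> s; pose E := [seq x <- undup u | 4 < count_mem x u].
have uE : uniq E by rewrite filter_uniq // undup_uniq.
have mE x : (x \in E) = (4 < count_mem x u).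
  rewrite mem_filter mem_undup -has_pred1 has_count; lia.
have mE' x : (x \in E) = (4 < count_mem x v).
  by rewrite mE; have := sim_count_min x s; lia.
have lim w : (forall x, (x \in E) = (4 < count_mem x w)) -> limited (filter [predC E] w).
  move=> h a; rewrite count_filter leqNgt; apply/negP => lt.
  have : 4 < count_mem a w by apply: leq_trans lt _; apply: sub_count => x /= /andP[].
  rewrite -h => aE; move: lt; rewrite (@eq_count _ _ pred0) ?count_pred0 // => x /=.
  by have [->|//] := eqVneq x a; rewrite aE.
have base_Sig w w' : deriv baseS w w' -> deriv Sig w w'.
  by apply: deriv_mono => e; left.
have ku : deriv Sig u (flatten [seq nseq 5 x | x <- E] ++ filter [predC E] u).
  by apply/base_Sig/kill_letters => // x; rewrite mE.
have kv : deriv Sig v (flatten [seq nseq 5 x | x <- E] ++ filter [predC E] v).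
  by apply/base_Sig/kill_letters => // x; rewrite mE'.
apply: deriv_trans ku _; apply: deriv_trans (deriv_sym kv); apply: deriv_catl.
by apply: limited_complete; [exact: sim_filter|exact: lim..].
Qed.

(** * The theorem *)

(** These cycles, one for each n > 3, make the basis infinite. *)
Lemma rotation_canonical n : 3 < n -> canonical_cycle n (fun i => i.+1 %% n).
Proof.
move=> n3; have n0 : 0 < n by exact: leq_trans n3.
split=> //; last first.
  have n1 : 1 < n by exact: leq_trans n3.
  by exists n.-1; rewrite prednK // modnn (modn_small n1); split=> //; lia.
split=> [i _|i j i_n j_n]; first by rewrite ltn_mod.
exists (j + (n - i)).
have it m : iter m (fun i => i.+1 %% n) i = (i + m) %% n.
  elim: m => [|m IH]; first by rewrite addn0 modn_small.
  by rewrite iterS IH -addn1 modnDml addn1 addnS.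
by rewrite it addnC -addnA subnK ?(ltnW i_n) // modnDr modn_small.
Qed.

(** Cyclic words have at least 20 letters. *)
Lemma base_not_cyclic e : e \in base -> ~ cycS e.
Proof.
move=> eb [n [c [[n3 _ _] E]]]; have : size e.1 = 5 * n by rewrite E size_cyc_word.
have : size e.1 < 20 by move: eb; rewrite !inE => /or4P[|||/orP[]] /eqP ->.
lia.
Qed.

Local Open Scope classical_set_scope.

Theorem mainTheorem1 :
  exists M : monoidType, finite_set [set: M] /\
  exists Sigma : set identity,
    [/\ infinite_set Sigma,
        (forall e : identity, satisfies M e <-> consequence Sigma e) &
        irredundant Sigma].
Proof.
have [M [finM satM]] := monoid_exists; exists M; split=> //.
have [F [sub core irr]] := irredundant_core base_not_cyclic.
exists [set x | x \in F \/ cycS x]%classic; split.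
- pose rot n := cyc_id (n + 4) (fun i => i.+1 %% (n + 4)).
  move=> fin; apply: infinite_nat.
  have inj : {in rot @^-1` [set x | x \in F \/ cycS x] &, injective rot}%classic.
    move=> m n _ _ /(congr1 (fun e : identity => size e.1)).
    by rewrite !size_cyc_word; lia.
  have := finite_preimage inj fin; congr (finite_set _); apply/seteqP; split=> // n _.
  right; exists (n + 4), (fun i => i.+1 %% (n + 4)); split=> //.
  by apply: rotation_canonical; lia.
- move=> [u v]; rewrite core satM; split=> [s|]; first exact/deriv_sound/sim_complete.
  by move/consequence_deriv/deriv_sim.
move=> e [/irr //|ce] cons; case: (ce) => n [c [can E]].
apply: (cyc_id_independent can); rewrite -E => N NS; apply: cons => x [[xF|cx] xe].
  by apply: NS; split=> //; left; exact: sub.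
by apply: NS; split=> //; right.
Qed.
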